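(* There exist positive constants $K$ and $C$ and $n_0\in\mathbb{N}$ such that the following holds for all $n\ge n_0$. Let $k=\lfloor K\log^3 n\rfloor$ and suppose that $k$ divides $n$. Let $d$ be a positive integer and $\lambda>0$ a real number with $\lambda\le \frac{d}{C\log^3 n}$. Then every $(n,d,\lambda)$-graph $G$ contains a $C_k$-factor.
   Context: All graphs are finite and simple. An $(n,d,\lambda)$-graph is a $d$-regular graph on $n$ vertices whose adjacency matrix has second largest eigenvalue in absolute value at most $\lambda$; that is, if $d=\lambda_1\ge\lambda_2\ge\dots\ge\lambda_n$ are the eigenvalues (with multiplicity), then $|\lambda_i|\le\lambda$ for all $2\le i\le n$. $C_k$ denotes the cycle on $k$ vertices. An $F$-factor in $G$ is a collection of vertex-disjoint copies of $F$ (not necessarily induced subgraphs) in $G$ covering every vertex of $G$. $\log$ is the natural logarithm and $\log^3 n=(\log n)^3$. *)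

(* Defs.v *)
From mathcomp Require Import all_boot all_order all_algebra.
From mathcomp Require Import reals exp.

Set Implicit Arguments.
Unset Strict Implicit.
Unset Printing Implicit Defensive.

Import Order.TTheory GRing.Theory Num.Theory.
Local Open Scope ring_scope.

Record sgraph := SGraph {
  vertex :> finType;
  adj : rel vertex;
  adj_sym : symmetric adj;
  adj_irrefl : irreflexive adj
}.

Definition regular (G : sgraph) (d : nat) : Prop :=
  forall x : G, #|[set y | adj x y]| = d.

Definition adjmx (R : nzRingType) (G : sgraph) : 'M[R]_#|G| :=
  \matrix_(i, j) (adj (enum_val i) (enum_val j))%:R.

(* [s] lists the eigenvalues of [A] with algebraic multiplicity, in
   non-increasing order; the factorization forces [size s = m]. *)
Definition spectrum (R : realType) (m : nat) (A : 'M[R]_m) (s : seq R) : Prop :=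
  sorted >=%R s /\ char_poly A = \prod_(a <- s) ('X - a%:P).

(* Eigenvalues are indexed from 0: [s`_0] is lambda_1 in the usual numbering.
   Some [s] always satisfies [spectrum], since [adjmx R G] is real symmetric. *)
Definition ndl_graph (R : realType) (n d : nat) (lambda : R) (G : sgraph)
    : Prop :=
  [/\ #|G| = n, regular G d
    & exists s : seq R,
        [/\ spectrum (adjmx R G) s, s`_0 = d%:R
          & forall i : nat, (0 < i < n)%N -> `|s`_i| <= lambda]].

(* The conjunct [i != j] matters only for [k = 1], where it removes the loop;
   for [k >= 3] this is the usual cycle. *)
Definition cycle_adj (k : nat) : rel 'I_k :=
  fun i j => (i != j) && ((j == i.+1 %% k :> nat) || (i == j.+1 %% k :> nat))%N.

Lemma cycle_adj_sym (k : nat) : symmetric (@cycle_adj k).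
Proof. by move=> i j; rewrite /cycle_adj eq_sym orbC. Qed.

Lemma cycle_adj_irrefl (k : nat) : irreflexive (@cycle_adj k).
Proof. by move=> i; rewrite /cycle_adj eqxx. Qed.

Definition cycle_graph (k : nat) : sgraph :=
  SGraph (@cycle_adj_sym k) (@cycle_adj_irrefl k).

(* A copy of [F] in [G], not necessarily induced, is given by an injective
   adjacency-preserving map. *)
Definition is_copy (F G : sgraph) (f : {ffun F -> G}) : Prop :=
  injective f /\ {homo f : x y / adj x y}.

Definition has_factor (F G : sgraph) : Prop :=
  exists P : {set {ffun F -> G}},
    [/\ forall f, f \in P -> is_copy f,
        forall f g, f \in P -> g \in P -> f != g ->
          [disjoint codom f & codom g]
      & forall v : G, exists2 f, f \in P & v \in codom f].

(* Main.v *)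
Require Import Defs.
From mathcomp Require Import all_boot all_order all_algebra all_fingroup.
From mathcomp Require Import spectral sesquilinear complex.
From mathcomp Require Import reals sequences exp.
From mathcomp Require Import zify ring lra.

Set Implicit Arguments.
Unset Strict Implicit.
Unset Printing Implicit Defensive.

(** The proof separates the two requirements on the cycles: that they cover every
    vertex, and that each of them closes up after exactly [k] vertices. Let
    [t = n / k] be the number of cycles.

    Covering is easy. If the vertex set is split at random into classes of size
    [t] ([equal_split]), every vertex has about [d / k] neighbours in each class,
    and the expander mixing lemma ([expander_mixing]) gives Hall's condition
    between any two classes ([mixing_matching]). Perfect matchings between
    consecutive classes yield [t] disjoint paths that cover everything ([chain]),
    but give no control over which first vertex is joined to which last vertex.

    Closing up is the task of a switchboard prepared beforehand. Two classes [A]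
    and [B] are set aside and a vertex set [N] is embedded such that, for every
    bijection from [A] to [B], the graph induced on [A], [B] and [N] has disjoint
    paths of one fixed length that realize the bijection and use up [N]
    ([network]). The remaining vertices are then split into classes, matchings
    lead from [B] through all of them to [A], and the switchboard is set to the
    inverse of the permutation so obtained ([cycle_factor]).

    Abstractly the switchboard is a Benes network, with about [2 * log2 t] layers of
    switches ([benes]). A switch cannot be a 4-cycle, since a sparse expander may
    have none; it is a ladder whose rails and rungs are paths of logarithmic
    length, built so that it can be traversed in two ways on the same vertices
    ([gadget]). It has order [log2 n ^ 2] vertices, and so the routes
    have order [log2 n ^ 3] vertices; this is where the cube of the logarithm in
    the cycle length comes from.

    All these parts are connected by disjoint paths of prescribed logarithmic
    length in a random reservoir. They are found by the method of Friedman and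
    Pippenger: a forest is kept extendable, meaning that every small set still
    sees enough unused vertices. Such a forest can be extended wherever a child
    is owed ([extend_step]), because tight sets are closed under union, and its
    edges can be removed again ([extendable_drop]). So large trees may be grown from two
    vertices until mixing yields an edge between them, and then cut back to the
    connecting path ([connect_edges]). *)

(** * Extendable forests *)

Section Extend.
Variables (S T : finType) (e : S -> T -> bool).

Definition nbrs (R : {set T}) (U : {set S}) : {set T} :=
  [set y in R | [exists x in U, e x y]].

Definition outdeg (E : seq (S * T)) (x : S) : nat := count_mem x (unzip1 E).

(** The condition of Friedman and Pippenger, with [E] the edges (parent, child)
    of a forest grown so far and [w x] the number of children promised to [x]:
    every small set must see enough unused vertices of [R] for the children its
    members are still owed. Neither side is truncated, so the condition makes
    sense, and can be rolled back, whatever the degrees in [E] are. *)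
Definition extendable (R : {set T}) (M : nat) (w : S -> nat) (E : seq (S * T)) :=
  forall U : {set S}, #|U| <= M ->
    \sum_(x in U) w x
      <= #|nbrs R U :\: [set:: unzip2 E]| + \sum_(x in U) outdeg E x.

Lemma nbrsU R U1 U2 : nbrs R (U1 :|: U2) = nbrs R U1 :|: nbrs R U2.
Proof.
apply/setP=> y; rewrite !inE -andb_orr; congr (_ && _).
apply/existsP/orP => [[x /andP[]]|[] /existsP[x /andP[xU xy]]].
- rewrite inE => /orP[] xU xy; [left|right]; apply/existsP; exists x; exact/andP.
- by exists x; rewrite inE xU.
- by exists x; rewrite inE xU orbT.
Qed.

Lemma nbrsI_sub R U1 U2 : nbrs R (U1 :&: U2) \subset nbrs R U1 :&: nbrs R U2.
Proof.
apply/subsetP=> y; rewrite !inE => /andP[yR /existsP[x]].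
rewrite inE => /andP[/andP[x1 x2] xy]; rewrite yR /=.
by apply/andP; split; apply/existsP; exists x; rewrite ?x1 ?x2.
Qed.

Lemma nbrs0 R : nbrs R set0 = set0.
Proof.
by apply/setP=> y; rewrite !inE; apply/andP=> -[_ /existsP[x]]; rewrite inE.
Qed.

Lemma mem_nbrs (R : {set T}) (U : {set S}) x y : x \in U -> y \in R -> e x y -> y \in nbrs R U.
Proof. by move=> xU yR xy; rewrite inE yR; apply/existsP; exists x; rewrite xU. Qed.

Definition tight R w E (U : {set S}) :=
  #|nbrs R U :\: [set:: unzip2 E]| + \sum_(x in U) outdeg E x
    = \sum_(x in U) w x.

Lemma sum_setUI (f : S -> nat) (A B : {set S}) :
  \sum_(x in A :|: B) f x + \sum_(x in A :&: B) f x
  = \sum_(x in A) f x + \sum_(x in B) f x.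
Proof.
have sumE (D : {set S}) : \sum_(x in D) f x = \sum_x (x \in D) * f x.
  by rewrite big_mkcond; apply: eq_bigr => x _; case: (x \in D); rewrite ?mul1n.
rewrite !sumE -!big_split /=; apply: eq_bigr => x _; rewrite !inE.
by case: (x \in A); case: (x \in B); rewrite /= ?mul1n ?mul0n ?addn0.
Qed.

(** The slack in the extendability condition is submodular: neighbourhoods are
    submodular under union and intersection, and the other terms are modular. *)
Lemma tightU R M w E (U1 U2 : {set S}) : extendable R M w E ->
  #|U1| + #|U2| <= M -> tight R w E U1 -> tight R w E U2 -> tight R w E (U1 :|: U2).
Proof.
rewrite /tight => ext le12 t1 t2; set C := [set:: unzip2 E] in t1 t2 *.
have cU : #|U1 :|: U2| <= M by rewrite (leq_trans _ le12) // -cardsUI leq_addr.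
have cI : #|U1 :&: U2| <= M by rewrite (leq_trans _ le12) // -cardsUI leq_addl.
have := ext _ cU; have := ext _ cI; rewrite -/C => hI hU.
apply/eqP; rewrite eqn_leq; apply/andP; split; last exact: hU.
have sw := sum_setUI w U1 U2; have so := sum_setUI (outdeg E) U1 U2.
have n12 : #|nbrs R (U1 :|: U2) :\: C| + #|nbrs R (U1 :&: U2) :\: C|
    <= #|nbrs R U1 :\: C| + #|nbrs R U2 :\: C|.
  rewrite nbrsU setDUl -(cardsUI (nbrs R U1 :\: C)) leq_add2l; apply: subset_leq_card.
  by rewrite -setDIl setSD // nbrsI_sub.
rewrite -/C; lia.
Qed.

Lemma outdeg_cons s y E x : outdeg ((s, y) :: E) x = (s == x) + outdeg E x.
Proof. by []. Qed.

Lemma sum_pred1 (U : {set S}) s : \sum_(x in U) (s == x) = (s \in U).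
Proof.
have [sU|sU] := boolP (s \in U).
  by rewrite (bigD1 s) //= eqxx big1 // => i /andP[_ /negPf]; rewrite eq_sym => ->.
by rewrite big1 // => i iU; case: eqP sU => // ->; rewrite iU.
Qed.

(** If every neighbour [y] of [s] were blocked, each would lie in the
    neighbourhood of a tight set avoiding [s]. The union of these sets is again
    tight, since tight sets stay small enough to be united two at a time; adding
    [s] to it gains no new neighbour but one more unpaid demand. *)
Lemma extend_step R M w E s :
    extendable R M w E ->
    (forall U : {set S}, #|U| <= M -> tight R w E U -> 2 * #|U| < M) ->
    outdeg E s < w s ->
  exists y, [/\ y \in R, e s y, y \notin unzip2 E & extendable R M w ((s, y) :: E)].
Proof.
move=> ext small degs.
have M_gt0 : 0 < M.
  have := small set0; rewrite cards0 muln0; apply => //.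
  by rewrite /tight nbrs0 set0D cards0 !big_set0.
pose ok y := [forall U : {set S}, (#|U| <= M) ==>
    (\sum_(x in U) w x <= #|nbrs R U :\: [set:: unzip2 ((s, y) :: E)]|
        + \sum_(x in U) outdeg ((s, y) :: E) x)].
case: (pickP [pred y in R | [&& e s y, y \notin unzip2 E & ok y]]) => [y|none].
  rewrite inE => /and4P[yR sy yE /forallP oky]; exists y; split => // U cU.
  by have := oky U; rewrite cU.
have fresh y : y \in R -> e s y -> y \notin unzip2 E ->
    exists2 U : {set S}, tight R w E U & (#|U| <= M) && (s \notin U) && (y \in nbrs R U).
  move=> yR sy yE; have := none y; rewrite inE yR sy yE /= => /negbT.
  rewrite negb_forall => /existsP[U]; rewrite negb_imply -ltnNge => /andP[cU].
  have := ext U cU.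
  have -> : \sum_(x in U) outdeg ((s, y) :: E) x = (s \in U) + \sum_(x in U) outdeg E x.
    under eq_bigr do rewrite outdeg_cons.
    by rewrite big_split /= sum_pred1.
  have cD : #|nbrs R U :\: [set:: unzip2 E]|
      = (y \in nbrs R U) + #|nbrs R U :\: [set:: unzip2 ((s, y) :: E)]|.
    rewrite (cardsD1 y) [y \in _ :\: _]inE inE yE /=; congr (_ + _).
    by apply: eq_card => z; rewrite !inE negb_or andbA.
  rewrite cD => h1 h2; exists U; last first.
    rewrite cU /=; case: (boolP (s \in U)) h2 => sU h2 /=.
      have : y \in nbrs R U by apply: mem_nbrs sU yR sy.
      by move=> yU; move: h1 h2; rewrite yU; lia.
    by case: (y \in _) h1 h2; rewrite ?andbT //; lia.
  by rewrite /tight cD; move: h1 h2; case: (s \in U); case: (y \in _); lia.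
pose Y := [seq y <- enum R | e s y && (y \notin unzip2 E)].
have [Us [tU cUs sUs cov]] : exists U : {set S},
    [/\ tight R w E U, 2 * #|U| < M, s \notin U & forall y, y \in Y -> y \in nbrs R U].
  have : {subset Y <= Y} by [].
  elim: {1 3}Y => [|y Y' IH] sub.
    exists set0; split => //; last by rewrite inE.
      by rewrite /tight nbrs0 set0D cards0 !big_set0.
    by rewrite cards0 muln0.
  case: IH => [z zY'|U1 [t1 c1 s1 cov1]]; first by apply: sub; rewrite inE zY' orbT.
  have : y \in Y by apply: sub; rewrite mem_head.
  rewrite mem_filter mem_enum => /andP[/andP[sy yE] yR].
  have [U2 t2 /andP[/andP[c2 s2] y2]] := fresh y yR sy yE.
  have c2' := small _ c2 t2.
  have t12 : tight R w E (U1 :|: U2) by apply: tightU t1 t2; [exact: ext | lia].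
  exists (U1 :|: U2); split => //.
  - apply: small => //; apply: leq_trans (leq_card_setU _ _) _; lia.
  - by rewrite inE negb_or s1.
  - move=> z; rewrite nbrsU !inE => /orP[/eqP ->|/cov1]; last by rewrite inE => ->.
    by move: y2; rewrite inE => ->; rewrite orbT.
have /ext : #|s |: Us| <= M by rewrite cardsU1 sUs /=; lia.
rewrite !big_setU1 //= -tU.
have -> : nbrs R (s |: Us) :\: [set:: unzip2 E] = nbrs R Us :\: [set:: unzip2 E].
  apply/eqP; rewrite eqEsubset; apply/andP; split; last first.
    by rewrite nbrsU setSD // subsetUr.
  apply/subsetP=> y; rewrite nbrsU [y \in _ :\: _]inE inE => /andP[yE].
  rewrite inE => /orP[|yU]; last by rewrite !inE in yU yE *; rewrite yE.
  rewrite !inE in yE *; rewrite yE /= => /andP[yR /existsP[x /andP[/set1P -> sy]]].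
  have : y \in nbrs R Us by apply: cov; rewrite mem_filter sy yE mem_enum.
  by rewrite inE.
by rewrite addnCA leq_add2l leq_add2r leqNgt degs.
Qed.

Definition edges_ok (R : {set T}) (E : seq (S * T)) :=
  all (fun p => e p.1 p.2 && (p.2 \in R)) E.

Lemma extendable_perm R M w E E' : perm_eq E E' ->
  extendable R M w E -> extendable R M w E'.
Proof.
move=> pE ext U /ext; congr (_ <= _ + _).
  apply: eq_card => y; rewrite !inE; congr (~~ _ && _).
  exact: perm_mem (perm_map _ pE) y.
apply: eq_bigr => x _; rewrite /outdeg; exact: seq.permP (perm_map _ pE) _.
Qed.

(** Rollback: deleting the edge to [y] frees [y] for exactly those sets that
    contain its parent, which are the sets whose demand goes up. *)
Lemma extendable_drop (R : {set T}) M w E s y : e s y -> y \in R -> y \notin unzip2 E ->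
  extendable R M w ((s, y) :: E) -> extendable R M w E.
Proof.
move=> sy yR yE ext U cU; apply: leq_trans (ext U cU) _.
under eq_bigr do rewrite outdeg_cons.
rewrite big_split /= addnA leq_add2r sum_pred1.
have [sU|sU] := boolP (s \in U); last first.
  rewrite addn0 subset_leq_card //; apply: setDS; apply/subsetP=> z; rewrite !inE => ->.
  exact: orbT.
rewrite (cardsD1 y (_ :\: [set:: unzip2 E])) !inE yE yR /=.
have -> : [exists x in U, e x y] by apply/existsP; exists s; rewrite sU.
rewrite addnC leq_add2l subset_leq_card //; apply/subsetP=> z; rewrite !inE negb_or.
by rewrite -andbA.
Qed.

Lemma extendable_catr R M w E1 E2 : edges_ok R E1 -> uniq (unzip2 (E1 ++ E2)) ->
  extendable R M w (E1 ++ E2) -> extendable R M w E2.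
Proof.
elim: E1 => [//|[s y] E1 IH] /= /andP[/andP[sy yR] ok] /andP[yE uE] ext.
exact: IH ok uE (extendable_drop sy yR yE ext).
Qed.

Lemma extendable_sub R M w E E' : edges_ok R E -> uniq (unzip2 E) ->
  uniq E' -> {subset E' <= E} -> extendable R M w E -> extendable R M w E'.
Proof.
move=> ok uE uE' sub.
have pE : perm_eq E ([seq p <- E | p \notin E'] ++ E').
  apply: uniq_perm; first exact: map_uniq uE.
    rewrite cat_uniq uE' (filter_uniq _ (map_uniq uE)) andbT /=.
    by apply/hasPn=> p pE'; rewrite mem_filter pE'.
  move=> p; rewrite mem_cat mem_filter; case: (boolP (p \in E')) => //= pE'.
    by rewrite sub.
  by rewrite orbF.
move/(extendable_perm pE); apply: extendable_catr.
  by apply/allP=> p; rewrite mem_filter => /andP[_] /(allP ok).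
by rewrite -(perm_uniq (perm_map _ pE)).
Qed.

End Extend.

(** * Hall's theorem *)

Lemma unzip2_inj (S T : eqType) (E : seq (S * T)) x1 x2 y :
  uniq (unzip2 E) -> (x1, y) \in E -> (x2, y) \in E -> x1 = x2.
Proof.
elim: E => //= -[a b] E IH /andP[bE uE]; rewrite !inE !xpair_eqE.
case/orP=> [/andP[/eqP-> /eqP yb]|p1]; case/orP=> [/andP[/eqP-> /eqP yb']|p2] //.
- by move/(map_f snd): p2; rewrite /= yb (negPf bE).
- by move/(map_f snd): p1; rewrite /= yb' (negPf bE).
- exact: IH.
Qed.

(** Hall's theorem is the case of demand one at every vertex: the size bound
    exceeds the number of vertices, so tight sets are never too big to unite. *)
Lemma hall_marriage (S T : finType) (e : S -> T -> bool) :
  (forall U : {set S}, #|U| <= #|nbrs e setT U|) ->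
  exists2 f : S -> T, injective f & forall x, e x (f x).
Proof.
move=> hall; pose M := (2 * #|S|).+1.
have [E [ext okE uE uzE]] : exists E : seq (S * T),
    [/\ extendable e setT M (fun=> 1) E, edges_ok e setT E, uniq (unzip2 E)
      & perm_eq (unzip1 E) (enum S)].
  have : uniq (enum S) by exact: enum_uniq.
  elim: (enum S) => [_|x s IH /= /andP[xs /IH [E [ext okE uE pE]]]].
    exists [::]; split => // U _; rewrite sum1_card set_nil setD0.
    by apply: leq_trans (hall U) _; exact: leq_addr.
  have small (U : {set S}) : #|U| <= M -> tight e setT (fun=> 1) E U -> 2 * #|U| < M.
    by move=> _ _; rewrite ltnS leq_mul2l max_card.
  have degx : outdeg E x < 1.
    by rewrite /outdeg (seq.permP pE) ltnS leqn0; apply/eqP/count_memPn.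
  have [y [_ xy yE ext']] := extend_step ext small degx.
  exists ((x, y) :: E); split => //=; first by rewrite xy inE.
    by rewrite yE.
  by rewrite perm_cons.
have ex x : exists y, (x, y) \in E.
  have : x \in unzip1 E by rewrite (perm_mem uzE) mem_enum.
  by case/mapP=> -[x' y] xyE /= ->; exists y.
have exE x : exists y, (x, y) \in E by [].
pose f x := xchoose (exE x); have fE x : (x, f x) \in E := xchooseP (exE x).
exists f => [x1 x2 fx|x]; last by have /allP/(_ _ (fE x))/andP[] := okE.
by apply: (unzip2_inj uE (fE x1)); rewrite fx.
Qed.

(** * Connecting pairs of vertices *)

Section Connect.
Variables (V : finType) (e : rel V) (R : {set V}) (m h : nat).
Hypothesis e_sym : symmetric e.
Hypothesis mE : m = 2 ^ h.
Hypothesis joined : forall U1 U2 : {set V}, m <= #|U1| -> m <= #|U2| ->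
  exists x y, [/\ x \in U1, y \in U2 & e x y].

(** Three children per vertex are enough for the roots of the gadgets, which start
    three paths, and for the binary branching of the search trees. *)
Definition good_forest (E : seq (V * V)) :=
  [/\ extendable e R (2 * m) (fun=> 3) E, edges_ok e R E, uniq (unzip2 E)
    & forall v, v \in R -> v \notin unzip2 E -> outdeg E v = 0].

Definition occupied (E : seq (V * V)) (v : V) := (v \notin R) || (v \in unzip2 E).

Lemma m_gt0 : 0 < m. Proof. by rewrite mE expn_gt0. Qed.

(** The vertices of [R] outside the neighbourhood of [U] have no edge to [U]. *)
Lemma wide (U : {set V}) : m <= #|U| -> #|R| < #|nbrs e R U| + m.
Proof.
move=> mU; rewrite ltnNge; apply/negP => le_R.
have := cardsID (nbrs e R U) R.
have -> : R :&: nbrs e R U = nbrs e R U.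
  by apply/setIidPr/subsetP=> y; rewrite inE => /andP[].
move=> cR; have /(joined mU)[x [y [xU]]] : m <= #|R :\: nbrs e R U| by lia.
by rewrite inE => /andP[/negP yN yR] xy; case: yN; exact: mem_nbrs xU yR xy.
Qed.

(** A tight set of at least [m] vertices would see almost all of [R], which is
    far more than its demand and the used vertices account for. *)
Lemma grow_leaf E s : good_forest E -> size E + 7 * m <= #|R| -> outdeg E s < 3 ->
    occupied E s ->
  exists y, [/\ e s y, y \in R, y \notin unzip2 E, outdeg E y = 0
    & good_forest ((s, y) :: E)].
Proof.
move=> [ext okE uE freshE] room degs occs.
have m0 := m_gt0.
have small (U : {set V}) : #|U| <= 2 * m -> tight e R (fun=> 3) E U -> 2 * #|U| < 2 * m.
  rewrite /tight sum_nat_const => cU tU.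
  rewrite ltn_pmul2l // ltnNge; apply/negP => mU.
  have wU := wide mU.
  have : #|nbrs e R U| <= #|nbrs e R U :\: [set:: unzip2 E]| + size E.
    rewrite -(cardsID [set:: unzip2 E] (nbrs e R U)) addnC leq_add2l.
    apply: leq_trans (subset_leq_card (subsetIr _ _)) _.
    by rewrite cardsE (leq_trans (card_size _)) // size_map.
  move: tU wU room cU; move: (\sum_(x in U) _) => a; move: (#|nbrs e R U :\: [set:: unzip2 E]|) => b. lia.
have [y [yR sy yE ext']] := extend_step ext small degs.
exists y; split => //; first exact: freshE.
split => //=; first by rewrite sy yR.
  by rewrite yE.
move=> v vR; rewrite inE negb_or => /andP[vy vE]; rewrite outdeg_cons freshE // addn0.
by case: eqP occs vE => // ->; rewrite /occupied vR /= => ->.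
Qed.

Lemma outdeg_cat (E1 E2 : seq (V * V)) v : outdeg (E1 ++ E2) v = outdeg E1 v + outdeg E2 v :> nat.
Proof. by rewrite /outdeg /unzip1 map_cat count_cat. Qed.

Lemma grow_level (E : seq (V * V)) (F : seq V) : good_forest E -> uniq F ->
    (forall v, v \in F -> outdeg E v = 0 /\ v \in unzip2 E) ->
    size E + 2 * size F + 7 * m <= #|R| ->
  exists (T : seq (V * V)) (F' : seq V), [/\ good_forest (T ++ E), size T = 2 * size F, size F' = 2 * size F /\ uniq F',
    forall v, v \notin F -> outdeg (T ++ E) v = outdeg E v
   & forall z, z \in F' -> [/\ z \notin unzip2 E, z \in unzip2 (T ++ E),
      outdeg (T ++ E) z = 0 & exists2 x, x \in F & (x, z) \in T /\ e x z]].
Proof.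
elim: F E => [|x F IH] E gE /= uF FE room.
  by exists [::], [::]; split.
have [xF uF'] := andP uF.
have [degx xE] := FE x (mem_head _ _).
have room1 : size E + 7 * m <= #|R| by move: room; clear; lia.
have deg1x : outdeg E x < 3 by rewrite degx.
have occ1 : occupied E x by rewrite /occupied xE orbT.
have [y1 [xy1 y1R y1E deg1 gE1]] := grow_leaf gE room1 deg1x occ1.
have room2 : size ((x, y1) :: E) + 7 * m <= #|R| by move: room; clear; rewrite /=; lia.
have deg2x : outdeg ((x, y1) :: E) x < 3 by rewrite outdeg_cons degx eqxx.
have occ2 : occupied ((x, y1) :: E) x by rewrite /occupied inE xE !orbT.
have [y2 [xy2 y2R y2E deg2 gE2]] := grow_leaf gE1 room2 deg2x occ2.
have yx y : y \notin unzip2 E -> (x == y) = false.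
  by move=> yE; case: eqP yE => // <-; rewrite xE.
have y2E' : y2 \notin unzip2 E by move: y2E; rewrite inE negb_or => /andP[].
have y21 : y2 != y1 by move: y2E; rewrite inE negb_or => /andP[].
have FE2 v : v \in F -> outdeg [:: (x, y2), (x, y1) & E] v = 0
    /\ v \in unzip2 [:: (x, y2), (x, y1) & E].
  move=> vF; have [|dv vE] := FE v; first by rewrite inE vF orbT.
  rewrite !outdeg_cons dv !inE vE !orbT.
  by case: eqP xF => // ->; rewrite vF.
have room3 : size [:: (x, y2), (x, y1) & E] + 2 * size F + 7 * m <= #|R|.
  by move: room; clear; rewrite /=; lia.
have [T [F' [gT sT [sF' uF''] dT F'P]]] := IH _ gE2 uF' FE2 room3.
have nF y : y \notin unzip2 E -> y \notin F.
  by apply: contra => yF; have [|] := FE y; rewrite ?inE ?yF ?orbT.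
exists (T ++ [:: (x, y2); (x, y1)]), [:: y1, y2 & F']; rewrite -catA /=.
split=> //; first by rewrite size_cat /= sT; clear; lia.
- rewrite /= sF' uF'' andbT inE negb_or eq_sym y21 /=; split; first by clear; lia.
  apply/andP; split; apply/negP => /F'P[]; by rewrite !inE eqxx ?orbT.
- move=> v; rewrite inE negb_or => /andP[vx vF]; rewrite dT // !outdeg_cons eq_sym.
  by rewrite (negPf vx).
- have mT y : y \in unzip2 [:: (x, y2), (x, y1) & E] ->
      y \in unzip2 (T ++ [:: (x, y2), (x, y1) & E]).
    by rewrite /unzip2 map_cat mem_cat => ->; rewrite orbT.
  move=> z; rewrite !inE => /or3P[/eqP->|/eqP->|/F'P[zE zT dz [u uF3 [uz ez]]]].
  + split; [exact: y1E | by apply: mT; rewrite !inE eqxx orbT | |].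
      by rewrite dT ?nF // !outdeg_cons !yx.
    by exists x; rewrite ?mem_head // mem_cat !inE eqxx !orbT.
  + split; [exact: y2E' | by apply: mT; rewrite !inE eqxx | |].
      by rewrite dT ?nF // outdeg_cons deg2 yx.
    by exists x; rewrite ?mem_head // mem_cat !inE eqxx !orbT.
  + split=> //; first by move: zE; rewrite !inE !negb_or => /and3P[].
    by exists u; rewrite ?inE ?uF3 ?orbT // mem_cat uz.
Qed.

(** The edges are recorded in [T], so that the forest can later be rolled back to
    the path alone. *)
Definition reaches (T : seq (V * V)) s l z := exists q : seq V,
  [/\ path e s q, last s q = z, size q = l, uniq q & {subset zip (s :: q) q <= T}].

Lemma unzip2_zip_cons (s : V) q : unzip2 (zip (s :: q) q) = q.
Proof. by elim: q s => //= a q IH s; rewrite IH. Qed.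

Lemma unzip1_zip_cons (s : V) q : unzip1 (zip (s :: q) q) = belast s q.
Proof. by elim: q s => //= a q IH s; rewrite IH. Qed.

Lemma zip_cons_rcons (s z : V) q :
  zip (s :: rcons q z) (rcons q z) = rcons (zip (s :: q) q) (last s q, z).
Proof. by elim: q s => //= a q IH s; rewrite IH. Qed.

Lemma unzip2_subset (T : seq (V * V)) s q :
  {subset zip (s :: q) q <= T} -> {subset q <= unzip2 T}.
Proof.
move=> sub v; rewrite -{1}(unzip2_zip_cons s q) => /mapP[p pq ->].
by apply: map_f; apply: sub.
Qed.

(** The root spends a single child and the branching starts one level below, so
    that a vertex which already has two children can still be connected. *)
Lemma grow_tree (E : seq (V * V)) s j : good_forest E -> outdeg E s < 3 -> occupied E s ->
    size E + 2 ^ j.+1 + 7 * m <= #|R| ->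
  exists (T : seq (V * V)) (F : seq V),
   [/\ good_forest (T ++ E), (size T).+1 = 2 ^ j.+1, size F = 2 ^ j /\ uniq F,
      forall v, v \notin unzip2 T -> v != s -> outdeg (T ++ E) v = outdeg E v
    & forall z, z \in F -> [/\ z \in unzip2 (T ++ E), outdeg (T ++ E) z = 0
        & reaches T s j.+1 z]].
Proof.
move=> gE degs occs; elim: j => [|j IH] room.
  have room1 : size E + 7 * m <= #|R| by move: room; clear; lia.
  have [y [sy yR yE degy gE']] := grow_leaf gE room1 degs occs.
  exists [:: (s, y)], [:: y]; split => //=.
    by move=> v _ vs; rewrite outdeg_cons eq_sym (negPf vs).
  move=> z; rewrite inE => /eqP ->; split; first by rewrite mem_head.
    have ys : (s == y) = false.
      by case: eqP yE occs => // ->; rewrite /occupied => /negPf ->; rewrite yR.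
    by rewrite outdeg_cons ys degy.
  by exists [:: y]; split=> //=; rewrite ?sy.
have roomj : size E + 2 ^ j.+1 + 7 * m <= #|R|.
  by move: room; clear; rewrite (expnS 2 j.+1); lia.
have [T [F [gT sT [sF uF] dT FP]]] := IH roomj.
have room2 : size (T ++ E) + 2 * size F + 7 * m <= #|R|.
  by rewrite size_cat sF; move: room sT; clear; rewrite (expnS 2 j.+1) (expnS 2 j); lia.
have FP' v : v \in F -> outdeg (T ++ E) v = 0 /\ v \in unzip2 (T ++ E) by case/FP.
have [T2 [F2 [gT2 sT2 [sF2 uF2] dT2 F2P]]] := grow_level gT uF FP' room2.
have FT v : v \in F -> v \in unzip2 T.
  move=> /FP[_ _ [q [_ lq sq _ /unzip2_subset sub]]].
  by rewrite -lq; apply: sub; case: (q) sq => //= a r _; apply: mem_last.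
exists (T2 ++ T), F2; rewrite -catA; split => //.
- by rewrite size_cat sT2 sF; move: sT; clear; rewrite (expnS 2 j.+1) (expnS 2 j); lia.
- by rewrite sF2 sF expnS.
- move=> v; rewrite /unzip2 map_cat mem_cat negb_or => /andP[_ vT] vs.
  by rewrite dT2 ?dT //; apply: contra vT => /FT.
- move=> z /F2P[zT zT2 dz [x xF [xz exz]]]; split=> //.
  have [_ _ [q [pq lq sq uq subq]]] := FP x xF.
  exists (rcons q z); split.
  + by rewrite rcons_path pq lq.
  + by rewrite last_rcons.
  + by rewrite size_rcons sq.
  + rewrite rcons_uniq uq andbT; apply: contra zT => zq.
    by rewrite /unzip2 map_cat mem_cat (unzip2_subset subq zq).
  + move=> p; rewrite zip_cons_rcons mem_rcons inE lq => /predU1P[->|/subq pT].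
      by rewrite mem_cat xz.
    by rewrite mem_cat pT orbT.
Qed.

(** Binary trees with at least [m] leaves are grown from both ends, an edge
    joins a leaf of one to a leaf of the other, and everything off the resulting
    path is rolled back. Hence a connection costs only its own vertices, however
    many were explored. The depths differ by one to make the number of inner
    vertices odd, as the gadgets require. *)
Lemma connect_edges E x y : good_forest E -> x != y -> occupied E x -> occupied E y ->
    outdeg E x < 3 -> outdeg E y < 3 -> size E + 13 * m <= #|R| ->
  exists (q : seq V) (E' : seq (V * V)),
    [/\ path e x (rcons q y), size q = 2 * h + 3,
     good_forest E' /\ perm_eq (unzip2 E') (q ++ unzip2 E)
     & forall v, outdeg E' v <= outdeg E v + (v \in [:: x, y & q])].
Proof.
move=> gE xy occx occy degx degy room.
have room1 : size E + 2 ^ h.+1 + 7 * m <= #|R|.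
  by move: room; rewrite expnS -mE; clear; lia.
have [T1 [F1 [g1 s1 [sF1 uF1] d1 P1]]] := grow_tree gE degx occx room1.
have [_ _ uT1 _] := g1.
have occR v : occupied E v -> v \notin unzip2 T1.
  have [_ ok1 _ _] := g1; move: ok1 uT1; rewrite /edges_ok all_cat => /andP[/allP ok1 _].
  rewrite /unzip2 map_cat cat_uniq => /and3P[_ /hasPn/= dis _].
  case/orP=> [vR|/dis //]; apply: contra vR => /mapP[p /ok1 /andP[_ pR] ->] //.
have dy : outdeg (T1 ++ E) y < 3 by rewrite d1 ?occR // eq_sym.
have occy1 : occupied (T1 ++ E) y.
  by case/orP: occy => yE; rewrite /occupied ?yE // /unzip2 map_cat mem_cat yE !orbT.
have room2 : size (T1 ++ E) + 2 ^ h.+2 + 7 * m <= #|R|.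
  by rewrite size_cat; move: room s1; rewrite !expnS -mE; clear; lia.
have [T2 [F2 [g2 s2 [sF2 uF2] d2 P2]]] := grow_tree g1 dy occy1 room2.
have [z1 [z2 []]] : exists z1 z2, [/\ z1 \in [set:: F1], z2 \in [set:: F2] & e z1 z2].
  apply: joined; rewrite cardsE (card_uniqP _) ?sF1 ?sF2 ?mE //.
  by rewrite leq_exp2l.
rewrite !inE => /P1[_ _ [q1 [pq1 lq1 sq1 uq1 sub1]]].
move=> /P2[_ _ [q2 [pq2 lq2 sq2 uq2 sub2]]] z12.
pose E' := zip (x :: q1) q1 ++ zip (y :: q2) q2 ++ E.
have [ext ok2 uE2 fr2] := g2.
have u2E' : unzip2 E' = q1 ++ q2 ++ unzip2 E.
  by rewrite /E' /unzip2 !map_cat -!/(unzip2 _) !unzip2_zip_cons.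
have sq1T := unzip2_subset sub1; have sq2T := unzip2_subset sub2.
have uE' : uniq (unzip2 E').
  move: uE2; rewrite u2E' /unzip2 !map_cat !cat_uniq uq1 uq2 /=.
  case/and3P=> _ /hasPn d2' /and3P[_ /hasPn d1' ->]; rewrite andbT.
  apply/andP; split; apply/hasPn=> v; last first.
    by move=> vE; apply/negP=> /sq2T v2; have := d2' v; rewrite mem_cat vE v2 orbT => /(_ isT).
  rewrite mem_cat => /orP[/sq2T v2|vE]; apply/negP=> /sq1T v1.
    by have := d2' v; rewrite mem_cat v1 v2 => /(_ isT).
  by have /negP := d1' v vE.
have subE' : {subset E' <= T2 ++ T1 ++ E}.
  move=> p; rewrite /E' !mem_cat => /or3P[/sub1 ->|/sub2 ->|->]; by rewrite ?orbT.
have degE' v : outdeg E' v = count_mem v (belast x q1) + count_mem v (belast y q2) + outdeg E v.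
  by rewrite !outdeg_cat addnA /outdeg !unzip1_zip_cons.
have cnt (s v : V) q : uniq (s :: q) -> count_mem v (belast s q) <= (v \in s :: q).
  rewrite lastI rcons_uniq => /andP[_ u]; rewrite (count_uniq_mem v u) mem_rcons inE.
  by case: (v \in belast s q); rewrite ?orbT.
have xq1 : x \notin q1 by apply/negP=> /sq1T xT; have := occR _ occx; rewrite xT.
have yT2 v : occupied (T1 ++ E) v -> v \notin unzip2 T2.
  move: ok2 uE2; rewrite /edges_ok all_cat => /andP[/allP ok2 _].
  rewrite /unzip2 map_cat cat_uniq => /and3P[_ /hasPn/= dis _].
  case/orP=> [vR|/dis //]; apply: contra vR => /mapP[p /ok2 /andP[_ pR] ->] //.
have yq2 : y \notin q2 by apply/negP=> /sq2T yT; have := yT2 _ occy1; rewrite yT.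
have occx1 : occupied (T1 ++ E) x.
  by case/orP: occx => xE; rewrite /occupied ?xE // /unzip2 map_cat mem_cat xE !orbT.
have xq2 : x \notin q2 by apply/negP=> /sq2T xT; have := yT2 _ occx1; rewrite xT.
have yq1 : y \notin q1 by apply/negP=> /sq1T yT; have := occR _ occy; rewrite yT.
have bound v : outdeg E' v <= outdeg E v + (v \in [:: x, y & q1 ++ rev q2]).
  rewrite degE' addnC leq_add2l.
  apply: leq_trans (leq_add (cnt x v q1 _) (cnt y v q2 _)) _; rewrite /= ?xq1 ?yq2 //.
  rewrite !inE mem_cat mem_rev; have := uE'; rewrite u2E' catA cat_uniq => /andP[].
  rewrite cat_uniq => /and3P[_ /hasPn d12 _] _; have := d12 v.
  case: (eqVneq v x) => [->|_] /=.
    by rewrite (negPf xy) (negPf xq1) (negPf xq2).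
  case: (eqVneq v y) => [->|_] /=; first by rewrite (negPf yq1) (negPf yq2).
  by case: (v \in q2) => [/(_ isT) /negPf ->|]; case: (v \in q1).
exists (q1 ++ rev q2), E'; split=> //.
- rewrite rcons_cat cat_path pq1 lq1 /=.
  have -> : rcons (rev q2) y = z2 :: rev (belast y q2).
    by rewrite -rev_cons lastI rev_rcons lq2.
  rewrite /= z12 -lq2 rev_path; apply: sub_path pq2 => a b; by rewrite e_sym.
- by rewrite size_cat size_rev sq1 sq2; clear; lia.
- split; last by rewrite u2E' -catA perm_cat2l perm_cat2r perm_sym perm_rev.
  split; [|by apply/allP=> p /subE' /(allP ok2)|exact: uE'|].
    exact: extendable_sub ok2 uE2 (map_uniq uE') subE' ext.
  move=> v vR; rewrite u2E' !mem_cat !negb_or => /and3P[v1 v2 vE].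
  apply/eqP; rewrite -leqn0; apply: leq_trans (bound v) _.
  have [_ _ _ frE] := gE; rewrite frE // add0n !inE mem_cat mem_rev (negPf v1) (negPf v2).
  rewrite !orbF; case: eqP => [vx|_].
    by move: occx; rewrite -vx /occupied vR (negPf vE).
  by case: eqP => // vy; move: occy; rewrite -vy /occupied vR (negPf vE).
Qed.

End Connect.

(** * Embeddings with a budget of branchings *)

Section State.
Variables (V : finType) (e : rel V) (R : {set V}) (m h : nat).
Hypothesis e_sym : symmetric e.
Hypothesis mE : m = 2 ^ h.
Hypothesis joined : forall U1 U2 : {set V}, m <= #|U1| -> m <= #|U2| ->
  exists x y, [/\ x \in U1, y \in U2 & e x y].

(** Hides the forest: [A] is the set of used vertices, [c] bounds the number of
    children, and vertices of the reservoir that are not used have none. *)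
Definition state (A : {set V}) (c : V -> nat) :=
  (exists E, [/\ good_forest e R m E, A =i unzip2 E & forall v, outdeg E v <= c v])
  /\ (forall v, v \in R :\: A -> c v = 0).

(** Vertices outside the reservoir never need to be entered by the forest, hence
    can serve as ends of paths from the start. *)
Definition occ (A : {set V}) v := (v \notin R) || (v \in A).

Lemma state_weaken A c c' : state A c -> (forall v, c v <= c' v) ->
  (forall v, v \in R :\: A -> c' v = 0) -> state A c'.
Proof.
move=> [[E [gE AE dE]] _] cc' z; split=> //; exists E; split=> // v.
exact: leq_trans (dE v) (cc' v).
Qed.

Lemma state_card (A : {set V}) (E : seq (V * V)) : uniq (unzip2 E) -> A =i unzip2 E -> size E = #|A|.
Proof. by move=> uE AE; rewrite (eq_card AE) (card_uniqP uE) size_map. Qed.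

Lemma state_step (A : {set V}) c s : state A c -> occ A s -> c s < 3 -> #|A| + 7 * m <= #|R| ->
  exists y, [/\ e s y, y \in R :\: A
    & state (y |: A) (fun v => c v + (v == s))].
Proof.
move=> [[E [gE AE dE]] z] occs cs room.
have [_ _ uE _] := gE.
have room' : size E + 7 * m <= #|R| by rewrite (state_card uE AE).
have ds : outdeg E s < 3 := leq_ltn_trans (dE s) cs.
have occE : occupied R E s by rewrite /occupied -AE.
have [y [sy yR yE dy gE']] := grow_leaf mE joined gE room' ds occE.
have yA : y \notin A by rewrite AE.
exists y; split=> //; first by rewrite inE yA.
split.
  exists ((s, y) :: E); split=> // v; first by rewrite !inE AE.
  by rewrite outdeg_cons addnC eq_sym leq_add.
move=> v; rewrite !inE negb_or -andbA => /and3P[vy vA vR].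
rewrite z ?inE ?vA //; case: eqP vR vA => // ->.
by case/orP: occs => [/negPf ->|->].
Qed.

Lemma extend_path (A : {set V}) c s j : state A c -> occ A s -> c s < 3 ->
    #|A| + j + 7 * m <= #|R| ->
  exists q : seq V, [/\ path e s q, size q = j, uniq q, {subset q <= R :\: A}
    & state (A :|: [set:: q]) (fun v => c v + (v \in belast s q))].
Proof.
move=> st occs cs; elim: j => [|j IH] room.
  exists [::]; split=> //=; rewrite set_nil setU0.
  by apply: (state_weaken st) => [v|v vR]; rewrite ?addn0 //; have [_ ->] := st.
have roomj : #|A| + j + 7 * m <= #|R| by move: room; clear; lia.
have [q [pq sq uq subq stq]] := IH roomj.
have sNq : s \notin q.
  apply/negP=> /subq; rewrite inE => /andP[/negPf sA sR].
  by move: occs; rewrite /occ sA sR.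
have occl : occ (A :|: [set:: q]) (last s q).
  case: (lastP q) => [|q' x] /=; first by rewrite set_nil setU0.
  by rewrite last_rcons /occ !inE mem_rcons mem_head !orbT.
have cl : c (last s q) + (last s q \in belast s q) < 3.
  have : uniq (s :: q) by rewrite /= sNq.
  rewrite lastI rcons_uniq => /andP[/negPf -> _]; rewrite addn0.
  case: (lastP q) subq => [|q' x] //= subq.
  have [_ ->] := st; rewrite // last_rcons subq // mem_rcons mem_head //.
have cA : #|A :|: [set:: q]| <= #|A| + j.
  apply: leq_trans (leq_card_setU _ _) _; rewrite leq_add2l cardsE.
  by rewrite (leq_trans (card_size _)) ?sq.
have room1 : #|A :|: [set:: q]| + 7 * m <= #|R| by move: room cA; clear; lia.
have [y [ly yR sty]] := state_step stq occl cl room1.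
exists (rcons q y); split.
- by rewrite rcons_path pq.
- by rewrite size_rcons sq.
- by rewrite rcons_uniq uq andbT; move: yR; rewrite !inE negb_or => /andP[/andP[]].
- move=> v; rewrite mem_rcons inE => /predU1P[->|/subq//].
  by move: yR; rewrite !inE negb_or => /andP[/andP[-> _] ->].
- have -> : A :|: [set:: rcons q y] = y |: (A :|: [set:: q]).
    by apply/setP=> v; rewrite !inE mem_rcons inE orbCA.
  apply: (state_weaken sty) => v.
    rewrite -addnA leq_add2l belast_rcons.
    have : uniq (s :: q) by rewrite /= sNq.
    rewrite lastI rcons_uniq mem_rcons inE => /andP[lN _].
    by case: eqP lN => [-> /negPf ->|] //; case: (v \in belast s q).
  rewrite !inE !negb_or -andbA belast_rcons => /andP[vy /andP[/andP[vA vq] vR]].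
  have [_ ->] := st; last by rewrite inE vA.
  rewrite inE (negPf vq) orbF; case: eqP vR vA => // ->.
  by case/orP: occs => [/negPf ->|->].
Qed.

Lemma connect_pair (A : {set V}) c x y : state A c -> x != y -> occ A x -> occ A y -> c x < 3 -> c y < 3 ->
    #|A| + 13 * m <= #|R| ->
  exists q : seq V, [/\ path e x (rcons q y), size q = 2 * h + 3, uniq q,
      {subset q <= R :\: A}
    & state (A :|: [set:: q]) (fun v => c v + (v \in [:: x, y & q]))].
Proof.
move=> [[E [gE AE dE]] z] xy occx occy cx cy room.
have [_ _ uE _] := gE.
have room' : size E + 13 * m <= #|R| by rewrite (state_card uE AE).
have dx : outdeg E x < 3 := leq_ltn_trans (dE x) cx.
have dy : outdeg E y < 3 := leq_ltn_trans (dE y) cy.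
have occxE : occupied R E x by rewrite /occupied -AE.
have occyE : occupied R E y by rewrite /occupied -AE.
have [q [E' [pq sq [gE' pE'] dE']]] :=
  connect_edges e_sym mE joined gE xy occxE occyE dx dy room'.
have [_ okE' uE' _] := gE'.
have := uE'; rewrite (perm_uniq pE') cat_uniq => /and3P[uq /hasPn qE _].
exists q; split=> //.
- move=> v vq; rewrite inE AE; apply/andP; split.
    by apply/negP=> /qE /=; rewrite vq.
  have : v \in unzip2 E' by rewrite (perm_mem pE') mem_cat vq.
  by case/mapP=> p /(allP okE') /andP[_ pR] ->.
split.
  exists E'; split=> // v; first by rewrite !inE (perm_mem pE') mem_cat AE orbC.
  by apply: leq_trans (dE' v) _; rewrite leq_add2r.
move=> v; rewrite !inE negb_or -andbA => /and3P[vA vq vR].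
have occE w : occ A w -> v != w.
  by move=> occw; case: eqP vR vA => // ->; case/orP: occw => [/negPf ->|->].
rewrite z; last by rewrite inE vA.
rewrite (negPf vq) orbF.
by rewrite (negPf (occE _ occx)) (negPf (occE _ occy)).
Qed.

Lemma connect_pairs (I : eqType) (s : seq I) (f1 f2 : I -> V) (A : {set V}) c :
    state A c -> uniq (map f1 s ++ map f2 s) ->
    (forall v, v \in map f1 s ++ map f2 s -> occ A v /\ c v < 3) ->
    #|A| + size s * (2 * h + 3) + 13 * m <= #|R| ->
  exists Q : I -> seq V,
    [/\ forall i, i \in s -> path e (f1 i) (rcons (Q i) (f2 i)) /\ size (Q i) = 2 * h + 3,
      uniq (flatten (map Q s)), {subset flatten (map Q s) <= R :\: A}
    & state (A :|: [set:: flatten (map Q s)])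
        (fun v => c v + (v \in map f1 s ++ map f2 s ++ flatten (map Q s)))].
Proof.
elim: s A c => [|i s IH] A c st uf fP room.
  exists (fun=> [::]); split=> //=; rewrite set_nil setU0.
  by apply: (state_weaken st) => [v|v vR]; rewrite ?addn0 //; have [_ ->] := st.
have roomi : #|A| + 13 * m <= #|R| by move: room; clear; lia.
have mem1 v : v \in map f1 s ++ map f2 s -> v \in map f1 (i :: s) ++ map f2 (i :: s).
  by rewrite /= !(inE, mem_cat) => /orP[] ->; rewrite !orbT.
have [o1 c1] := fP (f1 i) (mem_head _ _).
have [|o2 c2] := fP (f2 i); first by rewrite mem_cat (map_f f2 (mem_head i s)) orbT.
move: uf; rewrite map_cons cat_cons cons_uniq => /andP[f1N].
rewrite map_cons uniq_catC cat_cons cons_uniq uniq_catC => /andP[f2N uf].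
move: f1N f2N; rewrite /= !mem_cat inE !negb_or.
move=> /and3P[n11 n12 n13] /andP[n22 n21].
have [q [pq sq uq subq stq]] := connect_pair st n12 o1 o2 c1 c2 roomi.
have cA : #|A :|: [set:: q]| <= #|A| + (2 * h + 3).
  apply: leq_trans (leq_card_setU _ _) _; rewrite leq_add2l cardsE.
  by rewrite (leq_trans (card_size _)) ?sq.
have rooms : #|A :|: [set:: q]| + size s * (2 * h + 3) + 13 * m <= #|R|.
  by move: room cA; clear; rewrite /= mulSn; lia.
have fP' v : v \in map f1 s ++ map f2 s ->
    occ (A :|: [set:: q]) v /\ c v + (v \in [:: f1 i, f2 i & q]) < 3.
  move=> vs; have [ov cv] := fP v (mem1 v vs); split.
    by case/orP: ov => ov; rewrite /occ ?ov // !inE ov orbT.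
  rewrite !inE; have vq : v \notin q.
    apply/negP=> /subq; rewrite inE => /andP[vA vR].
    by move: ov; rewrite /occ vR (negPf vA).
  rewrite (negPf vq) orbF.
  have -> : (v == f1 i) = false.
    by apply/eqP=> vf; move: vs; rewrite vf mem_cat (negPf n11) (negPf n13).
  have -> : (v == f2 i) = false.
    by apply/eqP=> vf; move: vs; rewrite vf mem_cat (negPf n22) (negPf n21).
  by rewrite addn0.
have [Q [QP uQ subQ stQ]] := IH _ _ stq uf fP' rooms.
have iNs : i \notin s by apply: contra n11; apply: map_f.
pose Q' j := if j == i then q else Q j.
have QQ : map Q' s = map Q s.
  by apply/eq_in_map=> j js; rewrite /Q'; case: eqP iNs => // <-; rewrite js.
have flE : Q' i ++ flatten (map Q' s) = q ++ flatten (map Q s) by rewrite QQ /Q' eqxx.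
exists Q'; rewrite flE; split.
- move=> j; rewrite inE /Q'; case: eqP => [->|_] //= ; exact: QP.
- rewrite cat_uniq uq uQ andbT /=; apply/hasPn=> v /subQ.
  by rewrite !inE negb_or -andbA => /and3P[].
- move=> v; rewrite mem_cat => /orP[/subq//|/subQ].
  by rewrite !inE negb_or -andbA => /and3P[-> _ ->].
- have -> : A :|: [set:: q ++ flatten (map Q s)] = A :|: [set:: q] :|: [set:: flatten (map Q s)].
    by apply/setP=> v; rewrite !inE mem_cat orbA.
  apply: (state_weaken stQ) => v.
    rewrite -addnA leq_add2l /= !(mem_cat, inE).
    have := subQ v; rewrite !inE negb_or.
    case: (eqVneq v (f1 i)) => [->|_] /=.
      rewrite (negPf n11) (negPf n13) /=.
      case: (f1 i \in flatten _) => // /(_ isT) /andP[/andP[fA fq] fR].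
      by move: o1; rewrite /occ fR (negPf fA).
    case: (eqVneq v (f2 i)) => [->|_] /=.
      rewrite (negPf n22) (negPf n21) /=.
      case: (f2 i \in flatten _) => [/(_ isT) /andP[/andP[fA fq] fR]|].
        by move: o2; rewrite /occ fR (negPf fA).
      by rewrite ?orbT.
    case vq : (v \in q) => /=; last by rewrite !(orbF, add0n).
    rewrite andbF /=; have := subq v vq; rewrite inE => /andP[vA vR].
    have vN : v \in map f1 s ++ map f2 s -> False.
      by move=> /mem1/fP[]; rewrite /occ vR (negPf vA).
    move: vN; rewrite mem_cat; case: (v \in map f1 s) => [/(_ isT)//|].
    case: (v \in map f2 s) => [/(_ isT)//|] _ /=.
    by case: (v \in flatten _) => [/(_ isT)//|].
  move=> vH; have [vA vq vQ vR] : [/\ v \notin A, v \notin q,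
      v \notin flatten (map Q s) & v \in R].
    by move: vH; rewrite !inE !negb_or -!andbA => /and4P[].
  have [_ ->] := st; last by rewrite inE vA.
  case: (boolP (_ \in _)) => // vf.
  have : v \in map f1 (i :: s) ++ map f2 (i :: s).
    move: vf; rewrite /= !(inE, mem_cat) (negPf vq) (negPf vQ) !orbF.
    by case/or4P=> [->|->|->|->]; rewrite ?orbT.
  by case/fP; rewrite /occ vR (negPf vA).
Qed.

End State.

(** * Switch gadgets *)

Section Zigzag.
Variables (V : finType) (e : rel V).
Hypothesis e_sym : symmetric e.

Lemma path_rcons_rev x y s : path e x (rcons s y) = path e y (rcons (rev s) x).
Proof.
have := rev_path e x (rcons s y); rewrite last_rcons belast_rcons rev_cons => ->.
by apply: eq_path => a b; rewrite e_sym.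
Qed.

Definition route (g : nat) (x y : V) (p : seq V) :=
  exists r, [/\ p = x :: r, path e x r, last x r = y & size p = g].

(** Each triple [(u, s, v)] is a rung: a path [u, s, v] between the two sides of a
    ladder. The zigzag crosses every rung, so it can start on either side, and
    the two zigzags have the same vertices and the same last vertex [z]. *)
Fixpoint zig (z : V) (b : bool) (l : seq (V * seq V * V)) : seq V :=
  if l is (u, s, v) :: l' then
    if b then u :: s ++ v :: zig z (~~ b) l' else v :: rev s ++ u :: zig z (~~ b) l'
  else [:: z].

Definition tops (l : seq (V * seq V * V)) := [seq t.1.1 | t <- l].
Definition bots (l : seq (V * seq V * V)) := [seq t.2 | t <- l].
Definition mids (l : seq (V * seq V * V)) := flatten [seq t.1.2 | t <- l].

Lemma mids_cons t l : mids (t :: l) = t.1.2 ++ mids l. Proof. by []. Qed.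

Lemma zig_path z (l : seq (V * seq V * V)) a1 a2 b : path e a1 (rcons (tops l) z) -> path e a2 (rcons (bots l) z) ->
  (forall t, t \in l -> path e t.1.1 (rcons t.1.2 t.2)) ->
  path e (if b then a1 else a2) (zig z b l).
Proof.
elim: l a1 a2 b => [|[[u s] v] l IH] a1 a2 b /=; first by case: b; rewrite ?andbT.
move=> /andP[a1u pu] /andP[a2v pv] ps.
have us : path e u (rcons s v) := ps (u, s, v) (mem_head _ _).
have IH' c := IH u v c pu pv (fun t tl => ps t (mem_behead (s := (u, s, v) :: l) tl)).
case: b => /=.
  by rewrite a1u -cat_rcons cat_path us last_rcons (IH' false).
by rewrite a2v -cat_rcons cat_path -path_rcons_rev us last_rcons (IH' true).
Qed.

Lemma zig_last z (l : seq (V * seq V * V)) a b : last a (zig z b l) = z.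
Proof. by elim: l a b => [|[[u s] v] l IH] a [] //=; rewrite last_cat /= IH. Qed.

Lemma zig_size z (l : seq (V * seq V * V)) b p : (forall t, t \in l -> size t.1.2 = p) ->
  size (zig z b l) = size l * (p + 2) + 1.
Proof.
elim: l b => [|[[u s] v] l IH] b //= sp.
have := sp (u, s, v) (mem_head _ _) => /= ss.
have IH' c := IH c (fun t tl => sp t (mem_behead (s := (u, s, v) :: l) tl)).
by case: b; rewrite /= size_cat ?size_rev /= IH' ss mulSn; clear; lia.
Qed.

Lemma zig_count z (l : seq (V * seq V * V)) b w : count_mem w (zig z b l) =
  count_mem w (tops l) + count_mem w (bots l) + count_mem w (mids l) + (z == w).
Proof.
elim: l b => [|[[u s] v] l IH] b /=; first by rewrite addn0.
by rewrite mids_cons; case: b; rewrite /= !count_cat ?count_rev /= IH;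
  move: (count_mem w s) (count_mem w (tops l)) (count_mem w (bots l)) (count_mem w (mids l));
  clear; lia.
Qed.
End Zigzag.

Section Gadget.
Variables (V : finType) (e : rel V) (R : {set V}) (m h : nat).
Hypothesis e_sym : symmetric e.
Hypothesis mE : m = 2 ^ h.
Hypothesis joined : forall U1 U2 : {set V}, m <= #|U1| -> m <= #|U2| ->
  exists x y, [/\ x \in U1, y \in U2 & e x y].

Definition glen := h.+1 * (2 * h + 3 + 2) + 2.

(** The switch. The root [z0] gets the children [a1] and [a2], the inputs, which
    are joined by a path [q]; mirror-image vertices of [q] are joined by rungs, the
    middle vertex [zr] of [q] being one output. A pendant path [pad] at [z0], as
    long as a zigzag, ends in the other output. Either [a1] turns to [z0] and [pad]
    while [a2] zigzags to [zr], or the other way round; all vertices are used in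
    both cases and all routes have the same length. *)
Lemma gadget (A : {set V}) c z0 : state e R m A c -> z0 \notin R -> c z0 = 0 ->
    #|A| + 2 * glen + 13 * m <= #|R| ->
  exists a1 a2 b1 b2 (new : {set V}) c',
   [/\ [/\ new \subset R :\: A, #|new| <= 2 * glen, state e R m (A :|: new) c',
          (forall v, v \notin new -> v != z0 -> c' v = c v)
        & (forall v, v \in new -> c' v <= 2)],
       [/\ a1 \in new, a2 \in new, b1 \in new & b2 \in new],
       (exists P1 P2, [/\ route e glen a1 b1 P1, route e glen a2 b2 P2
          & forall v, count_mem v P1 + count_mem v P2 = (v \in z0 |: new)])
     & (exists P1 P2, [/\ route e glen a1 b2 P1, route e glen a2 b1 P2
          & forall v, count_mem v P1 + count_mem v P2 = (v \in z0 |: new)])].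
Proof.
move=> st z0R cz0 room; set g := glen in room *.
have gE : g = h.+1 * (2 * h + 3 + 2) + 2 by [].
have oz A' : occ R A' z0 by rewrite /occ z0R.
have room1 : #|A| + 7 * m <= #|R| by move: room; clear; lia.
have [|a1 [za1 a1R st1]] := state_step mE joined st (oz A) _ room1; first by rewrite cz0.
have cA1 : #|a1 |: A| <= #|A| + 1.
  by rewrite cardsU1 addnC leq_add2l leq_b1.
have room2 : #|a1 |: A| + 7 * m <= #|R| by move: room cA1; rewrite gE; clear; lia.
have [|a2 [za2 a2R st2]] := state_step mE joined st1 (oz _) _ room2.
  by rewrite cz0 eqxx.
set A2 := a2 |: _ in st2.
have cA2 : #|A2| <= #|A| + 2.
  by rewrite /A2 cardsU1; apply: leq_trans (leq_add (leq_b1 _) cA1) _; clear; lia.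
have room3 : #|A2| + (g - 2) + 7 * m <= #|R| by move: room cA2; rewrite gE; clear; lia.
have [|pad [ppad spad upad subpad st3]] := extend_path mE joined st2 (oz _) _ room3.
  by rewrite cz0 eqxx.
set A3 := A2 :|: _ in st3.
have cA3 : #|A3| <= #|A| + g.
  apply: leq_trans (leq_card_setU _ _) _.
  have cp : #|[set:: pad]| <= g - 2 by rewrite cardsE -spad card_size.
  by apply: leq_trans (leq_add cA2 cp) _; rewrite gE; clear; lia.
have [a1A2 a1R'] : a1 \in A2 /\ a1 \in R by move: a1R; rewrite !inE eqxx orbT => /andP[].
have [a2A2 a2R'] : a2 \in A2 /\ a2 \in R by move: a2R; rewrite !inE eqxx => /andP[].
have a1A : a1 \notin A by move: a1R; rewrite inE => /andP[].
have [a21 a2A] : a2 != a1 /\ a2 \notin A.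
  by move: a2R; rewrite !inE negb_or => /andP[/andP[]].
have z0ne v : v \in R -> (v == z0) = false by move=> vR; case: eqP z0R => // <-; rewrite vR.
have padN v : v \in A2 -> v \in R -> (v \in belast z0 pad) = false.
  move=> vA vR; apply/negP=> /mem_belast; rewrite inE z0ne //= => /subpad.
  by rewrite inE vA.
have c30 v : v \in A2 -> v \in R :\: A ->
    c v + (v == z0) + (v == z0) + (v \in belast z0 pad) = 0.
  by move=> vA vRA; have vR := subsetP (subsetDl _ _) _ vRA;
     rewrite padN // z0ne //; have [_ ->] := st.
have room4 : #|A3| + 13 * m <= #|R| by move: room cA3; rewrite gE; clear; lia.
have o3 v : v \in A2 -> occ R A3 v by move=> vA; rewrite /occ inE vA orbT.
have a2RA : a2 \in R :\: A by rewrite inE a2A.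
have [|||q [pq sq uq subq st4]] :=
  connect_pair e_sym mE joined st3 (x := a1) (y := a2) _ (o3 _ a1A2) (o3 _ a2A2) _ _ room4.
- by rewrite eq_sym.
- by rewrite c30.
- by rewrite c30.
set A4 := A3 :|: _ in st4.
pose n := h.+1.
have sqn : size q = n + n.+1 by rewrite sq /n; clear; lia.
have [us [zr [dr [qE sus sdr]]]] : exists us zr dr,
    [/\ q = us ++ zr :: dr, size us = n & size dr = n].
  exists (take n q), (nth z0 q n), (drop n.+1 q).
  rewrite -drop_nth ?cat_take_drop ?size_drop ?size_takel ?sqn; try by clear; lia.
  by split=> //; clear; lia.
pose f1 i := nth z0 q i; pose f2 i := nth z0 (rev q) i.
have f1E : map f1 (iota 0 n) = us.
  by rewrite map_nth_iota0 ?sqn ?leq_addr // qE -sus take_size_cat.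
have f2E : map f2 (iota 0 n) = rev dr.
  rewrite map_nth_iota0 ?size_rev ?sqn ?leq_addr // qE rev_cat rev_cons cat_rcons.
  by rewrite -sdr -size_rev take_size_cat.
have uf : uniq (map f1 (iota 0 n) ++ map f2 (iota 0 n)).
  rewrite f1E f2E; move: uq; rewrite qE !cat_uniq rev_uniq /=.
  case/and3P=> -> /norP[_ dN] /andP[_ ->]; rewrite andbT /=.
  by apply: contra dN => /hasP[v]; rewrite mem_rev => vd vu; apply/hasP; exists v.
have mq v : v \in us ++ rev dr -> v \in q.
  by rewrite qE !mem_cat mem_rev inE => /orP[] ->; rewrite ?orbT.
have fresh3 v : v \in q -> [/\ v \in R, v \notin A, v \notin A2 & v \notin pad].
  move/subq; rewrite !inE !negb_or -!andbA => /and5P[v2 v1 vA vp vR].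
  by rewrite vA vp vR v1 v2.
have fP v : v \in map f1 (iota 0 n) ++ map f2 (iota 0 n) -> occ R A4 v /\
    c v + (v == z0) + (v == z0) + (v \in belast z0 pad) + (v \in [:: a1, a2 & q]) < 3.
  rewrite f1E f2E => /mq vq; have [vR vA vA2 vpad] := fresh3 v vq.
  split; first by rewrite /occ !inE vq !orbT.
  have [_ ->] := st; last by rewrite inE vA.
  rewrite z0ne // !add0n.
  have -> : (v \in belast z0 pad) = false.
    by apply/negP=> /mem_belast; rewrite inE z0ne //= (negPf vpad).
  by rewrite add0n; case: (_ \in _).
have cA4 : #|A4| <= #|A| + g + (2 * h + 3).
  apply: leq_trans (leq_card_setU _ _) _.
  by apply: leq_add => //; rewrite cardsE -sq card_size.
have room5 : #|A4| + size (iota 0 n) * (2 * h + 3) + 13 * m <= #|R|.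
  by rewrite size_iota; move: room cA4; rewrite gE /n; clear; lia.
have [Q [QP uQ subQ st5]] := connect_pairs e_sym mE joined st4 uf fP room5.
have [fl flE] : exists fl, fl = flatten (map Q (iota 0 n)) by eexists.
rewrite -flE in uQ subQ st5; rewrite f1E f2E in st5.
have sQ v : v \in fl -> v \in R :\: A4 := subQ v.
have [tr [[trT trB trM] [trP trS trN]]] : exists tr : seq (V * seq V * V),
    [/\ tops tr = us, bots tr = rev dr & mids tr = fl] /\
    [/\ forall t, t \in tr -> path e t.1.1 (rcons t.1.2 t.2),
        forall t, t \in tr -> size t.1.2 = 2 * h + 3 & size tr = n].
  exists [seq (f1 i, Q i, f2 i) | i <- iota 0 n]; split; split.
  - by rewrite /tops -map_comp -f1E.
  - by rewrite /bots -map_comp -f2E.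
  - by rewrite /mids -map_comp flE.
  - by move=> t /mapP[i /QP[iP _] ->].
  - by move=> t /mapP[i /QP[_ iS] ->].
  - by rewrite size_map size_iota.
have zsize b : (size (zig zr b tr)).+1 = g.
  by rewrite (zig_size _ _ trS) trN gE /n; clear; lia.
have [pus pdr] : path e a1 (rcons us zr) /\ path e a2 (rcons (rev dr) zr).
  move: pq; rewrite qE rcons_cat rcons_cons -cat_rcons cat_path last_rcons => /andP[-> pz].
  by rewrite -path_rcons_rev.
have zpath b : path e (if b then a1 else a2) (zig zr b tr).
  by apply: zig_path => //; rewrite ?trT ?trB.
pose L := [:: a1, a2 & pad ++ q ++ fl].
pose new := [set:: L].
have subN v : v \in L -> v \in R :\: A.
  rewrite /L !inE !mem_cat => /predU1P[->|/predU1P[->|/or3P[/subpad|/subq|/sQ]]];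
    rewrite ?a1A ?a1R' ?a2A ?a2R' // !inE !negb_or -!andbA.
  - by case/and4P=> _ _ -> ->.
  - by case/and5P=> _ _ -> _ ->.
  - by case/and4P=> _ _ -> /and3P[_ _ ->].
have uL : uniq (z0 :: L).
  rewrite cons_uniq; apply/andP; split.
    by apply/negP=> /subN; rewrite inE (negPf z0R) andbF.
  rewrite /L /= !inE !mem_cat !negb_or eq_sym a21 /= !cat_uniq upad uq uQ andbT /=.
  have dis2 v : v \in A2 -> [/\ v \notin pad, v \notin q & v \notin fl].
    move=> vA; split; apply/negP.
    - by move/subpad=> /setDP[_]; rewrite vA.
    - by move/subq=> /setDP[_]; rewrite in_setU vA.
    - by move/sQ=> /setDP[_]; rewrite in_setU in_setU vA.
  have [-> -> ->] := dis2 _ a1A2; have [-> -> ->] := dis2 _ a2A2 => /=.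
  apply/andP; split; apply/hasPn=> v.
    rewrite mem_cat => /orP[/fresh3[]//|/sQ /setDP[_]].
    by rewrite !in_setU !negb_or [v \in [set:: pad]]inE => /andP[/andP[_ ->]].
  by move/sQ => /setDP[_]; rewrite in_setU negb_or [v \in [set:: q]]inE => /andP[].
have Lcnt v : (v \in z0 |: new : nat) = count_mem v (z0 :: L).
  by rewrite (count_uniq_mem v uL) !inE.
have cL : #|new| < 2 * g.
  rewrite /new cardsE (leq_ltn_trans (card_size _)) //= !size_cat spad sq flE.
  have -> : size (flatten (map Q (iota 0 n))) = n * (2 * h + 3).
    have : forall i, i \in iota 0 n -> size (Q i) = 2 * h + 3 by move=> i /QP[].
    rewrite -{3}(size_iota 0 n); elim: (iota 0 n) => //= i s IH sP.
    by rewrite size_cat sP ?mem_head // IH ?mulSn // => j js; rewrite sP // inE js orbT.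
  by rewrite gE /n; clear; lia.
exists a1, a2, (last z0 pad), zr, new.
have A5 : A4 :|: [set:: fl] = A :|: new.
  apply/setP=> v; rewrite /A4 /A3 /A2 /new /L !in_setU !in_set1 !inE !mem_cat.
  by case: (v == a1); case: (v == a2); case: (v \in A); rewrite ?orbT //= !orbA.
rewrite A5 in st5; eexists; split; [split; [| | exact: st5 | |] | | |].
- by apply/subsetP=> v; rewrite inE => /subN.
- exact: ltnW.
- move=> v; rewrite /new inE => vL vz; rewrite (negPf vz) !addn0.
  move: vL; rewrite /L !inE !mem_cat !negb_or => /and5P[v1 v2 vp vq vf].
  have -> : (v \in belast z0 pad) = false.
    by apply/negP=> /mem_belast; rewrite inE (negPf vz) (negPf vp).
  rewrite (negPf v1) (negPf v2) (negPf vq) (negPf vf) !orbF.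
  have : v \notin us ++ rev dr by apply: contra vq => /mq.
  by rewrite mem_cat => /norP[/negPf -> /negPf ->]; rewrite !addn0.
- move=> v; rewrite /new inE => vL; have vRA := subN v vL.
  have vR := subsetP (subsetDl _ _) _ vRA.
  have [_ ->] := st; last exact: vRA.
  rewrite z0ne // !add0n -(addn1 1); apply: leq_add; last exact: leq_b1.
  case: (boolP (v \in belast z0 pad)) => [/mem_belast|_]; last exact: leq_b1.
  rewrite inE z0ne //= => vp; rewrite !inE.
  have := subpad v vp; rewrite !inE !negb_or -!andbA => /and4P[/negPf -> /negPf -> _ _] /=.
  by case: (boolP (v \in q)) => // /fresh3[_ _ _]; rewrite vp.
- rewrite /new /L !inE !mem_cat eqxx eqxx ?orbT; split => //.
    case: (lastP pad) spad => [|r x _]; last by rewrite last_rcons mem_rcons mem_head !orbT.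
    by rewrite gE /=; clear; lia.
  by rewrite qE mem_cat mem_head !orbT.
- exists [:: a1, z0 & pad], (a2 :: zig zr false tr); split.
  + exists (z0 :: pad); split=> //=; first by rewrite e_sym za1.
    by rewrite spad gE; clear; lia.
  + exists (zig zr false tr); split=> //; [exact: (zpath false)|exact: zig_last|exact: (zsize false)].
  + move=> v; rewrite Lcnt /L /= zig_count trT trB trM qE !count_cat /= count_rev.
    move: (count_mem v us) (count_mem v dr) (count_mem v pad) (count_mem v fl).
    by clear; lia.
- exists (a1 :: zig zr true tr), [:: a2, z0 & pad]; split.
  + exists (zig zr true tr); split=> //; [exact: (zpath true)|exact: zig_last|exact: (zsize true)].
  + exists (z0 :: pad); split=> //=; first by rewrite e_sym za2.
    by rewrite spad gE; clear; lia.
  + move=> v; rewrite Lcnt /L /= zig_count trT trB trM qE !count_cat /= count_rev.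
    move: (count_mem v us) (count_mem v dr) (count_mem v pad) (count_mem v fl).
    by clear; lia.
Qed.
End Gadget.

(** * Layers of switches *)

Section Layer.
Variables (V : finType) (e : rel V) (R : {set V}) (m h : nat).
Hypothesis e_sym : symmetric e.
Hypothesis mE : m = 2 ^ h.
Hypothesis joined : forall U1 U2 : {set V}, m <= #|U1| -> m <= #|U2| ->
  exists x y, [/\ x \in U1, y \in U2 & e x y].
Variable I : finType.
Implicit Types (s : I -> I) (t : {perm I}).

(** Fixed points of [s] are wires without a switch. *)
Definition switching s t := forall x, t x = x \/ t x = s x.

(** Whatever the positions of the switches, the same vertex set [N] splits into
    routes joining the inputs [a] to the outputs [b] as prescribed. Covering [N]
    exactly once is stated by counting, which turns concatenation and reindexing
    of route systems into identities between sums. *)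
Definition block g s (D : {set I}) (N : {set V}) (a b : I -> V) :=
  forall t, switching s t -> exists P : I -> seq V,
    (forall x, x \in D -> route e g (a x) (b (t x)) (P x))
    /\ forall v, \sum_(x in D) count_mem v (P x) = (v \in N).

Lemma block_union g s (D1 D2 : {set I}) (N1 N2 : {set V}) a1 b1 a2 b2 :
  (forall x, x \in D1 -> s x \in D1) -> (forall x, x \in D2 -> s x \in D2) ->
  [disjoint D1 & D2] -> [disjoint N1 & N2] ->
  block g s D1 N1 a1 b1 -> block g s D2 N2 a2 b2 ->
  block g s (D1 :|: D2) (N1 :|: N2) (fun x => if x \in D1 then a1 x else a2 x)
    (fun x => if x \in D1 then b1 x else b2 x).
Proof.
move=> s1 s2 dD dN B1 B2 t st.
have [P1 [r1 c1]] := B1 t st; have [P2 [r2 c2]] := B2 t st.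
have st1 x : x \in D1 -> t x \in D1 by case: (st x) => -> // /s1.
have st2 x : x \in D2 -> t x \in D2 by case: (st x) => -> // /s2.
exists (fun x => if x \in D1 then P1 x else P2 x); split.
  move=> x; rewrite inE; case: (boolP (x \in D1)) => /= [x1 _|x1 x2].
    by rewrite st1 //; apply: r1.
  by rewrite (disjointFl dD (st2 x x2)); apply: r2.
move=> v; rewrite (eq_bigl [in [predU D1 & D2]]) ?bigU //=; last by move=> x; rewrite !inE.
rewrite inE (eq_bigr (fun x => count_mem v (P1 x))) => [|x ->//].
rewrite [X in _ + X](eq_bigr (fun x => count_mem v (P2 x))); last first.
  by move=> x x2; rewrite (disjointFl dD x2).
rewrite c1 c2; case: (boolP (v \in N1)) => // v1.
by rewrite (disjointFr dN v1).
Qed.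

(** A wire without a switch needs a path as long as the routes through switches. *)
Lemma straight_wire (A : {set V}) c z0 : state e R m A c -> z0 \notin R -> c z0 = 0 ->
    #|A| + 2 * glen h + 13 * m <= #|R| ->
  exists a b (new : {set V}) c',
   [/\ [/\ new \subset R :\: A, #|new| <= 2 * glen h, state e R m (A :|: new) c',
          (forall v, v \notin new -> v != z0 -> c' v = c v)
        & (forall v, v \in new -> c' v <= 2)],
       a \in new /\ b \in new
     & (exists P, route e (glen h) a b P /\ forall v, count_mem v P = (v \in new))].
Proof.
move=> st z0R cz0; set g := glen h => room.
have gE : g = h.+1 * (2 * h + 3 + 2) + 2 by [].
have room1 : #|A| + g + 7 * m <= #|R| by move: room; clear; lia.
have [||q [pq sq uq subq stq]] := extend_path mE joined (s := z0) (j := g) st _ _ room1.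
- by rewrite /occ z0R.
- by rewrite cz0.
case: q sq pq uq subq stq => [|a r] sq pq uq subq stq; first by move: sq; rewrite gE addn2.
have z0ne v : v \in R -> (v == z0) = false by move=> vR; case: eqP z0R => // <-; rewrite vR.
exists a, (last a r), [set:: a :: r]; eexists; split; [split; [| |exact: stq| |]| |].
- by apply/subsetP=> v; rewrite inE => /subq.
- rewrite cardsE (leq_trans (card_size _)) // sq; clear; lia.
- move=> v; rewrite inE => vq vz; case: (boolP (v \in belast _ _)); last by rewrite addn0.
  by move=> /mem_belast; rewrite inE (negPf vz) (negPf vq).
- move=> v; rewrite inE => /subq vR; have [_ ->] := st; last exact: vR.
  by rewrite add0n (leq_trans (leq_b1 _)).
- by split; rewrite inE ?mem_head ?mem_last.
- exists (a :: r); split; first by exists r; split=> //; move: pq => /= /andP[].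
  by move=> v; rewrite inE (count_uniq_mem v uq).
Qed.

Lemma orbit_switch s (A : {set V}) c z0 x : involutive s -> state e R m A c -> z0 \notin R -> c z0 = 0 ->
    #|A| + 2 * glen h + 13 * m <= #|R| ->
  exists a b (new N : {set V}) c',
   [/\ [/\ new \subset R :\: A, #|new| <= 2 * glen h, state e R m (A :|: new) c',
          (forall v, v \notin new -> v != z0 -> c' v = c v)
        & (forall v, v \in new -> c' v <= 2)],
       N \subset z0 |: new,
       forall y, a y \in new /\ b y \in new
     & block (glen h) s [set x; s x] N a b].
Proof.
move=> sK st z0R cz0 room; have [sx|sx] := eqVneq (s x) x.
  have [a [b [new [c' [H [an bn] [P [rP cP]]]]]]] := straight_wire st z0R cz0 room.
  exists (fun=> a), (fun=> b), new, new, c'; split=> //; first exact: subsetUr.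
  move=> t _; exists (fun=> P); split=> // v.
  by rewrite sx setUid big_set1 cP.
have [a1 [a2 [b1 [b2 [new [c' [H [a1n a2n b1n b2n]]]]]]]] :=
  gadget e_sym mE joined st z0R cz0 room.
move=> [P1 [P2 [r1 r2 c12]]] [P1' [P2' [r1' r2' c12']]].
exists (fun y => if y == x then a1 else a2), (fun y => if y == x then b1 else b2).
exists new, (z0 |: new), c'; split=> //; first by move=> y; case: (y == x).
move=> t st'.
have xs : x != s x by rewrite eq_sym.
have [tx|tx] := st' x.
  have tsx : t (s x) = s x.
    case: (st' (s x)) => //; rewrite sK -{2}tx => /perm_inj /eqP.
    by rewrite (negPf sx).
  exists (fun y => if y == x then P1 else P2); split.
    by move=> y; rewrite !inE => /orP[] /eqP->; rewrite ?tx ?tsx ?eqxx // (negPf sx).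
  by move=> v; rewrite big_setU1 ?in_set1 //= big_set1 eqxx (negPf sx) c12.
have tsx : t (s x) = x.
  case: (st' (s x)); last by rewrite sK.
  by rewrite -{2}tx => /perm_inj /eqP; rewrite (negPf sx).
exists (fun y => if y == x then P1' else P2'); split.
  by move=> y; rewrite !inE => /orP[] /eqP->; rewrite ?tx ?tsx ?eqxx // (negPf sx).
by move=> v; rewrite big_setU1 ?in_set1 //= big_set1 eqxx (negPf sx) c12'.
Qed.

Definition orbits s (l : seq I) : {set I} := [set y | (y \in l) || (s y \in l)].

Lemma layer_seq s (l : seq I) (rho : I -> V) (A : {set V}) c :
    involutive s -> injective rho -> uniq l ->
    (forall x y, x \in l -> y \in l -> s x = y -> x = y) ->
    (forall x, x \in l -> rho x \notin R /\ c (rho x) = 0) ->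
    state e R m A c -> #|A| + size l * (2 * glen h) + 13 * m <= #|R| ->
  exists a b (new N : {set V}) c',
   [/\ [/\ new \subset R :\: A, #|new| <= size l * (2 * glen h), state e R m (A :|: new) c',
          (forall v, v \notin new -> v \notin map rho l -> c' v = c v)
        & (forall v, v \in new -> c' v <= 2)],
       N \subset new :|: [set:: map rho l],
       forall y, y \in orbits s l -> a y \in new /\ b y \in new
     & block (glen h) s (orbits s l) N a b].
Proof.
move=> sK rhoI; elim: l A c => [|x l IH] A c ul reps rhoP st room.
  exists rho, rho, set0, set0, c; split=> //.
  - by split; rewrite ?sub0set ?cards0 ?setU0 // => v; rewrite inE.
  - exact: sub0set.
  - by move=> y; rewrite inE.
  - move=> t _; exists (fun=> [::]); split=> [y|v]; rewrite ?inE //.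
    by rewrite big1 // => y; rewrite inE.
have room1 : #|A| + 2 * glen h + 13 * m <= #|R|.
  by move: room; clear; rewrite /= mulSn; lia.
have [rxR cx] := rhoP x (mem_head _ _).
have [a1 [b1 [new1 [N1 [c1 [[n1R n1c st1 c1o c1n] N1s ab1 B1]]]]]] := orbit_switch x sK st rxR cx room1.
have [xl ul'] := andP ul.
have reps' y z : y \in l -> z \in l -> s y = z -> y = z.
  by move=> yl zl; apply: reps; rewrite inE ?yl ?zl orbT.
have rhoP' y : y \in l -> rho y \notin R /\ c1 (rho y) = 0.
  move=> yl; have [|ryR cy] := rhoP y; first by rewrite inE yl orbT.
  split=> //; rewrite c1o //; first by apply: contra ryR => /(subsetP n1R) /setDP[].
  by apply: contra xl => /eqP /rhoI <-.
have room2 : #|A :|: new1| + size l * (2 * glen h) + 13 * m <= #|R|.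
  apply: leq_trans room; rewrite /= mulSn.
  rewrite [X in _ <= X + _]addnA !leq_add2r; apply: leq_trans (leq_card_setU _ _) _.
  by rewrite leq_add2l.
have [a2 [b2 [new2 [N2 [c2 [[n2R n2c st2 c2o c2n] N2s ab2 B2]]]]]] :=
  IH _ _ ul' reps' rhoP' st1 room2.
have new12 v : v \in new2 -> v \notin new1.
  by move/(subsetP n2R); rewrite !inE negb_or => /andP[/andP[]].
have oE : orbits s (x :: l) = [set x; s x] :|: orbits s l.
  apply/setP=> y; rewrite !inE -!orbA (can2_eq sK sK y x); congr (_ || _).
  by rewrite orbCA.
have s1 y : y \in [set x; s x] -> s y \in [set x; s x].
  by rewrite !inE => /orP[] /eqP->; rewrite ?sK eqxx ?orbT.
have s2 y : y \in orbits s l -> s y \in orbits s l by rewrite !inE sK orbC.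
have dD : [disjoint [set x; s x] & orbits s l].
  rewrite disjoint_subset; apply/subsetP=> y; rewrite !inE => yx.
  have rep z : z \in l -> s x != z.
    move=> zl; apply: contra xl => /eqP sxz; rewrite (reps x z) ?mem_head //.
    by rewrite inE zl orbT.
  have sxl : s x \notin l by apply/negP=> /rep; rewrite eqxx.
  by case/orP: yx => /eqP->; rewrite ?sK negb_or xl sxl.
have dN : [disjoint N1 & N2].
  rewrite disjoint_subset; apply/subsetP=> v /(subsetP N1s); rewrite inE => v1.
  apply/negP=> /(subsetP N2s); rewrite !inE in v1 *.
  case/orP: v1 => [/eqP ->|v1].
    case/orP=> [/(subsetP n2R) /setDP[] | /mapP[y yl /rhoI xy]].
      by rewrite (negPf rxR).
    by move: xl; rewrite xy yl.
  case/orP=> [/new12|/mapP[y yl vy]]; first by rewrite v1.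
  have [ryR _] := rhoP' y yl; move/(subsetP n1R): v1; rewrite vy inE (negPf ryR).
  by rewrite andbF.
have B := block_union s1 s2 dD dN B1 B2.
exists (fun y => if y \in [set x; s x] then a1 y else a2 y).
exists (fun y => if y \in [set x; s x] then b1 y else b2 y).
exists (new1 :|: new2), (N1 :|: N2), c2; rewrite oE; split=> //.
- split.
  + rewrite subUset n1R /=; apply: subset_trans n2R _; rewrite setDS //; exact: subsetUl.
  + by apply: leq_trans (leq_card_setU _ _) _; rewrite /= mulSn leq_add.
  + by rewrite setUA.
  + move=> v; rewrite !inE !negb_or => /andP[v1 v2] /andP[vx vl].
    by rewrite c2o // c1o.
  + move=> v; rewrite inE; case: (boolP (v \in new2)) => [/c2n //|v2].
    rewrite orbF => v1; rewrite c2o ?c1n //; apply/negP=> /mapP[y yl vy].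
    have [ryR _] := rhoP' y yl; move/(subsetP n1R): v1; rewrite vy inE (negPf ryR).
    by rewrite andbF.
- rewrite subUset; apply/andP; split.
    apply: subset_trans N1s _; apply/subsetP=> v; rewrite !inE.
    by case/orP=> ->; rewrite ?orbT.
  apply: subset_trans N2s _; apply/subsetP=> v; rewrite !inE.
  by case/orP=> ->; rewrite ?orbT.
- move=> y; rewrite inE; case: (boolP (y \in [set x; s x])) => /= _ yl.
    by have [? ?] := ab1 y; rewrite !inE; split; apply/orP; left.
  by have [? ?] := ab2 y yl; rewrite !inE; split; apply/orP; right.
Qed.

Lemma layer s (rho : I -> V) (A : {set V}) c :
    involutive s -> injective rho ->
    (forall x, rho x \notin R /\ c (rho x) = 0) ->
    state e R m A c -> #|A| + #|I| * (2 * glen h) + 13 * m <= #|R| ->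
  exists a b (new N : {set V}) c',
   [/\ [/\ new \subset R :\: A, #|new| <= #|I| * (2 * glen h), state e R m (A :|: new) c',
          (forall v, v \notin new -> v \notin codom rho -> c' v = c v)
        & (forall v, v \in new -> c' v <= 2)],
       N \subset new :|: [set:: codom rho],
       forall y, a y \in new /\ b y \in new
     & block (glen h) s setT N a b].
Proof.
move=> sK rhoI rhoP st room.
pose l := [seq x <- enum I | enum_rank x <= enum_rank (s x)].
have ul : uniq l by rewrite filter_uniq ?enum_uniq.
have reps x y : x \in l -> y \in l -> s x = y -> x = y.
  rewrite !mem_filter => /andP[x1 _] /andP[y1 _] xy.
  by move: x1 y1; rewrite -xy sK => x1 y1; apply/enum_rank_inj/val_inj/eqP; rewrite eqn_leq x1.
have sl : size l <= #|I| by rewrite cardE size_filter count_size.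
have room' : #|A| + size l * (2 * glen h) + 13 * m <= #|R|.
  by apply: leq_trans room; rewrite leq_add2r leq_add2l leq_mul2r sl orbT.
have [a [b [new [N [c' [[nR nc st' co cn] Ns ab B]]]]]] :=
  layer_seq sK rhoI ul reps (fun x _ => rhoP x) st room'.
have oT : orbits s l = setT.
  have lE z : (z \in l) = (enum_rank z <= enum_rank (s z)).
    by rewrite mem_filter mem_enum andbT.
  apply/setP=> y; rewrite !inE !lE sK; exact: leq_total.
have sub : {subset map rho l <= codom rho} by move=> v /mapP[x _ ->]; apply: codom_f.
exists a, b, new, N, c'; split.
- split=> //; first by apply: leq_trans nc _; rewrite leq_mul2r sl orbT.
  by move=> v vn vr; apply: co => //; apply: contra vr => /sub.
- apply: subset_trans Ns _; apply: setUS; apply/subsetP=> v; rewrite !inE; exact: sub.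
- by move=> y; apply: ab; rewrite oT inE.
- by rewrite -oT.
Qed.
End Layer.

(** * Rearrangeable networks *)

Section Benes.
Local Open Scope group_scope.
Variable I : finType.
Implicit Types (s al be : I -> I) (t phi : {perm I}) (X : {set I}).

Definition alternates s (c : I -> bool) := forall x, s x != x -> c (s x) = ~~ c x.

(** The union of two matchings is bipartite. Contract an edge [{x, y}] of the
    first matching: the partners of [x] and [y] in the second become partners of
    each other, hence get opposite colours, which leaves opposite colours for
    [x] and [y]. *)
Lemma two_colouring al be : involutive al -> involutive be ->
  exists c, alternates al c /\ alternates be c.
Proof.
have [n] := ubnP #|[set x | al x != x]|; elim: n => // n IH in al be *.
rewrite ltnS => le_n alK beK.
have [x alx|alid] := pickP [pred x | al x != x]; last first.
  exists (fun x => enum_rank x < enum_rank (be x)); split=> x.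
    by have /= := alid x => ->.
  rewrite beK => bx; have : enum_rank (be x) != enum_rank x :> nat.
    by apply: contra bx => /eqP/val_inj/enum_rank_inj ->.
  by rewrite -leqNgt ltn_neqAle eq_sym => ->.
set y := al x in alx; have aly : al y = x by rewrite /y alK.
rewrite /= in alx.
pose al' z := if (z == x) || (z == y) then z else al z.
have al'K : involutive al'.
  move=> z; rewrite /al'; case: (boolP ((z == x) || (z == y))) => [->//|zN].
  by rewrite (inv_eq alK z x) (inv_eq alK z y) aly -/y orbC (negPf zN) alK.
pose be' z := if (z == x) || (z == y) then z else
  if be z == x then (if be y == y then z else be y) else
  if be z == y then (if be x == x then z else be x) else be z.
have bexy : (be x == y) = (be y == x) by rewrite (inv_eq beK) eq_sym.
have be'K : involutive be'.
  move=> z; rewrite /be'; case: (boolP ((z == x) || (z == y))) => [->//|zN].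
  have [zx zy] := norP zN.
  case: (eqVneq (be z) x) => [bzx|bzx].
    have bx : be x = z by rewrite -bzx beK.
    case: (eqVneq (be y) y) => [byy|byy]; first by rewrite /= (negPf zN) ?bzx ?eqxx ?byy ?eqxx.
    have byx : be y != x by rewrite -bexy bx.
    by rewrite (negPf byx) (negPf byy) /= beK (negPf alx) eqxx bx (negPf zx).
  case: (eqVneq (be z) y) => [bzy|bzy].
    have by' : be y = z by rewrite -bzy beK.
    case: (eqVneq (be x) x) => [bxx|bxx].
      by rewrite /= (negPf zN) ?bzy ?(negPf alx) ?eqxx ?bxx ?eqxx.
    have bxy : be x != y by rewrite bexy by'.
    by rewrite (negPf bxx) (negPf bxy) /= beK eqxx by' (negPf zy).
  by rewrite (negPf bzx) (negPf bzy) /= beK (negPf zx) (negPf zy).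
have card' : #|[set z | al' z != z]| < n.
  apply: leq_trans le_n; apply: proper_card; apply/properP; split.
    by apply/subsetP=> z; rewrite !inE /al'; case: ifP => //; rewrite eqxx.
  by exists x; rewrite !inE // /al' eqxx /= eqxx.
have [c [ca cb]] := IH al' be' card' al'K be'K.
pose inxy z := (z == x) || (z == y).
pose v := if ~~ inxy (be x) then ~~ c (be x) else if ~~ inxy (be y) then c (be y) else true.
exists (fun z => if z == x then v else if z == y then ~~ v else c z); split=> z.
  case: (eqVneq z x) => [->|zx] alz; first by rewrite -/y (negPf alx) eqxx.
  case: (eqVneq z y) => [zy|zy]; first by rewrite zy aly eqxx negbK.
  have alzx : al z != x by rewrite (inv_eq alK) -/y.
  have alzy : al z != y by rewrite (inv_eq alK) aly.
  have := ca z; rewrite /al' (negPf zx) (negPf zy) (negPf alzx) (negPf alzy) /=.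
  exact.
have vx : ~~ inxy (be x) -> c (be x) = ~~ v by rewrite /v => ->; rewrite negbK.
have vy : ~~ inxy (be y) -> c (be y) = v.
  rewrite /v => by'; case: (boolP (inxy (be x))) => bx /=; rewrite ?by' //.
  have [bxx bxy] := norP bx; have [byx byy] := norP by'.
  have := cb (be x); rewrite /be' (negPf bxx) (negPf bxy) beK eqxx (negPf byy).
  by move=> -> //; apply: contra alx => /eqP/(can_inj beK)/eqP.
case: (eqVneq z x) => [->|zx] bez.
  rewrite (negPf bez); case: (eqVneq (be x) y) => // bxy.
  by apply: vx; rewrite /inxy negb_or bez.
case: (eqVneq z y) => [zy|zy].
  rewrite zy in bez *; rewrite (negPf bez); case: (eqVneq (be y) x) => [_|byx].
    by rewrite negbK.
  by rewrite negbK; apply: vy; rewrite /inxy negb_or bez byx.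
case: (eqVneq (be z) x) => [bzx|bzx].
  have bx : be x = z by rewrite -bzx beK.
  by have := vx; rewrite bx /inxy (negPf zx) (negPf zy) => -> //; rewrite negbK.
case: (eqVneq (be z) y) => [bzy|bzy].
  have bx : be y = z by rewrite -bzy beK.
  by have := vy; rewrite bx /inxy (negPf zx) (negPf zy) => ->.
have := cb z; rewrite /be' (negPf zx) (negPf zy) (negPf bzx) (negPf bzy) /=.
exact.
Qed.

(** [phi] is the effect of the layers [ss] for some position of the switches. *)
Fixpoint realizes (ss : seq (I -> I)) phi : Prop :=
  if ss is s :: ss' then
    exists t phi', [/\ switching s t, realizes ss' phi' & phi = t * phi']
  else phi = 1.

Definition supported s X := forall x, x \notin X -> s x = x.

Lemma switching_on s t X : supported s X -> switching s t -> perm_on X t.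
Proof.
move=> sX st; apply/subsetP=> x; rewrite inE; apply: contraR => xX.
by case: (st x) => ->; rewrite ?sX.
Qed.

Lemma realizes_on ss phi X : (forall s, List.In s ss -> supported s X) ->
  realizes ss phi -> perm_on X phi.
Proof.
elim: ss phi => [|s ss IH] phi sX /=; first by move->; apply: perm_on1.
move=> [t [phi' [st r ->]]]; apply: perm_onM.
  by apply: switching_on st; apply: sX; left.
by apply: IH r => u us; apply: sX; right.
Qed.
(** The involution pairs the two halves; if [X] has odd size, its fixed point is
    put in the larger half. *)
Lemma halving X : exists (X0 X1 : {set I}) (al : I -> I),
  [/\ X = X0 :|: X1, [disjoint X0 & X1],
      involutive al /\ supported al X,
      (forall x, x \in X0 -> al x \in X1) /\
      (forall x, x \in X1 -> al x != x -> al x \in X0)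
    & (forall x y, x \in X1 -> y \in X1 -> al x = x -> al y = y -> x = y)
      /\ #|X1| <= #|X0|.+1].
Proof.
have [n] := ubnP #|X|; elim: n => // n IH in X *; rewrite ltnS => le_n.
have [x xX|X0] := pickP [in X]; last first.
  exists set0, set0, id; split=> //; try by split=> x; rewrite inE.
  - by apply/setP=> x; rewrite !inE; apply: X0.
  - by rewrite disjoint_subset; apply/subsetP=> x; rewrite inE.
  - by split=> [x y|]; rewrite ?inE ?cards0.
have [y yX|Y0] := pickP [in X :\ x]; last first.
  have XE : X = [set x].
    apply/setP=> y; rewrite inE; have := Y0 y; rewrite !inE.
    by case: eqP => [->|_] //= _; exact: xX.
  exists set0, [set x], id; split=> //; rewrite ?set0U //.
  - by rewrite disjoint_subset; apply/subsetP=> z; rewrite inE.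
  - by split=> z; rewrite ?in_set0 ?eqxx // inE eqxx.
  - by split=> [a b|]; rewrite ?cards1 ?cards0 // !inE => /eqP -> /eqP ->.
have {}yX : y != x /\ y \in X by apply/andP; move: yX; rewrite !inE.
have [yx yX'] := yX; rewrite /= in xX.
have card2 : #|X :\ x :\ y| < n.
  apply: leq_trans le_n; rewrite (cardsD1 x X) xX ltnS.
  by apply: subset_leq_card; apply: subsetDl.
have [X0 [X1 [al [XE dX [alK alX] [al0 al1] [alfix c1]]]]] := IH _ card2.
have XN z : z \in X0 :|: X1 -> (z == x) = false /\ (z == y) = false.
  by rewrite -XE !inE => /and3P[/negPf -> /negPf ->].
have x01 : x \notin X0 :|: X1 by apply/negP=> /XN[]; rewrite eqxx.
have y01 : y \notin X0 :|: X1 by apply/negP=> /XN[_]; rewrite eqxx.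
have [x0 x1] : x \notin X0 /\ x \notin X1 by apply/andP; move: x01; rewrite inE negb_or.
have [y0 y1] : y \notin X0 /\ y \notin X1 by apply/andP; move: y01; rewrite inE negb_or.
have alx : al x = x by apply: alX; rewrite XE.
have aly : al y = y by apply: alX; rewrite XE.
pose al' z := if z == x then y else if z == y then x else al z.
have al'x : al' x = y by rewrite /al' eqxx.
have al'y : al' y = x by rewrite /al' (negPf yx) eqxx.
have al'z z : z != x -> z != y -> al' z = al z by rewrite /al' => /negPf -> /negPf ->.
have N0 z : z \in X0 -> z != x /\ z != y.
  by move=> zX; have [|-> ->] := XN z; rewrite // inE zX.
have N1 z : z \in X1 -> z != x /\ z != y.
  by move=> zX; have [|-> ->] := XN z; rewrite // inE zX orbT.
exists (x |: X0), (y |: X1), al'; split.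
- apply/setP=> z; have /setP/(_ z) := XE; rewrite !inE.
  by case: eqP => [->|_]; case: eqP => [->|_] //=; rewrite ?yX' ?xX ?orbT // => <-.
- rewrite disjoint_subset; apply/subsetP=> z; rewrite !inE negb_or => /predU1P[->|z0].
    by rewrite eq_sym yx x1.
  by have [_ ->] := N0 z z0; rewrite (disjointFr dX z0).
- split=> [z|z zX].
    have [->|zx] := eqVneq z x; first by rewrite al'x al'y.
    have [->|zy] := eqVneq z y; first by rewrite al'y al'x.
    by rewrite al'z // al'z ?alK // (inv_eq alK) ?alx ?aly.
  rewrite al'z; last by apply: contra zX => /eqP ->.
    by apply: alX; apply: contra zX; rewrite !inE => /and3P[].
  by apply: contra zX => /eqP ->.
- split=> z; rewrite !inE.
    move=> /predU1P[->|z0]; first by rewrite al'x eqxx.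
    by have [zx zy] := N0 z z0; rewrite al'z // al0 ?orbT.
  move=> /predU1P[->|z1]; first by rewrite al'y eqxx.
  by have [zx zy] := N1 z z1; rewrite al'z // => /al1 -> //; rewrite orbT.
- split=> [a b|]; last by rewrite !cardsU1 x0 y1 !add1n.
  rewrite !inE => /predU1P[->|a1] /predU1P[->|b1] //; rewrite ?al'y.
  + by move=> xy; case/eqP: yx.
  + by move=> _ xy; case/eqP: yx.
  + have [? ?] := N1 a a1; have [? ?] := N1 b b1; rewrite !al'z //; exact: alfix.
Qed.

(** Moved points come in bichromatic pairs, so the fixed point [y] alone decides
    which colour is in excess. *)
Lemma alternates_card s c X y : involutive s -> alternates s c ->
  (forall x, x \in X -> s x \in X) -> y \in X -> s y = y ->
  (forall x, x \in X -> s x = x -> x = y) ->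
  #|[set x in X | c x]| + ~~ c y = #|[set x in X | ~~ c x]| + c y.
Proof.
move=> sK sc sX yX sy fixy.
have eqc : #|[set x in X | c x && (x != y)]| = #|[set x in X | ~~ c x && (x != y)]|.
  have le b : #|[set x in X | (c x == b) && (x != y)]|
      <= #|[set x in X | (c x == ~~ b) && (x != y)]|.
    rewrite -(card_imset _ (inv_inj sK)); apply: subset_leq_card.
    apply/subsetP=> z /imsetP[x]; rewrite !inE => /and3P[xX /eqP cx xy] ->.
    have sx : s x != x by apply: contra xy => /eqP /(fixy x xX) ->.
    rewrite sX // sc // cx eqxx /=; apply: contra xy => /eqP sxy.
    by rewrite -(sK x) sxy sy.
  have E b : [set x in X | (c x == b) && (x != y)]
     = [set x in X | (if b then c x else ~~ c x) && (x != y)].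
    by apply/setP=> x; rewrite !inE; case: b; rewrite ?eqb_id ?eqbF_neg.
  apply/eqP; rewrite eqn_leq; apply/andP; split.
    by have := le true; rewrite !E.
  by have := le false; rewrite !E.
have rem (d : I -> bool) : #|[set x in X | d x]| = d y + #|[set x in X | d x && (x != y)]|.
  rewrite (cardsD1 y) inE yX /=; congr (_ + _); apply: eq_card => x.
  by rewrite !inE; case: (x != y); rewrite ?andbT ?andbF.
by rewrite (rem c) (rem (fun x => ~~ c x)) eqc; case: (c y); rewrite /= ?addn0 ?add0n addnC.
Qed.

Lemma swap_perm s (d : I -> bool) : involutive s -> (forall x, d (s x) = d x) ->
  exists t, switching s t /\ forall x, t x = if d x then s x else x.
Proof.
move=> sK ds; pose f x := if d x then s x else x.
have fK : involutive f by move=> x; rewrite /f; case dx: (d x); rewrite ?ds dx ?sK.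
exists (perm (inv_inj fK)); split=> x; rewrite permE /f //.
by case: ifP; [right|left].
Qed.

Lemma realizes_par X0 X1 (ss0 ss1 : seq (I -> I)) phi0 phi1 : [disjoint X0 & X1] ->
  size ss0 = size ss1 ->
  (forall s, List.In s ss0 -> involutive s /\ supported s X0) ->
  (forall s, List.In s ss1 -> involutive s /\ supported s X1) ->
  realizes ss0 phi0 -> realizes ss1 phi1 ->
  realizes [seq p.2 \o p.1 | p <- zip ss0 ss1] (phi0 * phi1).
Proof.
move=> dX; elim: ss0 ss1 phi0 phi1 => [|s0 ss0 IH] [|s1 ss1] //= phi0 phi1.
  by move=> _ _ _ -> ->; rewrite mul1g.
move=> [ss] sP0 sP1 [t0 [psi0 [st0 r0 ->]]] [t1 [psi1 [st1 r1 ->]]].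
have [s0K sX0] := sP0 s0 (or_introl erefl); have [s1K sX1] := sP1 s1 (or_introl erefl).
have sP0' s : List.In s ss0 -> involutive s /\ supported s X0 by move=> ?; apply: sP0; right.
have sP1' s : List.In s ss1 -> involutive s /\ supported s X1 by move=> ?; apply: sP1; right.
exists (t0 * t1), (psi0 * psi1); split.
- move=> x; rewrite permM /=; have on0 := switching_on sX0 st0.
  have [x0|x0] := boolP (x \in X0).
    have fix1 z : z \in X0 -> s1 z = z by move=> zX; apply: sX1; rewrite (disjointFr dX).
    have fixt z : z \in X0 -> t1 z = z by move=> zX; case: (st1 z) => ->; rewrite ?fix1.
    have sx0 : s0 x \in X0.
      apply/negPn/negP=> h; have xe := sX0 _ h; rewrite s0K in xe.
      by rewrite -xe x0 in h.
    have tx0 : t0 x \in X0 by rewrite (perm_closed _ on0).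
    by rewrite fixt // fix1.
  by rewrite (out_perm on0 x0) (sX0 _ x0).
- exact: IH.
- rewrite !mulgA; congr (_ * _); rewrite -!mulgA; congr (_ * _).
  have on0 : perm_on X0 psi0 by apply: realizes_on r0 => s /sP0'[].
  have on1 := switching_on sX1 st1.
  exact: perm_onC on0 on1 dX.
Qed.

Lemma supported_closed s X x : involutive s -> supported s X -> x \in X -> s x \in X.
Proof.
move=> sK sX xX; apply/negPn/negP=> h; have xe := sX _ h.
by rewrite sK in xe; rewrite -xe xX in h.
Qed.

Lemma realizes_rcons ss s phi t : realizes ss phi -> switching s t ->
  realizes (rcons ss s) (phi * t).
Proof.
move=> + st; elim: ss phi => [|u ss IH] phi /=.
  by move->; exists t, 1; split=> //; rewrite mul1g mulg1.
move=> [t' [phi' [st' r ->]]]; exists t', (phi' * t); split=> //; first exact: IH.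
by rewrite mulgA.
Qed.

Lemma In_rcons (T : Type) (x y : T) (l : seq T) : List.In x (rcons l y) -> x = y \/ List.In x l.
Proof.
elim: l => [|a l IH] /=; first by case=> [->|//]; left.
by case=> [->|/IH[]]; [right; left|left|right; right].
Qed.

Lemma In_zip_comp (ss0 ss1 : seq (I -> I)) s :
  List.In s [seq p.2 \o p.1 | p <- zip ss0 ss1] ->
  exists s0 s1, [/\ List.In s0 ss0, List.In s1 ss1 & s = s1 \o s0].
Proof.
elim: ss0 ss1 => [|s0 ss0 IH] [|s1 ss1] //= [<-|/IH [u0 [u1 [i0 i1 ->]]]].
  by exists s0, s1; split=> //; left.
by exists u0, u1; split=> //; right.
Qed.

Lemma restrict_perm phi X0 X1 : [disjoint X0 & X1] -> perm_on (X0 :|: X1) phi ->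
    (forall x, x \in X0 -> phi x \in X0) -> (forall x, x \in X1 -> phi x \in X1) ->
  exists phi0 phi1, [/\ perm_on X0 phi0, perm_on X1 phi1 & phi = phi0 * phi1].
Proof.
move=> dX on st0 st1.
have restr (X : {set I}) : (forall x, x \in X -> phi x \in X) ->
    exists psi, perm_on X psi /\ forall x, x \in X -> psi x = phi x.
  move=> stX; pose f x := if x \in X then phi x else x.
  have fI : injective f.
    move=> x y; rewrite /f; case: ifP => xX; case: ifP => yX //.
    - exact: perm_inj.
    - by move=> pxy; rewrite -pxy stX in yX.
    - by move=> pxy; rewrite pxy stX in xX.
  exists (perm fI); split=> [|x xX]; last by rewrite permE /f xX.
  by apply/subsetP=> x; rewrite inE permE /f; case: ifP => //; rewrite eqxx.
have [phi0 [on0 E0]] := restr X0 st0; have [phi1 [on1 E1]] := restr X1 st1.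
exists phi0, phi1; split=> //; apply/permP=> x; rewrite permM.
have [x0|x0] := boolP (x \in X0).
  by rewrite E0 // (out_perm on1) // (disjointFr dX) // st0.
rewrite (out_perm on0 x0); have [x1|x1] := boolP (x \in X1); first by rewrite E1.
by rewrite (out_perm on1 x1) (out_perm on) // inE negb_or x0.
Qed.

(** Benes's recursion, for any number of wires. Colour the inputs so that both
    the input pairs and the pairs of inputs with paired outputs are bichromatic.
    The first layer sends the colours to the two halves, the last layer undoes
    this at the outputs, and each half is routed by a smaller network. When the
    number of wires is odd, the unpaired input and the unpaired output must get
    the same colour; this follows by counting the colour classes in two ways. *)
Lemma benes_on a X : (#|X| <= 2 ^ a)%N -> exists ss : seq (I -> I),
  [/\ size ss = (2 * a)%N, forall s, List.In s ss -> involutive s /\ supported s X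
    & forall phi, perm_on X phi -> realizes ss phi].
Proof.
elim: a X => [|a IH] X cX.
  exists [::]; split=> // phi on /=; apply/permP=> x; rewrite perm1.
  have [xX|] := boolP (x \in X); last exact: out_perm.
  have pX : phi x \in X by rewrite perm_closed.
  by move: cX; rewrite expn0 => /card_le1_eqP; apply.
have [X0 [X1 [al [XE dX [alK alX] [al0 al1] [alfix c1]]]]] := halving X.
have c0 : #|X0| <= #|X1|.
  rewrite -(card_imset _ (inv_inj alK)); apply: subset_leq_card.
  by apply/subsetP=> z /imsetP[x /al0 ? ->].
have c01 : (#|X0| + #|X1| <= 2 * 2 ^ a)%N.
  rewrite -expnS; apply: leq_trans cX; rewrite XE cardsU.
  by move: dX; rewrite -setI_eq0 => /eqP->; rewrite cards0 subn0.
have [|ss0 [sz0 P0 R0]] := IH X0.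
  by move: (#|X0|) (#|X1|) c0 c01 => x y; clear; lia.
have [|ss1 [sz1 P1 R1]] := IH X1.
  by move: (#|X0|) (#|X1|) c1 c01 => x y; clear; lia.
pose mid := [seq p.2 \o p.1 | p <- zip ss0 ss1].
exists (al :: rcons mid al); split.
- by rewrite /= size_rcons size_map size_zip sz0 sz1 minnn mulnS.
- move=> s []; first by move=> <-.
  move=> h; case: (In_rcons h) => [e|]; first by rewrite e.
  move=> {h}/In_zip_comp[s0 [s1 [/P0[s0K s0X] /P1[s1K s1X] ->]]]; split; last first.
    move=> x; rewrite XE inE negb_or => /andP[x0 x1] /=; by rewrite s0X // s1X.
  move=> x /=; have [x0|x0] := boolP (x \in X0).
    have sx0 := supported_closed s0K s0X x0.
    by rewrite (s1X (s0 x)) ?(disjointFr dX sx0) // s0K s1X // (disjointFr dX x0).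
  rewrite (s0X x x0); have [x1|x1] := boolP (x \in X1).
    have sx1 := supported_closed s1K s1X x1.
    by rewrite (s0X (s1 x)) ?(disjointFl dX sx1) // s1K.
  by rewrite (s1X x x1) (s0X x x0) s1X.
move=> phi on.
pose ga x := (phi^-1)%g (al (phi x)).
have gaK : involutive ga by move=> x; rewrite /ga permKV alK permK.
have [c [ca cg]] : exists c, [/\ alternates al c, alternates ga c
    & forall z, z \in X1 -> al z = z -> c z].
  have [c [ca cg]] := two_colouring alK gaK.
  have [z /andP[z1 /eqP alz]|no] := pickP [pred z | (z \in X1) && (al z == z)]; last first.
    exists c; split=> // z z1 alz; have := no z; by rewrite /= z1 alz eqxx.
  exists (fun x => c x == c z); split.
  - by move=> x /ca ->; case: (c x); case: (c z).
  - by move=> x /cg ->; case: (c x); case: (c z).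
  - by move=> y y1 aly; rewrite (alfix y z y1 z1 aly alz).
move=> cfix.
have X0X x : x \in X0 -> x \in X by rewrite XE inE => ->.
have X1X x : x \in X1 -> x \in X by rewrite XE inE => ->; rewrite orbT.
have alXX x : x \in X -> al x \in X by move=> xX; apply: supported_closed.
have fix1 x : x \in X -> al x = x -> x \in X1.
  by rewrite XE inE => /orP[/al0 + alx|//]; rewrite alx.
have phiX x : (phi x \in X) = (x \in X) by rewrite perm_closed.
have phiVX x : ((phi^-1)%g x \in X) = (x \in X) by rewrite -phiX permKV.
(* Both fixed points decide which colour is in excess, hence they agree. *)
have gfix z : z \in X -> al z = z -> c ((phi^-1)%g z).
  move=> zX alz; have z1 := fix1 z zX alz; set y := (phi^-1)%g z.
  have yX : y \in X by rewrite phiVX.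
  have gy : ga y = y by rewrite /ga /y permKV alz.
  have e1 := @alternates_card al c X z alK ca alXX zX alz _.
  have e2 := @alternates_card ga c X y gaK cg _ yX gy _.
  have := e1 _; have {e1} := e2 _ _.
  rewrite (cfix z z1 alz); case: (c y) => //= e2' e1'; exfalso.
  have {}e2' : #|[set x in X | c x]| + 1 = #|[set x in X | ~~ c x]| + 0.
    apply: e2'; first by move=> x xX; rewrite /ga phiVX alXX // phiX.
    move=> x xX; rewrite /ga => /(congr1 phi); rewrite permKV => alx.
    rewrite /y -(permK phi x); congr ((phi^-1)%g _).
    by apply: (alfix (phi x) z) => //; apply: fix1; rewrite ?phiX.
  have {}e1' : #|[set x in X | c x]| + 0 = #|[set x in X | ~~ c x]| + 1.
    by apply: e1' => x xX alx; apply: (alfix x z) => //; apply: fix1.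
  by move: e1' e2'; clear; lia.
have swapd (d : I -> bool) : alternates al d -> (forall z, z \in X -> al z = z -> d z) ->
    exists t, [/\ switching al t, forall x, t (t x) = x & forall x, x \in X -> (t x \in X1) = d x].
  move=> da dfix; pose sw x := (x \in X) && (d x != (x \in X1)).
  have alsw x : al x != x -> x \in X -> (al x \in X1) = ~~ (x \in X1).
    move=> alx; rewrite XE inE => /orP[x0|x1].
      by rewrite (disjointFr dX x0) al0.
    by rewrite x1 (disjointFr dX (al1 x x1 alx)).
  have swal x : sw (al x) = sw x.
    have [alx|alx] := eqVneq (al x) x; first by rewrite alx.
    rewrite /sw; have -> : (al x \in X) = (x \in X).
      by apply/idP/idP => [/alXX|/alXX //]; rewrite alK.
    by case: (boolP (x \in X)) => //= xX; rewrite alsw // da //; case: (d x); case: (x \in X1).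
  have [t [st tE]] := swap_perm alK swal.
  exists t; split=> //.
    by move=> x; rewrite !tE; case swx: (sw x); rewrite ?swal swx ?alK.
  move=> x xX; rewrite tE; case: (boolP (sw x)); rewrite /sw xX /=; last first.
    by rewrite negbK => /eqP.
  have [alx|alx] := eqVneq (al x) x.
    by rewrite (fix1 x xX alx) (dfix x xX alx).
  by rewrite alsw //; case: (d x); case: (x \in X1).
have [tin [stin tinK tinX]] := swapd c ca (fun z zX alz => cfix z (fix1 z zX alz) alz).
pose cout y := c ((phi^-1)%g y).
have aout : alternates al cout.
  move=> y aly; rewrite /cout -cg; last first.
    by rewrite /ga permKV (inj_eq perm_inj).
  by rewrite /ga permKV.
have [tout [stout toutK toutX]] := swapd cout aout gfix.
pose mu := tin * phi * tout.
have onin : perm_on X tin by apply: switching_on stin.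
have onout : perm_on X tout by apply: switching_on stout.
have onmu : perm_on X mu by rewrite /mu !perm_onM.
have muX x : x \in X -> (mu x \in X1) = (x \in X1).
  move=> xX; rewrite /mu !permM.
  have txX : tin x \in X by rewrite perm_closed.
  by rewrite toutX ?phiX // /cout permK -tinX // tinK.
have memX0 x : (x \in X0) = (x \in X) && (x \notin X1).
  rewrite XE inE; case: (boolP (x \in X0)) => [x0|] /=; first by rewrite (disjointFr dX x0).
  by case: (x \in X1).
have [|||mu0 [mu1 [on0 on1 muE]]] := @restrict_perm mu X0 X1 dX.
- by rewrite -XE.
- by move=> x; rewrite !memX0 perm_closed // => /andP[xX]; rewrite muX // xX.
- by move=> x x1; rewrite muX // X1X.
have phiE : phi = tin * (mu * tout).
  by apply/permP=> x; rewrite /mu !permM tinK toutK.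
exists tin, (mu * tout); split=> //.
apply: realizes_rcons stout; rewrite muE; apply: (realizes_par dX) => //.
- by rewrite sz0 sz1.
- exact: R0.
- exact: R1.
Qed.

Theorem benes : exists ss : seq (I -> I),
  [/\ size ss = (2 * up_log 2 #|I|)%N, forall s, List.In s ss -> involutive s
    & forall phi, realizes ss phi].
Proof.
have [|ss [sz P R]] := @benes_on (up_log 2 #|I|) setT; first by rewrite cardsT up_logP.
exists ss; split=> // [s /P[]//|phi]; apply: R.
by apply/subsetP=> x _; rewrite inE.
Qed.

End Benes.

(** * Routing every permutation through a reservoir *)

Section Network.
Variables (V : finType) (e : rel V) (R : {set V}) (m h : nat).
Hypothesis e_sym : symmetric e.
Hypothesis mE : m = 2 ^ h.
Hypothesis joined : forall U1 U2 : {set V}, m <= #|U1| -> m <= #|U2| ->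
  exists x y, [/\ x \in U1, y \in U2 & e x y].
Variable I : finType.

Lemma uniq_map_enum (f : I -> V) : injective f -> uniq (map f (enum I)).
Proof. by move=> fI; rewrite (map_inj_uniq fI) enum_uniq. Qed.

Lemma sum_count_flatten (Q : I -> seq V) v : uniq (flatten (map Q (enum I))) ->
  \sum_x count_mem v (Q x) = (v \in flatten (map Q (enum I))).
Proof.
move=> uQ; rewrite -(count_uniq_mem v uQ) count_flatten sumnE !big_map.
by rewrite -big_enum.
Qed.

(** Positions of the switches are irrelevant to the ports, and when all switches
    are straight the ports are ends of disjoint routes with at least two vertices. *)
Lemma block_ports g (s : I -> I) (N : {set V}) a b : 1 < g -> block e g s setT N a b ->
  [/\ injective a, injective b & forall x y, a x != b y].
Proof.
move=> g1 B; have [|P [rP cP]] := B 1%g; first by move=> x; left; rewrite perm1.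
have {}cP v : \sum_x count_mem v (P x) = (v \in N) by rewrite -cP; apply: eq_bigl => x; rewrite inE.
have {}rP x : route e g (a x) (b x) (P x) by have := rP x; rewrite inE perm1; apply.
have memP v x y : v \in P x -> v \in P y -> x = y.
  move=> vx vy; apply/eqP/negPn/negP => xy; have := cP v.
  rewrite (bigD1 x) //= (bigD1 y) 1?eq_sym //=.
  move: vx vy; rewrite -!has_pred1 !has_count; case: (v \in N) => /=;
  by move: (\sum_(i | _) _) => k; clear; lia.
have aP x : a x \in P x by have [r [-> _ _ _]] := rP x; apply: mem_head.
have bP x : b x \in P x by have [r [-> _ <- _]] := rP x; apply: mem_last.
split.
- by move=> x y axy; apply: (memP (a x)) => //; rewrite axy.
- by move=> x y bxy; apply: (memP (b x)) => //; rewrite bxy.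
move=> x y; apply/eqP => axb; have xy : x = y by apply: (memP (a x)) => //; rewrite axb.
have [r [Pr _ br sr]] := rP x; have := cP (a x); rewrite (bigD1 x) //= Pr /= eqxx.
have : a x \in r.
  rewrite axb -xy -br; case: (r) Pr sr => [|z r'] Pr sr; last by rewrite /= mem_last.
  by move: g1; rewrite -sr Pr.
rewrite -has_pred1 has_count; case: (_ \in N) => /=; move: (\sum_(i | _) _) => k; clear; lia.
Qed.

(** The number of vertices of a route after its start: one connecting path before
    each layer and one after the last, the layers, and the final vertex. *)
Definition netlen L := (2 * h + 3).+1 + L * (glen h + (2 * h + 3)).

(** Layers of switches are embedded one after the other, with connecting paths
    between consecutive layers. The embedding is fixed before the permutation
    [phi] is known, and for every [phi] the routes cover the same set [N]. *)
Lemma network (ss : seq (I -> I)) (rho : nat -> I -> V) (b0 bl : I -> V) (A : {set V}) c :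
    (forall s, List.In s ss -> involutive s) ->
    injective b0 -> injective bl ->
    (forall x, occ R A (b0 x) /\ c (b0 x) < 3) ->
    (forall x, bl x \notin R /\ c (bl x) = 0) ->
    (forall i x, i < size ss -> rho i x \notin R /\ c (rho i x) = 0) ->
    (forall i j x y, i < size ss -> j < size ss -> rho i x = rho j y -> i = j /\ x = y) ->
    (forall x y, b0 x != bl y) -> (forall i x y, i < size ss -> rho i x != bl y) ->
    (forall i x y, i < size ss -> rho i x != b0 y) ->
    state e R m A c ->
    #|A| + #|I| * (2 * h + 3 + size ss * (2 * glen h + (2 * h + 3))) + 13 * m <= #|R| ->
  exists N : {set V},
    (forall v, v \in N -> [|| v \in R :\: A, v \in codom bl | [exists x, exists i : 'I_(size ss), v == rho i x]])
    /\ forall phi, realizes ss phi -> exists P : I -> seq V,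
      (forall x, [/\ path e (b0 x) (P x), last (b0 x) (P x) = bl (phi x)
         & size (P x) = netlen (size ss)])
      /\ forall v, \sum_x count_mem v (P x) = (v \in N).
Proof.
elim: ss rho b0 A c => [|s ss IH] rho b0 A c sK b0I blI b0P blP rhoP rhoI b0l rhol rho0 st room.
  have uf : uniq (map b0 (enum I) ++ map bl (enum I)).
    rewrite cat_uniq !uniq_map_enum //= andbT.
    by apply/hasPn=> v /mapP[y _ ->]; apply/mapP=> -[x _] /eqP; rewrite eq_sym (negPf (b0l _ _)).
  have fP v : v \in map b0 (enum I) ++ map bl (enum I) -> occ R A v /\ c v < 3.
    rewrite mem_cat => /orP[] /mapP[x _ ->]; first exact: b0P.
    by have [blR ->] := blP x; rewrite /occ blR.
  have room' : #|A| + size (enum I) * (2 * h + 3) + 13 * m <= #|R|.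
    by rewrite -cardE; apply: leq_trans room; rewrite addn0.
  have [Q [QP uQ subQ _]] := connect_pairs e_sym mE joined st uf fP room'.
  set fl := flatten _ in uQ subQ.
  have sQ v : v \in fl -> v \in R :\: A := subQ v.
  exists ([set:: fl] :|: [set:: codom bl]); split.
    by move=> v; rewrite inE 2!in_set => /orP[/sQ ->|->]; rewrite ?orbT.
  move=> phi /= ->; exists (fun x => rcons (Q x) (bl x)); split.
    move=> x; have [pQ szQ] := QP x (mem_enum _ _).
    by rewrite pQ last_rcons perm1 size_rcons szQ /netlen mul0n addn0.
  move=> v; under eq_bigr do rewrite -cats1 count_cat /= addn0.
  rewrite big_split /= sum_count_flatten // -/fl inE 2!in_set.
  have -> : \sum_x (bl x == v) = (v \in codom bl).
    have [/codomP[y ->]|vN] := boolP (v \in codom bl).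
      rewrite (bigD1 y) //= eqxx big1 // => x xy; apply/eqP; rewrite eqb0.
      by apply: contra xy => /eqP /blI ->.
    by rewrite big1 // => x _; apply/eqP; rewrite eqb0; apply: contra vN => /eqP <-; apply: codom_f.
  case: (boolP (v \in fl)) => // /sQ /setDP[vR _].
  case: (boolP (v \in codom bl)) => // /codomP[y vy].
  by have [] := blP y; rewrite -vy vR.
set g := glen h in room IH *; set p := 2 * h + 3 in room IH *.
have g1 : 1 < g by rewrite /g /glen; clear; lia.
have room1 : #|A| + #|I| * (2 * glen h) + 13 * m <= #|R|.
  apply: leq_trans room; rewrite leq_add2r leq_add2l leq_mul2l /= -/g; apply/orP; right.
  by rewrite mulSn; clear; lia.
have rhoP0 x : rho 0 x \notin R /\ c (rho 0 x) = 0 by apply: rhoP.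
have rho0I : injective (rho 0) by move=> x y /rhoI[].
have [a [b [new [N1 [c1 [[nR nc st1 c1o c1n] N1s ab B]]]]]] :=
  layer e_sym mE joined (sK s (or_introl erefl)) rho0I rhoP0 st room1.
have [aI bI abN] := block_ports g1 B.
have nRA v : v \in new -> v \in R /\ v \notin A by move/(subsetP nR)/setDP.
have cA1 : #|A :|: new| <= #|A| + #|I| * (2 * g).
  by apply: leq_trans (leq_card_setU _ _) _; rewrite leq_add2l.
have b0new x : b0 x \notin new.
  by apply/negP=> /nRA[bR bA]; have [] := b0P x; rewrite /occ bR (negPf bA).
have b0a x y : b0 x != a y.
  by apply/eqP=> ba; have := b0new x; rewrite ba; have [-> _] := ab y.
have uf : uniq (map b0 (enum I) ++ map a (enum I)).
  rewrite cat_uniq !uniq_map_enum //= andbT.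
  by apply/hasPn=> v /mapP[y _ ->]; apply/mapP=> -[x _] /eqP; rewrite eq_sym (negPf (b0a _ _)).
have b0rho x : b0 x \notin codom (rho 0).
  by apply/negP=> /codomP[y /eqP]; rewrite eq_sym (negPf (rho0 _ _ _ _)).
have fP v : v \in map b0 (enum I) ++ map a (enum I) -> occ R (A :|: new) v /\ c1 v < 3.
  rewrite mem_cat => /orP[] /mapP[x _ ->].
    have [ob cb] := b0P x; rewrite c1o //; split=> //.
    by case/orP: ob => ob; rewrite /occ ?ob // inE ob orbT.
  have [ax _] := ab x; split; last exact: c1n.
  by rewrite /occ inE ax !orbT.
have room2 : #|A :|: new| + size (enum I) * p + 13 * m <= #|R|.
  apply: leq_trans room; rewrite -cardE leq_add2r.
  apply: leq_trans (leq_add cA1 (leqnn _)) _; rewrite -addnA leq_add2l -mulnDr.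
  by rewrite leq_mul2l; apply/orP; right; rewrite /= mulSn; clear; lia.
have [Q [QP uQ subQ st2]] := connect_pairs e_sym mE joined st1 uf fP room2.
have [fl flE] : exists fl, fl = flatten (map Q (enum I)) by eexists.
rewrite -flE in uQ subQ st2.
have sQ v : v \in fl -> [/\ v \in R, v \notin A & v \notin new].
  by move/subQ; rewrite !inE negb_or => /andP[/andP[-> ->] ->].
set A2 := A :|: new :|: [set:: fl] in st2.
set c2 := (fun v => c1 v + _) in st2.
have cfl : size fl = #|I| * p.
  rewrite flE cardE; have : forall i, i \in enum I -> size (Q i) = p by move=> i /QP[].
  elim: (enum I) => //= i l IHl sP.
  by rewrite size_cat sP ?mem_head // IHl ?mulSn // => j js; rewrite sP // inE js orbT.
have cA2 : #|A2| <= #|A| + #|I| * (2 * g) + #|I| * p.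
  apply: leq_trans (leq_card_setU _ _) _; apply: leq_add => //.
  by rewrite cardsE -cfl card_size.
have outR v : v \notin R -> v \notin new /\ v \notin fl.
  by move=> vR; split; apply: contra vR; [case/nRA|case/sQ].
have aR x : a x \in R by have [/nRA[]] := ab x.
have c2out v : v \notin R -> v \notin codom (rho 0) -> v \notin map b0 (enum I) -> c2 v = c v.
  move=> vR v0 vb; have [vn vf] := outR v vR.
  rewrite /c2 !mem_cat (negPf vb) (negPf vf) orbF /= c1o //.
  suff -> : (v \in map a (enum I)) = false by rewrite addn0.
  by apply/negP=> /mapP[x _ vx]; move: vR; rewrite vx aR.
have bP x : occ R A2 (b x) /\ c2 (b x) < 3.
  have [_ bx] := ab x; split; first by rewrite /occ /A2 !inE bx !orbT.
  rewrite /c2 !mem_cat; have -> : (b x \in map b0 (enum I)) = false.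
    by apply/negP=> /mapP[y _ bb]; have := b0new y; rewrite -bb bx.
  have -> : (b x \in map a (enum I)) = false.
    by apply/negP=> /mapP[y _ /esym /eqP]; rewrite (negPf (abN _ _)).
  have -> : (b x \in fl) = false by apply/negP=> /sQ[_ _]; rewrite bx.
  by rewrite addn0; apply: c1n.
have blP2 x : bl x \notin R /\ c2 (bl x) = 0.
  have [blR cb] := blP x; rewrite c2out //.
    by apply/negP=> /codomP[y /eqP]; rewrite eq_sym (negPf (rhol _ _ _ _)).
  by apply/negP=> /mapP[y _ /esym/eqP]; rewrite (negPf (b0l _ _)).
have rhoP2 i x : i < size ss -> rho i.+1 x \notin R /\ c2 (rho i.+1 x) = 0.
  move=> ilt; have [rR cr] := rhoP i.+1 x ilt; rewrite c2out //.
    by apply/negP=> /codomP[y /rhoI[]].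
  by apply/negP=> /mapP[y _ /eqP]; rewrite (negPf (rho0 _ _ _ _)).
have bR x : b x \in R by have [_ /nRA[]] := ab x.
have rhoI2 i j x y : i < size ss -> j < size ss -> rho i.+1 x = rho j.+1 y -> i = j /\ x = y.
  by move=> il jl /rhoI[] // [].
have bbl x y : b x != bl y by apply/eqP=> bb; have [] := blP y; rewrite -bb bR.
have rhob i x y : i < size ss -> rho i.+1 x != b y.
  by move=> il; apply/eqP=> bb; have [] := rhoP i.+1 x il; rewrite bb bR.
have room3 : #|A2| + #|I| * (p + size ss * (2 * g + p)) + 13 * m <= #|R|.
  have E : #|I| * (p + (size ss).+1 * (2 * g + p))
      = #|I| * (2 * g) + #|I| * p + #|I| * (p + size ss * (2 * g + p)).
    rewrite -!mulnDr; congr (_ * _); rewrite (mulSn (size ss)).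
    exact: addnCA.
  apply: leq_trans room; rewrite leq_add2r /= E 2!addnA leq_add2r.
  exact: cA2.
have sK2 u : List.In u ss -> involutive u by move=> us; apply: sK; right.
have [N2 [N2s NP2]] := IH (fun i => rho i.+1) b A2 c2 sK2 bI blI bP blP2 rhoP2 rhoI2 bbl
  (fun i => rhol i.+1) rhob st2 room3.
have fl1 v : v \in fl -> v \notin N1.
  move=> vf; have [vR vA vn] := sQ v vf; apply/negP=> /(subsetP N1s); rewrite !inE (negPf vn).
  by case/codomP=> x vx; have [] := rhoP0 x; rewrite -vx vR.
have d2 v : v \in N2 -> v \notin fl /\ v \notin N1.
  case/N2s/or3P=> [|/codomP[y ->]|/existsP[x /existsP[i /eqP ->]]].
  - rewrite /A2 !inE !negb_or => /andP[/andP[/andP[vA vn] vf] vR]; split=> //.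
    apply/negP=> /(subsetP N1s); rewrite !inE (negPf vn).
    by case/codomP=> x vx; have [] := rhoP0 x; rewrite -vx vR.
  - have [blR _] := blP y; have [vn vf] := outR _ blR; split=> //.
    apply/negP=> /(subsetP N1s); rewrite !inE (negPf vn) /=.
    by case/codomP=> x /esym/eqP; rewrite (negPf (rhol _ _ _ _)).
  - have [rR _] := rhoP i.+1 x (ltn_ord i); have [vn vf] := outR _ rR; split=> //.
    apply/negP=> /(subsetP N1s); rewrite !inE (negPf vn) /=.
    by case/codomP=> y /(rhoI i.+1 0 x y (ltn_ord i) isT)[].
exists ([set:: fl] :|: N1 :|: N2); split.
  move=> v; rewrite !in_setU in_set => /orP[/orP[/sQ[vR vA _]|/(subsetP N1s)]|/N2s].
  - by rewrite inE vR vA.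
  - rewrite in_setU in_set => /orP[/(subsetP nR) -> //|/codomP[x ->]].
    apply/or3P; apply: Or33; apply/existsP; exists x; apply/existsP.
    by exists (Ordinal (ltn0Sn (size ss))).
  - case/or3P=> [|->|/existsP[x /existsP[i /eqP ->]]]; rewrite ?orbT //.
      by rewrite !inE !negb_or => /andP[/andP[/andP[-> _] _] ->].
    apply/or3P; apply: Or33; apply/existsP; exists x; apply/existsP.
    by exists (lift ord0 i).
move=> phi [t [phi' [stt r ->]]].
have [P1 [r1 e1]] := B t stt; have [P2 [r2 e2]] := NP2 phi' r.
exists (fun x => Q x ++ P1 x ++ P2 (t x)); split.
  move=> x; have [pQ szQ] := QP x (mem_enum _ _).
  have [|q [Pq pq lq sq]] := r1 x; first by rewrite inE.
  have [p2 l2 s2] := r2 (t x).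
  move: pQ; rewrite -cats1 cat_path /= => /and3P[pQ eQ _].
  rewrite !cat_path !last_cat Pq /= pQ eQ pq lq p2 l2 permM; split=> //.
  move: sq; rewrite Pq /= => sq.
  rewrite !size_cat /= !size_cat szQ s2 -addSn sq /netlen -/g -/p (mulSn (size ss)).
  by generalize p g (size ss * (g + p)); clear; lia.
move=> v; under eq_bigr do rewrite !count_cat.
rewrite !big_split /= flE sum_count_flatten -flE //.
have {}e1 : \sum_x count_mem v (P1 x) = (v \in N1).
  by rewrite -e1; apply: eq_bigl => x; rewrite inE.
have {}e2 : \sum_x count_mem v (P2 (t x)) = (v \in N2).
  by rewrite -e2 [RHS](reindex_inj (@perm_inj _ t)).
rewrite e1 e2 !in_setU in_set.
case: (boolP (v \in fl)) => [vf|_]; last first.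
  case: (boolP (v \in N1)) => // v1; case: (boolP (v \in N2)) => // /d2[_].
  by rewrite v1.
rewrite (negPf (fl1 v vf)); case: (boolP (v \in N2)) => // /d2[].
by rewrite vf.
Qed.
End Network.

Import Order.TTheory GRing.Theory Num.Theory.
Local Open Scope ring_scope.

(** * Splitting into equal classes *)

Section Split.
Variables (R : realType) (V I : finType) (X : {set V}) (N : I -> {set V}).
Variables (a b D : nat).
Local Notation B := b.+1.
Hypothesis cardX : (#|X| = a * B)%N.
Hypothesis degN : forall i, (D <= #|N i :&: X|)%N.

Let cardP : #|{: 'I_a * 'I_B}| = #|X|.
Proof. by rewrite card_prod !card_ord cardX. Qed.

Let f (p : 'I_a * 'I_B) : V := enum_val (cast_ord cardP (enum_rank p)).

Let f_inj : injective f.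
Proof. by move=> p q /enum_val_inj /cast_ord_inj /enum_rank_inj. Qed.

Let f_in p : f p \in X. Proof. exact: enum_valP. Qed.

Let f_onto x : x \in X -> exists p, x = f p.
Proof.
move=> xX; exists (enum_val (cast_ord (esym cardP) (enum_rank_in xX x))).
by rewrite /f enum_valK cast_ordKV enum_rankK_in.
Qed.

Let hits (s : {ffun 'I_a -> 'I_B}) (i : I) (j : 'I_B) := (\sum_u (f (u, (j - s u)%R) \in N i))%N.

(** The factor of each block is a sum over its shifts, and [1 + x <= exp x] turns
    it into an exponential in the number of neighbours in the block. *)
Lemma expectation i j :
  \sum_(s : {ffun 'I_a -> 'I_B}) (9 / 10 : R) ^+ hits s i j
    <= B%:R ^+ a * expR (- (D%:R / (10 * B%:R))).
Proof.
pose F u (r : 'I_B) : R := (9 / 10) ^+ (f (u, j - r) \in N i).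
pose d u := #|[set r | f (u, r) \in N i]|.
have B0 : 0 < B%:R :> R by rewrite ltr0n.
have -> : \sum_(s : {ffun 'I_a -> 'I_B}) (9 / 10 : R) ^+ hits s i j
    = \prod_u \sum_r F u r.
  by rewrite bigA_distr_bigA; apply: eq_bigr => s _; rewrite -expr_sum.
have dE u : d u = (\sum_r (f (u, r) \in N i))%N.
  rewrite /d -sum1_card big_mkcond /=.
  by apply: eq_bigr => r _; rewrite inE; case: (_ \in _).
have sumF u : \sum_r F u r = B%:R - (d u)%:R / 10.
  rewrite (reindex_inj (subrI j)) /= dE natr_sum.
  rewrite mulr_suml -[B in B%:R]card_ord -sum1_card natr_sum -sumrB.
  apply: eq_bigr => r _; rewrite /F subKr; case: (_ \in _); rewrite /= ?expr1 ?expr0; lra.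
have le u : \sum_r F u r <= B%:R * expR (- ((d u)%:R / (10 * B%:R))).
  rewrite sumF; have h := @expR_ge1Dx R (- ((d u)%:R / (10 * B%:R))).
  have E (x y : R) : 0 < y -> y - x / 10 = y * (1 + - (x / (10 * y))).
    by move=> y0; field; rewrite gt_eqF.
  rewrite E //.
  by rewrite ler_pM2l.
have leP : \prod_u \sum_r F u r <= \prod_(u < a) (B%:R * expR (- ((d u)%:R / (10 * B%:R)))).
  apply: ler_prod => u _; rewrite le andbT; apply: sumr_ge0 => r _.
  by apply: exprn_ge0; lra.
apply: le_trans leP _.
rewrite big_split /= prodr_const card_ord ler_wpM2l ?exprn_ge0 ?ler0n //.
rewrite -expR_sum ler_expR sumrN lerN2 -mulr_suml ler_wpM2r //.
  by rewrite invr_ge0 mulr_ge0 ?ltW.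
rewrite -natr_sum ler_nat; apply: leq_trans (degN i) _.
have -> : (\sum_u d u = #|[set p | f p \in N i]|)%N.
  rewrite (eq_bigr _ (fun u _ => dE u)) pair_big /= -sum1_card [RHS]big_mkcond /=.
  by apply: eq_bigr => -[u r] _; rewrite inE; case: (_ \in _).
rewrite -(card_imset _ f_inj); apply: subset_leq_card; apply/subsetP=> x.
rewrite inE => /andP[xN /f_onto[p xp]]; apply/imsetP; exists p => //.
by rewrite inE -xp.
Qed.

Hypothesis few : (#|I| * B)%:R < expR (D%:R / (90 * B%:R)) :> R.

(** Cut [X] into [a] blocks of [B] vertices and shift each block cyclically at
    random: classes have size exactly [a], and the members of [N i] in a class
    come from independent blocks. The lower tail is bounded by the expectation
    of 9/10 to the power of their number; as [9/10 >= exp (-1/9)], falling below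
    4/5 of the mean has probability at most [exp] of [- mean * (1/10 - 4/45)],
    that is of [- mean / 90]. *)
Lemma equal_split : exists c : V -> 'I_B,
  (forall j, #|[set x in X | c x == j]| = a) /\
  (forall i j, (4 * D <= 5 * B * #|[set x in X :&: N i | c x == j]|)%N).
Proof.
have B0 : 0 < B%:R :> R by rewrite ltr0n.
have [s /forallP rich] : exists s : {ffun 'I_a -> 'I_B},
    [forall i, [forall j, (4 * D <= 5 * B * hits s i j)%N]].
  apply/existsP; apply: contraLR few; rewrite negb_exists => /forallP bad.
  rewrite -leNgt.
  have lower (s : {ffun 'I_a -> 'I_B}) : expR (- (4 * D%:R / (45 * B%:R)))
      <= \sum_i \sum_j (9 / 10 : R) ^+ hits s i j.
    have := bad s; rewrite negb_forall => /existsP[i0]; rewrite negb_forall => /existsP[j0].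
    rewrite -ltnNge => lt_ij.
    rewrite (bigD1 i0) //= (bigD1 j0) //= -addrA; apply: ler_wpDr.
      apply: addr_ge0; apply: sumr_ge0 => k _; last apply: sumr_ge0 => l _;
      by apply: exprn_ge0; lra.
    have base : expR (- (1 / 9)) <= 9 / 10 :> R.
      rewrite expRN; have h := @expR_ge1Dx R (1 / 9).
      have -> : 9 / 10 = (1 + 1 / 9)^-1 :> R by field.
      by rewrite lef_pV2 ?posrE ?expR_gt0 //; lra.
    apply: le_trans (lerXn2r _ _ _ base); rewrite ?nnegrE ?expR_ge0 //; last by lra.
    rewrite -expRM_natl ler_expR.
    have : (5 * B * hits s i0 j0)%:R <= (4 * D)%:R :> R by rewrite ler_nat ltnW.
    rewrite !natrM => le_ij.
    rewrite mulrN lerN2 -(ler_pM2r (x := 45 * B%:R)) ?mulr_gt0 ?ltr0n //.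
    rewrite mulfVK ?gt_eqF ?mulr_gt0 ?ltr0n //.
    by move: le_ij; lra.
  have := ler_sum (index_enum _) (fun s (_ : true) => lower s) => /=.
  rewrite sumr_const exchange_big /=; under eq_bigr do rewrite exchange_big /=.
  have -> : #|{ffun 'I_a -> 'I_B}| = (B ^ a)%N by rewrite card_ffun !card_ord.
  set E1 := expR _; move=> h.
  pose E2 : R := expR (- (D%:R / (10 * B%:R))).
  have {h} : E1 *+ B ^ a <= \sum_(i : I) \sum_(j : 'I_B) B%:R ^+ a * E2.
    by apply: le_trans h _; apply: ler_sum => i _; apply: ler_sum => j _; exact: expectation.
  rewrite !sumr_const card_ord -mulrnA => h.
  have {}h : E1 <= E2 * (#|I| * B)%:R.
    rewrite -(ler_pM2l (exprn_gt0 a B0)) mulrA mulr_natr (mulnC #|I|).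
    by apply: le_trans h; rewrite -natrX mulr_natl.
  have E (x y : R) : 0 < y -> x / (90 * y) = - (4 * x / (45 * y)) + x / (10 * y).
    by move=> y0; field; rewrite gt_eqF.
  rewrite E //.
  rewrite expRD -/E1; apply: le_trans (ler_wpM2r (expR_ge0 _) h) _.
  by rewrite mulrAC /E2 -expRD addNr expR0 mul1r.
pose c x : 'I_B := if [pick p | f p == x] is Some p then p.2 + s p.1 else 0.
have cf p : c (f p) = p.2 + s p.1.
  rewrite /c; case: pickP => [q /eqP/f_inj -> //|/(_ p)]; by rewrite eqxx.
have imE (Y : {set V}) j : Y \subset X ->
    [set x in Y | c x == j] = [set f (u, j - s u) | u in [set u | f (u, j - s u) \in Y]].
  move=> YX; apply/setP=> x; rewrite inE; apply/andP/imsetP.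
    move=> [xY /eqP cx]; have [[u r] xp] := f_onto (subsetP YX x xY).
    move: cx; rewrite xp cf /= => <-; exists u; rewrite ?inE addrK //.
    by rewrite -xp.
  by move=> [u]; rewrite inE => uY ->; rewrite uY cf /= subrK.
have cE (Y : {set V}) j : Y \subset X ->
    #|[set x in Y | c x == j]| = (\sum_u (f (u, (j - s u)%R) \in Y))%N.
  move=> YX; rewrite imE // card_imset; last by move=> u u' /f_inj[].
  rewrite -sum1_card big_mkcond /=; apply: eq_bigr => u _; rewrite inE.
  by case: (_ \in _).
exists c; split=> [j|i j].
  rewrite cE // (eq_bigr (fun=> 1%N)) ?sum1_card ?card_ord // => u _.
  by rewrite f_in.
have /forallP/(_ j) := rich i; rewrite /hits cE ?subsetIl //.
by congr (_ <= _ * _)%N; apply: eq_bigr => u _; rewrite inE f_in.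
Qed.
End Split.

(** * The expander mixing lemma *)

Section Spectral.
Local Open Scope sesquilinear_scope.

Lemma char_poly_conj (F : comUnitRingType) n (P D : 'M[F]_n) : P \in unitmx ->
  char_poly (invmx P *m D *m P) = char_poly D.
Proof.
move=> uP; rewrite /char_poly.
have -> : char_poly_mx (invmx P *m D *m P) =
    map_mx polyC (invmx P) *m char_poly_mx D *m map_mx polyC P.
  rewrite /char_poly_mx mulmxBr mulmxBl !map_mxM; congr (_ - _).
  by rewrite scalar_mxC -mulmxA -map_mxM mulVmx // map_mx1 mulmx1.
rewrite !det_mulmx mulrAC -det_mulmx -map_mxM mulVmx // map_mx1 det1 mul1r //.
Qed.

Section Mixing.
Variables (C : numClosedFieldType) (n : nat) (A : 'M[C]_n) (d lam : C) (s : seq C).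
Hypothesis n_gt0 : (0 < n)%N.
Hypothesis Asym : A \is symmetricmx.
Hypothesis Areal : A \is a mxOver Num.real.
Hypothesis Aspec : char_poly A = \prod_(a <- d :: s) ('X - a%:P).
Hypothesis small : forall a, a \in s -> `|a| <= lam.
Hypothesis lam_ge0 : 0 <= lam.
Hypothesis gap : lam < d.
Hypothesis regA : (const_mx 1 : 'rV_n) *m A = d *: const_mx 1.

(** In an orthonormal eigenbasis the all-ones vector is a multiple of the
    eigenvector of [d], since the other eigenvalues differ from [d]. Removing
    this component from the bilinear form subtracts exactly the expected term,
    and on the rest the matrix has norm at most [lam]. *)
Lemma mixing_vectors (u v : 'rV[C]_n) : u ^ Num.conj = u -> v ^ Num.conj = v ->
  `|(u *m A *m v^T) 0 0 - d / n%:R * (\sum_j u 0 j) * (\sum_j v 0 j)| ^+ 2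
    <= lam ^+ 2 * (dotmx u u * dotmx v v).
Proof.
move=> ureal vreal.
have /orthomx_spectralP := hermitian_normalmx (realsym_hermsym Asym Areal).
set P := spectralmx A; set sp := spectral_diag A => AE.
have uP : P \is unitarymx := spectral_unitarymx A.
have iP : invmx P = P ^t* := invmx_unitary uP.
have unP : P \in unitmx := unitarymx_unit uP.
have PtP : P ^t* *m P = 1%:M by rewrite -iP mulVmx.
have specE : perm_eq [seq sp 0 i | i <- enum 'I_n] (d :: s).
  apply: prod_XsubC_eq; rewrite -Aspec {1}AE char_poly_conj // char_poly_trig.
    by rewrite big_map big_enum /=; apply: eq_bigr => i _; rewrite mxE eqxx mulr1n.
  exact: diag_mx_is_trig.
have [i0 spi0 sp_small] : exists2 i0, sp 0 i0 = d & forall i, i != i0 -> `|sp 0 i| <= lam.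
  have /mapP[i0 _ di0] : d \in [seq sp 0 i | i <- enum 'I_n].
    by rewrite (perm_mem specE) mem_head.
  exists i0 => // i ii0.
  have pe : perm_eq (enum 'I_n) (i0 :: rem i0 (enum 'I_n)) by apply: perm_to_rem; rewrite mem_enum.
  have : perm_eq (d :: [seq sp 0 i | i <- rem i0 (enum 'I_n)]) (d :: s).
    rewrite {1}di0; apply: perm_trans specE.
    by have := perm_map (fun i => sp 0 i) pe; rewrite perm_sym.
  rewrite perm_cons => /perm_mem ms; apply: small; rewrite -ms; apply: map_f.
  by rewrite mem_rem_uniq ?enum_uniq // inE ii0 mem_enum.
pose w : 'rV[C]_n := const_mx 1 *m P ^t*.
have wE i : i != i0 -> w 0 i = 0.
  move=> ii0; have : w *m diag_mx sp = d *: w.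
    rewrite /w scalemxAl -regA [in RHS]AE -iP -!mulmxA mulmxV // mulmx1.
    by rewrite !mulmxA.
  move=> /rowP/(_ i); rewrite mul_mx_diag !mxE mulrC => /eqP.
  rewrite -subr_eq0 -mulrBl mulf_eq0 subr_eq0 => /orP[/eqP spd|/eqP //].
  have := sp_small i ii0; rewrite spd => le_d.
  have d0 : 0 < d by apply: le_lt_trans gap; apply: le_trans (normr_ge0 _) le_d.
  by move: (le_lt_trans le_d gap); rewrite gtr0_norm // ltxx.
pose al := u *m P ^t*; pose be := v *m P ^t*.
have dotE (x y : 'rV[C]_n) : dotmx x y = \sum_j x 0 j * (y 0 j)^*.
  by rewrite dotmxE !mxE; apply: eq_bigr => j _; rewrite !mxE.
have dotU (x y : 'rV[C]_n) : dotmx (x *m P ^t*) (y *m P ^t*) = dotmx x y.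
  rewrite !dotmxE trmx_mul map_mxM trmxCK -mulmxA (mulmxA (P ^t*)) PtP mul1mx //.
have vT : v ^t* = v^T by rewrite -map_trmx vreal.
have Dform : (u *m A *m v^T) 0 0 = \sum_j al 0 j * sp 0 j * (be 0 j)^*.
  rewrite -vT AE iP -!mulmxA (mulmxA u).
  have -> : P *m v ^t* = be ^t* by rewrite /be trmx_mul map_mxM trmxCK.
  rewrite -/al mulmxA mul_mx_diag !mxE; apply: eq_bigr => j _.
  by rewrite !mxE.
pose ga : 'rV[C]_n := \row_j (if j == i0 then 0 else al 0 j * sp 0 j).
have sum1 (x : 'rV[C]_n) : x ^ Num.conj = x -> \sum_j x 0 j = w 0 i0 * ((x *m P ^t*) 0 i0)^*.
  move=> xr; have <- : dotmx (const_mx 1) x = \sum_j x 0 j.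
    rewrite dotE; apply: eq_bigr => j _; rewrite mxE mul1r.
    by have /rowP/(_ j) := xr; rewrite mxE.
  rewrite -dotU dotE (bigD1 i0) //= -/w big1 ?addr0 // => j /wE ->.
  by rewrite mul0r.
have w2 : w 0 i0 * (w 0 i0)^* = n%:R.
  have := dotU (const_mx 1) (const_mx 1); rewrite dotE (bigD1 i0) //= -/w big1 => [|j /wE ->].
    rewrite addr0 => ->; rewrite dotE (eq_bigr (fun=> 1)) ?sumr_const ?card_ord //.
    by move=> j _; rewrite !mxE conjC1 mulr1.
  by rewrite mul0r.
have sumu : \sum_j u 0 j = (w 0 i0)^* * al 0 i0.
  have -> : \sum_j u 0 j = (\sum_j u 0 j)^*.
    rewrite rmorph_sum; apply: eq_bigr => j _.
    by have /rowP/(_ j) := ureal; rewrite mxE => /esym.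
  by rewrite (sum1 u ureal) rmorphM /= conjCK.
have n0 : n%:R != 0 :> C by rewrite pnatr_eq0 -lt0n.
have -> : (u *m A *m v^T) 0 0 - d / n%:R * (\sum_j u 0 j) * (\sum_j v 0 j) = dotmx ga be.
  rewrite Dform dotE (bigD1 i0) //= [in RHS](bigD1 i0) //= [in RHS]mxE eqxx mul0r add0r.
  rewrite sumu (sum1 v vreal) -/be spi0.
  have -> : d / n%:R * ((w 0 i0)^* * al 0 i0) * (w 0 i0 * (be 0 i0)^*)
      = al 0 i0 * d * (be 0 i0)^*.
    transitivity (d / n%:R * (w 0 i0 * (w 0 i0)^*) * al 0 i0 * (be 0 i0)^*).
      by move: ((w 0 i0)^*) ((be 0 i0)^*) => x y; ring.
    by rewrite w2 divfK // [d * _]mulrC.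
  rewrite addrAC subrr add0r; apply: eq_bigr => j ji.
  by rewrite [ga 0 j]mxE (negPf ji).
have CS : `|dotmx ga be| ^+ 2 <= dotmx ga ga * dotmx be be.
  exact: (CauchySchwarz (@dotmx C n) ga be).1.
apply: le_trans CS _.
rewrite /be dotU mulrA ler_wpM2r //.
  by rewrite dotE sumr_ge0 // => j _; rewrite mul_conjC_ge0.
rewrite -(dotU u u) -/al !dotE mulr_sumr; apply: ler_sum => j _.
rewrite [ga 0 j]mxE; case: eqVneq => [_|ji].
  by rewrite mul0r mulr_ge0 ?mul_conjC_ge0 // exprn_ge0.
rewrite rmorphM /= mulrACA -!normCK mulrC ler_wpM2r ?exprn_ge0 ?normr_ge0 //.
by rewrite lerXn2r ?nnegrE ?normr_ge0 ?sp_small.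
Qed.
End Mixing.

End Spectral.

Definition edges (G : sgraph) (U T : {set G}) : nat :=
  (\sum_(x in U) \sum_(y in T) adj x y)%N.

Lemma expander_mixing (R : realType) (n d : nat) (lam : R) (G : sgraph) :
    (0 < n)%N -> ndl_graph n d lam G -> 0 <= lam -> lam < d%:R ->
  forall U T : {set G},
    ((edges U T)%:R - d%:R / n%:R * #|U|%:R * #|T|%:R) ^+ 2
      <= lam ^+ 2 * (#|U|%:R * #|T|%:R).
Proof.
move=> n0 [cG reg [s [[_ charA] s0 sP]]] lam0 gap U T.
pose f : {rmorphism R -> R[i]} := real_complex R.
pose A := map_mx f (adjmx R G).
have size_s : size s = n.
  have := size_char_poly (adjmx R G); rewrite charA size_prod_XsubC cG.
  by case.
case: s => [|a s] in charA s0 sP size_s; first by move: n0; rewrite -size_s.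
rewrite /= in s0; rewrite {}s0 in charA sP size_s *.
have Asym : A \is symmetricmx.
  apply/is_hermitianmxP; rewrite expr0 scale1r; apply/matrixP=> i j.
  by rewrite !mxE adj_sym.
have fnat k : f k%:R = k%:R by rewrite rmorph_nat.
have AE i j : A i j = (adj (enum_val i) (enum_val j))%:R by rewrite !mxE fnat.
have Areal : A \is a mxOver Num.real.
  by apply/mxOverP=> i j; rewrite AE realn.
have sumE (F : G -> R[i]) : \sum_(j < #|G|) F (enum_val j) = \sum_x F x.
  by rewrite [RHS](reindex _ (onW_bij _ (enum_val_bij _))).
have Aspec : char_poly A = \prod_(a <- f d%:R :: [seq f x | x <- s]) ('X - a%:P).
  rewrite -map_char_poly charA rmorph_prod /= !big_cons big_map.
  by congr (_ * _); [|apply: eq_bigr => x _]; rewrite rmorphB /= map_polyX map_polyC.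
have small a0 : a0 \in [seq f x | x <- s] -> `|a0| <= f lam.
  case/mapP=> x xs ->; have -> : `|f x| = f `|x|.
    have [x0|x0] := lerP 0 x; first by rewrite !ger0_norm // -(rmorph0 f) lecR.
    by rewrite !ltr0_norm ?rmorphN // -(rmorph0 f) ltcR.
  rewrite lecR; have := sP (index x s).+1; rewrite /= nth_index //; apply.
  by rewrite -size_s /= ltnS index_mem.
have f0 : 0 <= f lam by rewrite -(rmorph0 f) lecR.
have fgap : f lam < f d%:R by rewrite ltcR.
have regA : (const_mx 1 : 'rV_#|G|) *m A = f d%:R *: const_mx 1.
  apply/rowP=> j; rewrite !mxE mulr1 fnat.
  under eq_bigr do rewrite AE mxE mul1r.
  rewrite (sumE (fun x => (adj x (enum_val j))%:R)) -natr_sum -(reg (enum_val j)).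
  rewrite -sum1_card [in RHS]big_mkcond /=; congr (_%:R); apply: eq_bigr => x _.
  by rewrite inE adj_sym; case: (adj _ _).
have G0 : (0 < #|G|)%N by rewrite cG.
pose ind (S : {set G}) : 'rV[R[i]]_#|G| := \row_j (enum_val j \in S)%:R.
have indr S : map_mx Num.conj (ind S) = ind S.
  by apply/rowP=> j; rewrite !mxE conjC_nat.
have inds S : \sum_j ind S 0 j = #|S|%:R.
  under eq_bigr do rewrite mxE.
  rewrite (sumE (fun x => (x \in S)%:R)) -natr_sum -sum1_card [in RHS]big_mkcond /=.
  by congr (_%:R); apply: eq_bigr => x _; case: (_ \in _).
have indd S : dotmx (ind S) (ind S) = #|S|%:R.
  rewrite dotmxE -(inds S) !mxE; apply: eq_bigr => j _.
  by rewrite !mxE conjC_nat; case: (_ \in _); rewrite ?mulr1 ?mulr0.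
have indA : (ind U *m A *m (ind T)^T) 0 0 = (edges U T)%:R.
  rewrite mxE /edges exchange_big /= natr_sum [RHS]big_mkcond -sumE /=; apply: eq_bigr => j _.
  rewrite !mxE; case: (_ \in T); rewrite ?mulr0 // mulr1 natr_sum [RHS]big_mkcond -sumE /=.
  apply: eq_bigr => i _; rewrite AE mxE; case: (_ \in U); rewrite ?mul1r ?mul0r //.
have := mixing_vectors G0 Asym Areal Aspec small f0 fgap regA (indr U) (indr T).
rewrite !indd indA !inds cG.
set z : R := (edges U T)%:R - d%:R / n%:R * #|U|%:R * #|T|%:R.
have -> : (edges U T)%:R - f d%:R / n%:R * #|U|%:R * #|T|%:R = f z.
  by rewrite /z rmorphB !rmorphM fmorphV !fnat.
rewrite real_normK; last by rewrite realE -!(rmorph0 f) !lecR -realE num_real.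
have -> : (f lam) ^+ 2 * (#|U|%:R * #|T|%:R) = f (lam ^+ 2 * (#|U|%:R * #|T|%:R)).
  by rewrite !rmorphM !fnat.
by rewrite -rmorphXn lecR.
Qed.

(** * Cycle factors and chains of matchings *)

Section CyclesAndChains.
Local Open Scope nat_scope.

Definition nbhd (G : sgraph) (x : G) : {set G} := [set y | adj x y].

Section Factor.
Variables (G : sgraph) (I : finType) (k : nat) (cyc : I -> seq G).
Hypothesis cyc_size : forall x, size (cyc x) = k.
Hypothesis cyc_cycle : forall x, path.cycle (@adj G) (cyc x).
Hypothesis cyc_once : forall v, \sum_x count_mem v (cyc x) = 1.

Lemma cyc_uniq x : uniq (cyc x).
Proof.
apply/count_mem_uniq => v; have := cyc_once v; rewrite (bigD1 x) //= => h.
have : count_mem v (cyc x) <= 1 by rewrite -h leq_addr.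
have := has_count (pred1 v) (cyc x); rewrite has_pred1.
by case: (count_mem v (cyc x)) => [|[|c]] // ->.
Qed.

Lemma cyc_disjoint x y v : v \in cyc x -> v \in cyc y -> x = y.
Proof.
move=> vx vy; apply/eqP/negPn/negP=> xy; have := cyc_once v.
rewrite (bigD1 x) //= (bigD1 y) 1?eq_sym //=.
move: vx vy; rewrite -!has_pred1 !has_count; move: (count_mem v (cyc x)) (count_mem v (cyc y)).
by move=> a b; move: (\sum_(i | _) _) => c; clear; lia.
Qed.

Lemma cyc_nth x (v0 : G) i : i < k -> adj (nth v0 (cyc x) i) (nth v0 (cyc x) (i.+1 %% k)).
Proof.
move=> ik; have := cyc_cycle x; have := cyc_size x; case: (cyc x) => [|a p] /= szk.
  by move: ik; rewrite -szk.
move/(pathP v0) => /(_ i); rewrite size_rcons => /(_ _).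
have ip : i < (size p).+1 by rewrite szk.
move=> /(_ ip); rewrite nth_rcons -rcons_cons nth_rcons /= ip.
move: ip; rewrite ltnS leq_eqVlt => /orP[/eqP ip|ip].
  by rewrite ip ltnn eqxx szk modnn.
by rewrite ip modn_small // -szk ltnS.
Qed.

(** Covering every vertex exactly once makes the cycles disjoint and each of them
    free of repetitions. *)
Lemma factor_of_cycles : has_factor (cycle_graph k) G.
Proof.
have [x0|noI] := pickP (fun _ : I => true); last first.
  exists set0; split=> [f|f g|v]; rewrite ?inE //.
  by have := cyc_once v; rewrite big1 // => x; have := noI x.
have [v0|noG] := pickP (fun _ : G => true); last first.
  exists [set [ffun i : cycle_graph k => x] | x : G]; split=> [f|f g|v].
  - by case/imsetP=> v; have := noG v.
  - by case/imsetP=> v; have := noG v.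
  - by have := noG v.
pose f x : {ffun cycle_graph k -> G} := [ffun i : 'I_k => nth v0 (cyc x) i].
have fin x (i : 'I_k) : f x i \in cyc x by rewrite ffunE mem_nth // cyc_size.
exists [set f x | x : I]; split.
- move=> _ /imsetP[x _ ->]; split.
    move=> i1 i2; rewrite !ffunE => /eqP; rewrite nth_uniq ?cyc_size ?cyc_uniq //.
    by move/eqP/val_inj.
  move=> i1 i2 /= /andP[_ /orP[] /eqP E]; rewrite !ffunE E; last rewrite adj_sym;
  exact: cyc_nth.
- move=> _ _ /imsetP[x _ ->] /imsetP[y _ ->] fxy; rewrite disjoint_subset.
  apply/subsetP=> v /codomP[i1 ->]; rewrite inE; apply/codomP=> -[i2 fij].
  have xy : x = y by apply: (@cyc_disjoint x y (f x i1)); rewrite ?fin // fij fin.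
  by move: fxy; rewrite xy eqxx.
- move=> v; have : exists x, v \in cyc x.
    apply/existsP; apply: contraT; rewrite negb_exists => /forallP no.
    by have := cyc_once v; rewrite big1 // => x _; apply/count_memPn; apply: no.
  case=> x vx; exists (f x); first exact: imset_f.
  have iv : index v (cyc x) < k by rewrite -(cyc_size x) index_mem.
  by apply/codomP; exists (Ordinal iv); rewrite ffunE /= nth_index.
Qed.
End Factor.

Section Chain.
Variables (G : sgraph) (t : nat).
Local Notation I := 'I_t.

Variable rich : {set G} -> Prop.
Hypothesis matching : forall f g : I -> G, injective f -> injective g ->
  rich [set f x | x : I] -> rich [set g x | x : I] ->
  exists2 p : I -> I, injective p & forall x, adj (f x) (g (p x)).

Lemma enum_class (S : {set G}) : #|S| = t ->
  exists2 f : I -> G, injective f & S = [set f x | x : I].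
Proof.
move=> cS; exists (fun x => enum_val (cast_ord (esym cS) x)).
  by move=> x y /enum_val_inj /cast_ord_inj.
apply/setP=> v; apply/idP/imsetP => [vS|[x _ ->]]; last exact: enum_valP.
exists (cast_ord cS (enum_rank_in vS v)) => //.
by rewrite cast_ordK enum_rankK_in.
Qed.

(** Perfect matchings between consecutive classes concatenate to paths that meet
    every class once. *)
Lemma chain (f : I -> G) (X : {set G}) b (c : G -> 'I_b) :
    injective f -> rich [set f x | x : I] ->
    (forall j, #|[set x in X | c x == j]| = t) ->
    (forall j, rich [set x in X | c x == j]) ->
  exists (D : I -> seq G) (g : I -> G),
    [/\ injective g, rich [set g x | x : I],
       forall x, [/\ path (@adj G) (f x) (D x), last (f x) (D x) = g x & size (D x) = b]
     & forall v, \sum_x count_mem v (D x) = (v \in X)].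
Proof.
move=> fI fgood cX gX.
have step j : j <= b -> exists (D : I -> seq G) (g : I -> G),
    [/\ injective g, rich [set g x | x : I],
       forall x, [/\ path (@adj G) (f x) (D x), last (f x) (D x) = g x & size (D x) = j]
     & forall v, \sum_x count_mem v (D x) = ((v \in X) && (c v < j))].
  elim: j => [_|j IH jb].
    exists (fun=> [::]), f; split=> // v; rewrite ltn0 andbF big1 //.
  have [D [g [gI gg Dp Dc]]] := IH (ltnW jb).
  pose j' := Ordinal jb.
  have [g' g'I g'E] := enum_class (cX j').
  have := gX j'; rewrite g'E => gg'.
  have [p pI pa] := matching gI g'I gg gg'.
  have g'pI : injective (g' \o p) by apply: inj_comp.
  have imE : [set (g' \o p) x | x : I] = [set g' x | x : I].
    apply/eqP; rewrite eqEcard !card_imset // leqnn andbT.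
    by apply/subsetP=> v /imsetP[x _ ->]; apply: imset_f.
  exists (fun x => rcons (D x) (g' (p x))), (g' \o p); split=> //.
  - by rewrite imE.
  - move=> x; have [Dpx Dl Ds] := Dp x.
    by rewrite rcons_path Dpx Dl pa last_rcons size_rcons Ds.
  - move=> v; under eq_bigr do rewrite -cats1 count_cat /= addn0.
    rewrite big_split /= Dc.
    have -> : \sum_x (g' (p x) == v) = (v \in [set x in X | c x == j']).
      rewrite g'E -imE; have [/imsetP[y _ ->]|vN] := boolP (v \in _).
        rewrite (bigD1 y) //= eqxx big1 // => x xy; apply/eqP; rewrite eqb0.
        by apply: contra xy => /eqP /g'pI ->.
      rewrite big1 // => x _; apply/eqP; rewrite eqb0; apply: contra vN => /eqP <-.
      by apply/imsetP; exists x.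
    rewrite inE -val_eqE /= ltnS [c v <= j]leq_eqVlt.
    by case: (v \in X) => //=; case: (ltngtP (c v) j).
have [D [g [gI gg Dp Dc]]] := step b (leqnn b).
exists D, g; split=> //.
by move=> v; rewrite Dc ltn_ord andbT.
Qed.
End Chain.

End CyclesAndChains.

(** * Consequences of expander mixing *)

Section Mixed.
Variables (R : realType) (G : sgraph) (n d : nat) (lam : R).
Hypothesis n_gt0 : (0 < n)%N.
Hypothesis d_gt0 : (0 < d)%N.
Hypothesis lam_ge0 : 0 <= lam.
Hypothesis mix : forall U T : {set G},
    ((edges U T)%:R - d%:R / n%:R * #|U|%:R * #|T|%:R) ^+ 2
      <= lam ^+ 2 * (#|U|%:R * #|T|%:R).

Lemma edges_nbhd (U T : {set G}) : edges U T = (\sum_(x in U) #|nbhd x :&: T|)%N.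
Proof.
apply: eq_bigr => x _; rewrite -sum1_card [RHS]big_mkcond /= [LHS]big_mkcond /=.
by apply: eq_bigr => y _; rewrite !inE andbC; case: (y \in T); case: (adj x y).
Qed.

Lemma mixing_joined (m : nat) : lam * n%:R < d%:R * m%:R ->
  forall U T : {set G}, (m <= #|U|)%N -> (m <= #|T|)%N ->
  exists x y, [/\ x \in U, y \in T & adj x y].
Proof.
move=> lm U T mU mT.
have [/existsP[x /existsP[y /and3P[]]]|no] :=
  boolP [exists x, exists y, [&& x \in U, y \in T & adj x y]]; first by exists x, y.
have e0 : edges U T = 0%N.
  rewrite /edges big1 // => x xU; rewrite big1 // => y yT; apply/eqP; rewrite eqb0.
  apply: contra no => xy; apply/existsP; exists x; apply/existsP; exists y.
  by rewrite xU yT.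
have n0 : 0 < n%:R :> R by rewrite ltr0n.
have := mix U T; rewrite e0 sub0r sqrrN.
set u : R := #|U|%:R; set v : R := #|T|%:R => h.
have mu : m%:R <= u by rewrite ler_nat.
have mv : m%:R <= v by rewrite ler_nat.
have m0 : 0 < m%:R :> R.
  rewrite ltr0n lt0n; apply/eqP => m0; move: lm; rewrite m0 mulr0 ltNge.
  by rewrite mulr_ge0 // ler0n.
have uv0 : 0 < u * v by apply: mulr_gt0; apply: lt_le_trans m0 _.
have h1 : (d%:R / n%:R) ^+ 2 * (u * v) <= lam ^+ 2.
  rewrite -(ler_pM2r uv0); apply: le_trans h; rewrite le_eqVlt; apply/orP; left.
  by apply/eqP; ring.
have h2 : (d%:R / n%:R * m%:R) ^+ 2 <= lam ^+ 2.
  apply: le_trans h1; rewrite exprMn ler_wpM2l ?sqr_ge0 // expr2.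
  by apply: ler_pM; rewrite ?ler0n.
have := h2; rewrite ler_pXn2r ?nnegrE //; last by rewrite !mulr_ge0 ?invr_ge0 ?ler0n.
rewrite mulrAC ler_pdivrMr // => h3.
by move: (le_lt_trans h3 lm); rewrite ltxx.
Qed.

(** The factor 4 stands in for a square root: for [#|T| <= 4 * #|U|] the error
    term of the mixing lemma is at most [2 * lam * #|U|]. *)
Lemma mixing_expansion (U T : {set G}) (delta : R) : (0 < #|U|)%N -> (#|T| <= 4 * #|U|)%N ->
  (forall x, x \in U -> delta <= #|nbhd x :&: T|%:R) ->
  delta <= d%:R / n%:R * #|T|%:R + 2 * lam.
Proof.
move=> U0 TU deg.
have lower : delta * #|U|%:R <= (edges U T)%:R.
  rewrite edges_nbhd natr_sum mulr_natr -sumr_const; exact: ler_sum.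
have := mix U T; set z := (edges U T)%:R - _ => zle.
have u0 : 0 < #|U|%:R :> R by rewrite ltr0n.
have tu : #|T|%:R <= 4 * #|U|%:R :> R by rewrite -natrM ler_nat.
have z2 : z ^+ 2 <= (2 * lam * #|U|%:R) ^+ 2.
  apply: le_trans zle _.
  have -> : (2 * lam * #|U|%:R) ^+ 2 = lam ^+ 2 * (#|U|%:R * (4 * #|U|%:R)) by ring.
  by rewrite ler_wpM2l ?sqr_ge0 // ler_wpM2l // ltW.
have zU : z <= 2 * lam * #|U|%:R.
  apply: le_trans (ler_norm z) _; move: z2; rewrite -real_normK ?num_real //.
  by rewrite ler_pXn2r ?nnegrE ?normr_ge0 // !mulr_ge0 ?ler0n.
rewrite -(ler_pM2r u0); apply: le_trans lower _.
have -> : (edges U T)%:R = z + d%:R / n%:R * #|U|%:R * #|T|%:R by rewrite /z subrK.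
apply: le_trans (lerD zU (lexx _)) _; rewrite le_eqVlt; apply/orP; left; apply/eqP; ring.
Qed.

Variables (k t : nat).
Hypothesis nE : n = (k * t)%N.
Hypothesis lam_small : 32 * k%:R * lam <= d%:R.

(** The ratio 5/8 lies strictly between 1/2, needed for Hall's condition in
    classes of [n / k] vertices, and 16/25, the fraction of the mean degree that
    is left, up to two per cent, when two splittings keep 4/5 each. *)
Definition rich (S : {set G}) := forall x : G, (5 * d <= 8 * k * #|nbhd x :&: S|)%N.

Let k0 : 0 < k%:R :> R.
Proof. by rewrite ltr0n; move: n_gt0; rewrite nE muln_gt0 => /andP[]. Qed.
Let t0 : 0 < t%:R :> R.
Proof. by rewrite ltr0n; move: n_gt0; rewrite nE muln_gt0 => /andP[]. Qed.

(** A set whose neighbours in [S] all lie in a set [T] of at most half a class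
    would send to [T] 5/8 of the mean degree of a class, while the mixing lemma
    leaves it little more than 1/2. *)
Lemma no_contraction (U T S : {set G}) : rich S -> (0 < #|U|)%N -> (#|T| <= #|U|)%N ->
  (2 * #|T| <= t)%N -> (forall x, x \in U -> nbhd x :&: S \subset T) -> False.
Proof.
move=> gS U0 TU Tt sub.
have deg x : x \in U -> (5 * d%:R / (8 * k%:R) : R) <= #|nbhd x :&: T|%:R.
  move=> xU; have : (5 * d)%:R <= (8 * k * #|nbhd x :&: T|)%:R :> R.
    rewrite ler_nat; apply: leq_trans (gS x) _; rewrite leq_mul2l; apply/orP; right.
    apply: subset_leq_card; rewrite subsetI subsetIl /=; exact: sub.
  rewrite !natrM ler_pdivrMr ?mulr_gt0 // => h.
  by apply: le_trans h _; rewrite mulrC.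
have TU4 : (#|T| <= 4 * #|U|)%N by apply: leq_trans TU _; rewrite leq_pmull.
have := mixing_expansion U0 TU4 deg.
have Tt' : 2 * #|T|%:R <= t%:R :> R by rewrite -natrM ler_nat.
have d0 : 0 < d%:R :> R by rewrite ltr0n.
rewrite nE natrM.
have -> : d%:R / (k%:R * t%:R) * #|T|%:R = d%:R / k%:R * (#|T|%:R / t%:R) :> R.
  by rewrite invfM; ring.
have tt : #|T|%:R / t%:R <= 1 / 2 :> R.
  by rewrite ler_pdivrMr //; lra.
have -> : 5 * d%:R / (8 * k%:R) = d%:R / k%:R * (5 / 8) :> R by rewrite invfM; ring.
set a := d%:R / k%:R.
have a0 : 0 < a by rewrite divr_gt0.
have la : 32 * lam <= a by rewrite ler_pdivlMr // mulrAC.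
have := ler_wpM2l (ltW a0) tt.
set b := a * (_ / t%:R) => h1 h2; lra.
Qed.

(** A violation [U] of Hall's condition with small neighbourhood contradicts
    [no_contraction] directly; otherwise the complement of the neighbourhood is
    small and violates the condition from the other side. *)
Lemma mixing_matching (f g : 'I_t -> G) : injective f -> injective g ->
  rich [set f x | x : 'I_t] -> rich [set g x | x : 'I_t] ->
  exists2 p : 'I_t -> 'I_t, injective p & forall x, adj (f x) (g (p x)).
Proof.
move=> fI gI gf gg; pose e (x y : 'I_t) := adj (f x) (g y).
apply: (@hall_marriage _ _ e) => U; rewrite leqNgt; apply/negP => lt_NU.
set N := nbrs e setT U in lt_NU.
have inN x y : x \in U -> e x y -> y \in N by move=> xU xy; apply: mem_nbrs xU _ xy; rewrite inE.
have [Nt|Nt] := leqP (2 * #|N|) t.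
  apply: (@no_contraction (f @: U) (g @: N) _ gg); rewrite ?card_imset //.
  - exact: leq_ltn_trans lt_NU.
  - exact: ltnW.
  - move=> _ /imsetP[x xU ->]; apply/subsetP=> v; rewrite !inE => /andP[xv /imsetP[y _ vy]].
    by apply/imsetP; exists y => //; apply: inN xU _; rewrite /e -vy.
have cN := cardsC N; have cU := cardsC U; rewrite card_ord in cN cU.
apply: (@no_contraction (g @: (~: N)) (f @: (~: U)) _ gf); rewrite ?card_imset //.
- by move: (#|U|) (#|N|) (#|~: N|) (#|~: U|) lt_NU cN cU => a b c c'; clear; lia.
- by move: (#|U|) (#|N|) (#|~: N|) (#|~: U|) lt_NU cN cU => a b c c'; clear; lia.
- by move: (#|U|) (#|N|) (#|~: N|) (#|~: U|) lt_NU cN cU Nt => a b c c'; clear; lia.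
- move=> _ /imsetP[y yN ->]; apply/subsetP=> v; rewrite !inE => /andP[yv /imsetP[x _ vx]].
  apply/imsetP; exists x => //; rewrite inE; apply: contraL yN => xU; rewrite inE negbK.
  by apply: inN xU _; rewrite /e -vx adj_sym.
Qed.
End Mixed.

(** * Assembling the cycles *)

Lemma card_ord_lt k a : (a <= k)%N -> #|[set j : 'I_k | (j < a)%N]| = a.
Proof.
move=> ak; have winj : injective (widen_ord ak).
  by move=> i j /(congr1 val) /= /val_inj.
rewrite -[RHS](card_ord a) -(card_imset predT winj).
apply: eq_card => j; rewrite inE; apply/idP/imsetP => [ja|[i _ ->]]; last exact: (ltn_ord i).
by exists (Ordinal ja) => //; apply: val_inj.
Qed.

Lemma sum_count_mem (T : finType) (s : seq T) : (\sum_v count_mem v s = size s)%N.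
Proof.
elim: s => [|a s IH] /=; first by rewrite big1.
rewrite big_split /= IH (bigD1 a) //= eqxx big1 // => v va.
by apply/eqP; rewrite eqb0 eq_sym.
Qed.

Lemma card_classes (T : finType) k (c : T -> 'I_k) (Y : {set T}) (J : {set 'I_k}) :
  (#|[set y in Y | c y \in J]| = \sum_(j in J) #|[set y in Y | c y == j]|)%N.
Proof.
rewrite -sum1_card (partition_big c (mem J)) /=; last by move=> y; rewrite inE => /andP[].
apply: eq_bigr => j jJ; rewrite -sum1_card; apply: eq_bigl => y; rewrite !inE -andbA.
by case: (y \in Y) => //=; case: eqP => [->|]; rewrite ?jJ ?andbF.
Qed.

Lemma second_split_degree (d D w K z : nat) : (392 * d <= 500 * D)%N -> (w <= K)%N ->
  (4 * D <= 5 * w * z)%N -> (5 * d <= 8 * K * z)%N.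
Proof.
move=> h1 h2 h3; have h4 : (5 * w * z <= 5 * K * z)%N by rewrite leq_mul2r leq_mul2l h2 !orbT.
have h5 := leq_trans h3 h4; move: h1 h5; rewrite -!mulnA; move: (K * z)%N => a.
by clear; lia.
Qed.

Section Core.
Variables (R : realType) (G : sgraph) (n d k t h q : nat) (lam : R).
Local Notation L := (2 * up_log 2 t)%N.
Hypothesis nE : n = (k.+1 * t)%N.
Hypothesis cG : #|G| = n.
Hypothesis t_gt0 : (0 < t)%N.
Hypothesis d_gt0 : (0 < d)%N.
Hypothesis reg : regular G d.
Hypothesis lam_ge0 : 0 <= lam.
Hypothesis mix : forall U T : {set G},
    ((edges U T)%:R - d%:R / n%:R * #|U|%:R * #|T|%:R) ^+ 2
      <= lam ^+ 2 * (#|U|%:R * #|T|%:R).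
Hypothesis lam_k : 32 * k.+1%:R * lam <= d%:R.
Hypothesis lam_1000 : 1000 * lam <= d%:R.
Hypothesis lam_h : lam * n%:R < d%:R * (2 ^ h)%:R.
Hypothesis h_n : (4000 * 2 ^ h <= n)%N.
Hypothesis room : (t * (2 * h + 3 + L * (2 * glen h + (2 * h + 3))) + 13 * 2 ^ h <= q * t)%N.
Hypothesis few : (100 * (L + 2 + q) <= 2 * k.+1)%N.
Hypothesis enough : (k.+1 <= 200 * q)%N.
Hypothesis exp_large : (n * n)%:R < expR (d%:R / (120 * k.+1%:R)) :> R.

Let n_gt0 : (0 < n)%N. Proof. by rewrite nE muln_gt0. Qed.
Let k_le_n : (k.+1 <= n)%N. Proof. by rewrite nE leq_pmulr. Qed.
Let fits : (L + 2 + q <= k.+1)%N. Proof. by move: few; move: L => l; clear; lia. Qed.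

Lemma first_split : exists c : G -> 'I_k.+1,
  (forall j, #|[set x | c x == j]| = t) /\
  (forall (x : G) j, (4 * d <= 5 * k.+1 * #|[set y in nbhd x | c y == j]|)%N).
Proof.
have [|||c [c1 c2]] := @equal_split R G G setT (@nbhd G) t k d.
- by rewrite cardsT cG nE mulnC.
- by move=> x; rewrite setIT -(reg x).
- rewrite cG; apply: le_lt_trans (lt_le_trans exp_large _).
    by rewrite ler_nat leq_mul2l k_le_n orbT.
  rewrite ler_expR ler_wpM2l ?ler0n // lef_pV2 ?posrE ?mulr_gt0 ?ltr0n //.
  by rewrite ler_wpM2r ?ler0n //; lra.
exists c; split=> [j|x j].
  by rewrite -[RHS](c1 j); apply: eq_card => x; rewrite !inE.
apply: leq_trans (c2 x j) _; rewrite leq_mul2l; apply/orP; right.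
by rewrite setTI.
Qed.

(** A small set with fewer than three neighbours per vertex in [S] would contradict
    expansion, as all its edges to [S] go to that neighbourhood. *)
Lemma reservoir_extendable (S : {set G}) :
  (forall x, 4 * d * q <= 5 * k.+1 * #|nbhd x :&: S|)%N ->
  state (@adj G) S (2 ^ h) set0 (fun=> 0%N).
Proof.
move=> degS; split=> //; exists [::]; split; [|by move=> v; rewrite inE|by []].
split=> // U cU; rewrite sum_nat_const /= set_nil setD0.
apply: leq_trans (leq_addr _ _); have [->|U0] := posnP #|U|; first by rewrite mul0n.
rewrite leqNgt; apply/negP => small.
set T := nbrs _ _ _ in small.
have TU : (#|T| <= 4 * #|U|)%N by move: small; move: (#|T|) (#|U|) => a b; clear; lia.
have d0 : 0 < d%:R :> R by rewrite ltr0n.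
have k0 : 0 < k.+1%:R :> R by rewrite ltr0n.
have n0 : 0 < n%:R :> R by rewrite ltr0n.
(* As [k.+1 <= 200 * q], every vertex has at least [d / 250] neighbours in [S]. *)
have deg x : x \in U -> (d%:R / 250 : R) <= #|nbhd x :&: T|%:R.
  move=> xU; have : (4 * d * q)%:R <= (5 * k.+1 * #|nbhd x :&: T|)%:R :> R.
    rewrite ler_nat; apply: leq_trans (degS x) _; rewrite leq_mul2l; apply/orP; right.
    apply: subset_leq_card; apply/subsetP=> y; rewrite !inE => /andP[xy yS].
    by rewrite xy yS /=; apply/existsP; exists x; rewrite xU.
  have : k.+1%:R <= 200 * q%:R :> R by rewrite -natrM ler_nat.
  rewrite !natrM; set z := #|_|%:R; set K := k.+1%:R => kq h1.
  rewrite -(ler_pM2l k0) -/K; have := ler_wpM2l (ltW d0) kq; lra.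
have := mixing_expansion lam_ge0 mix U0 TU deg.
have Tm : #|T|%:R <= 6 * (2 ^ h)%:R :> R.
  rewrite -natrM ler_nat; move: small cU; move: (#|T|) (#|U|) (2 ^ h)%N => a b c.
  by clear; lia.
have hn : 4000 * (2 ^ h)%:R <= n%:R :> R by rewrite -natrM ler_nat.
have Tn : #|T|%:R / n%:R <= 6 / 4000 :> R by rewrite ler_pdivrMr //; lra.
rewrite mulrAC -mulrA => h1; have := ler_wpM2l (ltW d0) Tn.
by set w := d%:R * (_ / n%:R) in h1 *; move: lam_1000 d0; lra.
Qed.

(** The routes run from class 0 through the network to class 1, and a chain of
    matchings leads from class 1 through everything else back to class 0. The
    matchings induce a permutation [psi], and the network is set to its inverse. *)
Theorem cycle_factor : has_factor (cycle_graph k.+1) G.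
Proof.
have [c [cT cN]] := first_split.
have classT j : #|[set x | c x == j]| = t := cT j.
have [kap kapI kapE] := fin_all_exists2 (fun j => enum_class (classT j)).
have ckap j x : c (kap j x) = j.
  have : kap j x \in [set y | c y == j] by rewrite kapE imset_f.
  by rewrite inE => /eqP.
have kapJ j1 j2 x1 x2 : kap j1 x1 = kap j2 x2 -> j1 = j2 /\ x1 = x2.
  move=> E; have jj : j1 = j2 by rewrite -(ckap j1 x1) E ckap.
  by split=> //; apply: (kapI j2); rewrite -[in LHS]jj.
(* The classes are used as follows: 0 and 1 hold the ends of the routes, the
   next [L] the gadget roots, the next [q] the reservoir; the rest is untouched. *)
pose cls i : 'I_k.+1 := inord i.
have clsE i : (i < L + 2 + q)%N -> cls i = i :> nat.
  by move=> il; rewrite /cls inordK //; apply: leq_trans il fits.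
have clsI i1 i2 : (i1 < L + 2 + q)%N -> (i2 < L + 2 + q)%N -> cls i1 = cls i2 -> i1 = i2.
  by move=> l1 l2 E; rewrite -(clsE i1 l1) E clsE.
have lt0 : (0 < L + 2 + q)%N by move: (L) => l; clear; lia.
have lt1 : (1 < L + 2 + q)%N by move: (L) => l; clear; lia.
have ltS i : (i < L)%N -> (i.+2 < L + 2 + q)%N by move: (L) => l; clear; lia.
pose JR := [set j : 'I_k.+1 | (L + 2 <= j < L + 2 + q)%N].
pose JB := [set j : 'I_k.+1 | (L + 2 + q <= j)%N].
have cardJR : #|JR| = q.
  have -> : JR = [set j : 'I_k.+1 | (j < L + 2 + q)%N] :\: [set j : 'I_k.+1 | (j < L + 2)%N].
    by apply/setP=> j; rewrite !inE -leqNgt.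
  rewrite cardsD (setIidPr _); last first.
    by apply/subsetP=> j; rewrite !inE => jl; apply: leq_trans jl (leq_addr _ _).
  rewrite !card_ord_lt ?addKn //; exact: leq_trans (leq_addr _ _) fits.
have cardJB : (#|JB| = k.+1 - (L + 2 + q))%N.
  have -> : JB = ~: [set j : 'I_k.+1 | (j < L + 2 + q)%N].
    by apply/setP=> j; rewrite !inE -leqNgt.
  by rewrite cardsCs setCK card_ord card_ord_lt // fits.
pose S := [set x | c x \in JR].
have degJ (J : {set 'I_k.+1}) (x : G) :
    (4 * d * #|J| <= 5 * k.+1 * #|[set y in nbhd x | c y \in J]|)%N.
  rewrite card_classes big_distrr /= mulnC -sum_nat_const; apply: leq_sum => j _.
  exact: cN.
have degS x : (4 * d * q <= 5 * k.+1 * #|nbhd x :&: S|)%N.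
  have := degJ JR x; rewrite cardJR => h1.
  apply: leq_trans h1 _; rewrite leq_mul2l; apply/orP; right.
  by apply: subset_leq_card; apply/subsetP=> y; rewrite !inE.
have cardS : #|S| = (q * t)%N.
  have -> : S = [set x in setT | c x \in JR] by apply/setP=> x; rewrite !inE.
  rewrite card_classes (eq_bigr (fun=> t)) ?sum_nat_const ?cardJR // => j _.
  by rewrite -[RHS](classT j); apply: eq_card => x; rewrite !inE.
have outS i x : (i < L + 2)%N -> kap (cls i) x \notin S.
  move=> il; have il' : (i < L + 2 + q)%N by apply: leq_trans il (leq_addr _ _).
  by rewrite !inE ckap clsE // leqNgt il.
have out2 x : kap (cls 0) x \notin S /\ kap (cls 1) x \notin S.
  by split; apply: outS; move: (L) => l; clear; lia.
have outi i x : (i < L)%N -> kap (cls i.+2) x \notin S.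
  by move=> il; apply: outS; move: il; move: (L) => l; clear; lia.
pose b0 := kap (cls 0); pose bl := kap (cls 1); pose rho i := kap (cls i.+2).
have kapne i1 i2 x y : (i1 < L + 2 + q)%N -> (i2 < L + 2 + q)%N -> i1 != i2 ->
    kap (cls i1) x != kap (cls i2) y.
  by move=> l1 l2; apply: contraNneq => /kapJ[/(clsI _ _ l1 l2) ->].
have joined := mixing_joined n_gt0 lam_ge0 mix lam_h.
have st := reservoir_extendable degS.
have [ss [size_ss ssK ssR]] := benes 'I_t.
rewrite card_ord in size_ss.
have room' : (#|@set0 G| + #|'I_t| * (2 * h + 3 + size ss * (2 * glen h + (2 * h + 3)))
    + 13 * 2 ^ h <= #|S|)%N.
  by rewrite cards0 add0n card_ord size_ss cardS.
have b0P x : occ S set0 (b0 x) /\ (0 < 3)%N by rewrite /occ (out2 x).1.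
have blP x : bl x \notin S /\ 0%N = 0%N by rewrite (out2 x).2.
have rhoP i x : (i < size ss)%N -> rho i x \notin S /\ 0%N = 0%N.
  by rewrite size_ss => il; split=> //; apply: outi.
have rhoI i j x y : (i < size ss)%N -> (j < size ss)%N -> rho i x = rho j y -> i = j /\ x = y.
  rewrite size_ss => il jl /kapJ[/clsI ij ->]; split=> //.
  by have [] := ij (ltS _ il) (ltS _ jl).
have b0l x y : b0 x != bl y by apply: kapne.
have rhol i x y : (i < size ss)%N -> rho i x != bl y.
  by rewrite size_ss => il; apply: kapne; rewrite ?ltS.
have rho0 i x y : (i < size ss)%N -> rho i x != b0 y.
  by rewrite size_ss => il; apply: kapne; rewrite ?ltS.
have adjS : symmetric (@adj G) := @adj_sym G.
have [N [Nsub Nroute]] := network adjS erefl joined ssK (kapI _) (kapI _) b0P blP rhoP rhoI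
  b0l rhol rho0 st room'.
rewrite size_ss in Nsub Nroute.
pose ell := netlen h L.
have cardN : #|N| = (t * ell)%N.
  have [P [Pr Pc]] := Nroute 1%g (ssR 1%g).
  rewrite -sum1_card big_mkcond /=.
  rewrite (eq_bigr (fun v => \sum_x count_mem v (P x))%N); last first.
    by move=> v _; rewrite Pc; case: (v \in N).
  rewrite exchange_big /= (eq_bigr (fun=> ell)) ?sum_nat_const ?card_ord // => x _.
  by rewrite sum_count_mem; have [] := Pr x.
pose B0 := [set b0 x | x : 'I_t].
have cardB0 : #|B0| = t by rewrite card_imset ?card_ord //; exact: kapI.
have dB0 : [disjoint B0 & N].
  rewrite disjoint_subset; apply/subsetP=> v /imsetP[x _ ->]; rewrite inE.
  apply/negP=> /Nsub /or3P[|/codomP[y /eqP]|/existsP[y /existsP[i /eqP/esym/eqP]]].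
  - by rewrite inE (negPf (out2 x).1) andbF.
  - by rewrite (negPf (b0l _ _)).
  - by rewrite (negPf (rho0 _ _ _ _)) // size_ss.
pose X := ~: (B0 :|: N).
have ell_q : (ell <= q.+1)%N.
  rewrite /ell /netlen addSn ltnS -(leq_pmul2l t_gt0) (mulnC t q).
  apply: leq_trans room; apply: leq_trans (leq_addr _ _).
  rewrite leq_mul2l leq_add2l leq_mul2l leq_add2r -[leqLHS]mul1n leq_mul2r.
  by rewrite !orbT.
have ell_k : (ell.+1 <= k)%N.
  apply: leq_ltn_trans ell_q _; move: few; move: (L) => l; clear; lia.
have cardX : #|X| = (t * (k - ell.+1).+1)%N.
  have := cardsC (B0 :|: N); rewrite -/X cG nE.
  have -> : #|B0 :|: N| = (t + t * ell)%N.
    by rewrite cardsU cardB0 cardN; move: dB0; rewrite -setI_eq0 => /eqP ->; rewrite cards0 subn0.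
  rewrite -mulnS => E; apply: (@addnI (t * ell.+1)); rewrite E -mulnDr mulnC; congr (_ * _)%N.
  by move: ell_k; clear; lia.
have BX : [set y | c y \in JB] \subset X.
  apply/subsetP=> y; rewrite !inE => yJ; rewrite negb_or.
  have yk i x : (i < L + 2 + q)%N -> y != kap (cls i) x.
    by move=> il; apply/eqP=> E; move: yJ; rewrite E ckap clsE // leqNgt il.
  apply/andP; split; first by apply/imsetP=> -[x _ /eqP]; rewrite (negPf (yk _ _ lt0)).
  apply/negP=> /Nsub /or3P[|/codomP[x /eqP]|/existsP[x /existsP[i0]]].
  - by rewrite !inE => /andP[_]; rewrite ltnNge yJ andbF.
  - by rewrite (negPf (yk _ _ lt1)).
  - by rewrite (negPf (yk _ _ (ltS _ (ltn_ord i0)))).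
(* At least 98 per cent of the classes are untouched: 392/500 = 49/50 * 4/5. *)
pose D1 := ((392 * d + 499) %/ 500)%N.
have D1P : (392 * d <= 500 * D1)%N by rewrite /D1; clear; lia.
have degX x : (D1 <= #|nbhd x :&: X|)%N.
  have : (392 * d <= 500 * #|nbhd x :&: X|)%N.
    have zX : (#|[set y in nbhd x | c y \in JB]| <= #|nbhd x :&: X|)%N.
      apply: subset_leq_card; apply/subsetP=> y; rewrite !inE => /andP[xy yJ].
      by have := subsetP BX y; rewrite !inE xy yJ => /(_ isT).
    have := degJ JB x; rewrite cardJB.
    have JBl : (98 * k.+1 <= 100 * (k.+1 - (L + 2 + q)))%N.
      by move: few; move: (L) => l; clear; lia.
    move: zX JBl; move: #|nbhd x :&: X| #|[set y in nbhd x | c y \in JB]| => z z'.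
    move: (k.+1 - _)%N (ltn0Sn k); move: k.+1 => K w K0 zz w1 w2.
    have w3 : (4 * d * (98 * K) <= 500 * K * z)%N.
      apply: (@leq_trans (4 * d * (100 * w))%N); first by rewrite leq_mul2l w1 orbT.
      apply: (@leq_trans (100 * (5 * K * z'))%N); first by rewrite mulnCA leq_mul2l w2.
      by rewrite !mulnA leq_mul2l zz orbT.
    by rewrite -(leq_pmul2l K0); apply: leq_trans (leq_trans _ w3) _;
      rewrite leq_eqVlt; apply/orP; left; apply/eqP; clear; lia.
  by rewrite /D1; clear; lia.
have [|c2 [c2T c2N]] := @equal_split R G G X (@nbhd G) t (k - ell.+1) D1 cardX degX.
  rewrite cG; apply: le_lt_trans (lt_le_trans exp_large _).
    by rewrite ler_nat leq_mul2l; apply/orP; right; move: k_le_n; clear; lia.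
  rewrite ler_expR.
  have K0 : 0 < k.+1%:R :> R by rewrite ltr0n.
  have W0 : 0 < (k - ell.+1).+1%:R :> R by rewrite ltr0n.
  have WK : (k - ell.+1).+1%:R <= k.+1%:R :> R by rewrite ler_nat ltnS leq_subr.
  have D1R : 392 * d%:R <= 500 * D1%:R :> R by rewrite -!natrM ler_nat.
  have dR : 0 <= d%:R :> R by rewrite ler0n.
  rewrite ler_pdivrMr ?mulr_gt0 // mulrAC ler_pdivlMr ?mulr_gt0 //.
  have := ler_wpM2l dR WK; have := ler_wpM2r (ltW K0) D1R.
  have : 0 <= D1%:R * k.+1%:R :> R by rewrite mulr_ge0 ?ler0n.
  by move: (k.+1%:R : R) (D1%:R : R) ((k - ell.+1).+1%:R : R) => x y z; lra.
have goodX j : rich d k.+1 [set x in X | c2 x == j].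
  move=> x; have := c2N x j.
  have -> : #|[set y in X :&: nbhd x | c2 y == j]| = #|nbhd x :&: [set y in X | c2 y == j]|.
    by apply: eq_card => y; rewrite !inE; case: (adj x y); rewrite ?andbF ?andbT.
  by apply: (second_split_degree D1P); rewrite ltnS leq_subr.
have good_kap j : rich d k.+1 [set kap j x | x : 'I_t].
  move=> x; have := cN x j; rewrite -kapE.
  have -> : #|[set y in nbhd x | c y == j]| = #|nbhd x :&: [set y | c y == j]|.
    by apply: eq_card => y; rewrite !inE.
  by rewrite -!mulnA; move: (k.+1 * _)%N => z; clear; lia.
have matching_A := mixing_matching n_gt0 d_gt0 lam_ge0 mix nE lam_k.
have [D [g [gI gg Dp Dc]]] :=
  chain matching_A (kapI (cls 1)) (good_kap _) c2T goodX.
have [psi psiI psiA] := matching_A g b0 gI (kapI _) gg (good_kap _).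
pose phi := ((perm psiI)^-1)%g.
have [P [Pr Pc]] := Nroute phi (ssR phi).
have size_cyc x : size (b0 x :: P x ++ D (phi x)) = k.+1.
  have [_ _ Ps] := Pr x; have [_ _ Ds] := Dp (phi x).
  by rewrite /= size_cat Ps Ds -/ell; move: ell_k; clear; lia.
apply: (@factor_of_cycles G _ _ (fun x => b0 x :: P x ++ D (phi x)) size_cyc).
- move=> x; have [Pp Pl _] := Pr x; have [Dpp Dl _] := Dp (phi x).
  rewrite /= rcons_path cat_path last_cat Pp Pl Dpp Dl /=.
  have := psiA (phi x); congr (adj _ (b0 _)).
  by rewrite -(permE psiI) /phi permKV.
- move=> v; rewrite /=; under eq_bigr do rewrite count_cat.
  rewrite !big_split /= Pc.
  have -> : (\sum_x count_mem v (D (phi x)) = (v \in X))%N.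
    by rewrite -Dc [RHS](reindex_inj (@perm_inj _ phi)).
  have -> : (\sum_x (b0 x == v) = (v \in B0))%N.
    have [/imsetP[y _ ->]|vN] := boolP (v \in B0).
      rewrite (bigD1 y) //= eqxx big1 // => x xy; apply/eqP; rewrite eqb0.
      by apply: contra xy => /eqP /kapI ->.
    rewrite big1 // => x _; apply/eqP; rewrite eqb0; apply: contra vN => /eqP <-.
    exact: imset_f.
  rewrite !inE; case: (boolP (v \in B0)) => vB /=; first by rewrite (disjointFr dB0 vB).
  by case: (v \in N).
Qed.

End Core.

(** * Choice of the constants *)

Section Numerics.
Variable R : realType.
Local Notation K := (100 * 1000 : R).

(** Because [exp (1/2) <= 2]. *)
Lemma exponent_le_ln a n : (2 ^ a <= n)%N -> a%:R <= 2 * ln (n%:R : R).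
Proof.
move=> an; have n0 : 0 < n%:R :> R.
  by rewrite ltr0n; apply: leq_trans an; rewrite expn_gt0.
rewrite mulrC -ler_pdivrMr // -ler_expR lnK ?posrE //.
have e2 : expR (1 / 2) <= 2 :> R.
  have h := @expR_ge1Dx R (- (1 / 2)); rewrite expRN in h.
  have e0 : 0 < expR (1 / 2) :> R by exact: expR_gt0.
  by have := ler_wpM2r (ltW e0) h; rewrite mulVf ?gt_eqF //; lra.
have -> : a%:R / 2 = a%:R * (1 / 2) :> R by rewrite div1r.
rewrite expRM_natl; apply: le_trans (_ : (2 ^ a)%:R <= _); last by rewrite ler_nat.
by rewrite natrX lerXn2r ?nnegrE ?expR_ge0.
Qed.

Lemma up_log_le_ln t n : (0 < n)%N -> (t <= n)%N ->
  (2 * up_log 2 t)%:R <= 4 * ln (n%:R : R) + 2.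
Proof.
move=> n0 tn; have l0 : 0 <= ln (n%:R : R) by rewrite ln_ge0 // ler1n.
have [t1|t1] := leqP t 1.
  have -> : up_log 2 t = 0%N by apply/eqP; rewrite up_log_eq0 t1 orbT.
  by rewrite muln0; lra.
have := exponent_le_ln (ltnW (leq_trans (up_log_gtn (isT : 1 < 2)%N t1) tn)).
have : (0 < up_log 2 t)%N by rewrite up_log_gt0.
case: (up_log 2 t) => // u _ /=; rewrite mulnS natrD natrM; lra.
Qed.

(** The sixth power in [exp x >= (x / 6) ^+ 6] beats the fourth power. *)
Lemma ln_pow_le n : (0 < n)%N -> 1000 * (100 * 100) <= ln (n%:R : R) ->
  480 * K * ln (n%:R : R) ^+ 4 <= n%:R.
Proof.
move=> n0 big; set x := ln _ in big *.
have <- : expR x = n%:R by rewrite lnK // posrE ltr0n.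
have x0 : 0 <= x by lra.
have -> : x = 6%:R * (x / 6) by field.
rewrite expRM_natl; set y := x / 6.
have yx : x = 6 * y by rewrite /y; field.
have y0 : 0 <= y by rewrite divr_ge0.
have h : y ^+ 6 <= expR y ^+ 6.
  by rewrite lerXn2r ?nnegrE ?expR_ge0 //; have := @expR_ge1Dx R y; lra.
apply: le_trans h; have -> : 480 * K * (6 * y) ^+ 4 = (480 * K * 6 ^+ 4) * y ^+ 4 by ring.
have -> : y ^+ 6 = y ^+ 2 * y ^+ 4 by ring.
rewrite ler_wpM2r ?exprn_ge0 //.
have yb : 1000 * 1000 <= y by lra.
have : (1000 * 1000) * (1000 * 1000) <= y ^+ 2 by rewrite expr2 ler_pM //; lra.
apply: le_trans; lra.
Qed.

(** Mixing applied to one vertex and its neighbourhood gives [d <= 4 * lam ^+ 2]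
    for [d <= n / 2]; as [lam] is much smaller than [d], this bounds [d] from
    below. *)
Lemma degree_large (G : sgraph) n d (lam : R) :
    (0 < n)%N -> (0 < d)%N -> regular G d -> #|G| = n -> 0 <= lam ->
    (forall U T : {set G}, ((edges U T)%:R - d%:R / n%:R * #|U|%:R * #|T|%:R) ^+ 2
      <= lam ^+ 2 * (#|U|%:R * #|T|%:R)) ->
    1000 * (100 * 100) <= ln (n%:R : R) ->
    lam * (32 * K * ln (n%:R : R) ^+ 3) <= d%:R ->
  240 * K * ln (n%:R : R) ^+ 4 < d%:R.
Proof.
move=> n0 d0 reg cG lam0 mix big lamd; set x := ln _ in big lamd *.
have [dn|dn] := leqP (2 * d) n; last first.
  have := ln_pow_le n0 big; rewrite -/x => h.
  have : n%:R < 2 * d%:R :> R by rewrite -natrM ltr_nat.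
  by move: (x ^+ 4) h => z; lra.
have /card_gt0P[v _] : (0 < #|[set: G]|)%N by rewrite cardsT cG.
have := mix [set v] (nbhd v).
have -> : edges [set v] (nbhd v) = d by rewrite edges_nbhd big_set1 setIid reg.
have -> : #|nbhd v| = d := reg v.
rewrite cards1 mulr1 mul1r => h.
have nR : 0 < n%:R :> R by rewrite ltr0n.
have dR : 0 < d%:R :> R by rewrite ltr0n.
have x0 : 0 < x by lra.
have half : d%:R / 2 <= d%:R - d%:R / n%:R * d%:R :> R.
  have : 2 * d%:R <= n%:R :> R by rewrite -natrM ler_nat.
  move=> dn2; have : d%:R / n%:R <= 1 / 2 :> R by rewrite ler_pdivrMr //; lra.
  by move/(ler_wpM2r (ltW dR)); lra.
have h1 : (d%:R / 2) ^+ 2 <= lam ^+ 2 * d%:R.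
  apply: le_trans h; rewrite lerXn2r ?nnegrE //; first by rewrite divr_ge0 // ltW.
  by apply: le_trans half; rewrite divr_ge0 // ltW.
have h2 : d%:R <= 4 * lam ^+ 2.
  rewrite -(ler_pM2r dR); move: h1; rewrite !expr2.
  by set p := lam * lam; lra.
set c := 32 * K * x ^+ 3 in lamd.
have c0 : 0 < c by rewrite !mulr_gt0 ?exprn_gt0 //; lra.
have h3 : c ^+ 2 * d%:R <= 4 * d%:R ^+ 2.
  apply: le_trans (ler_wpM2l (sqr_ge0 c) h2) _.
  have -> : c ^+ 2 * (4 * lam ^+ 2) = 4 * (lam * c) ^+ 2 by ring.
  rewrite ler_wpM2l // lerXn2r ?nnegrE // ?mulr_ge0 // ltW //.
have h4 : c ^+ 2 <= 4 * d%:R.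
  by rewrite -(ler_pM2r dR); apply: le_trans h3 _; rewrite expr2; lra.
have h5 : 1000 * K * x ^+ 4 < c ^+ 2.
  have -> : c ^+ 2 = (32 ^+ 2 * K ^+ 2 * x ^+ 2) * x ^+ 4 by rewrite /c; ring.
  rewrite ltr_pM2r ?exprn_gt0 //.
  have : 1 <= x ^+ 2 by rewrite exprn_ege1 //; lra.
  lra.
by move: h4 h5; set z := x ^+ 4; lra.
Qed.

Lemma route_length_le (h L : nat) (x : R) : 10 <= x -> h%:R <= 2 * x -> L%:R <= 5 * x ->
  (2 * h + 3 + L * (2 * glen h + (2 * h + 3)))%:R <= 190 * x ^+ 3.
Proof.
move=> x10 hx Lx; have h0 : 0 <= h%:R :> R by [].
have L0 : 0 <= L%:R :> R by [].
have p5 : (2 * h + 3)%:R <= 5 * x by rewrite natrD natrM; lra.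
have p0 : 0 <= (2 * h + 3)%:R :> R by [].
have g16 : (glen h)%:R <= 16 * x ^+ 2.
  have a : h.+1%:R <= 3 * x by rewrite -natr1; lra.
  have b : (2 * h + 3 + 2)%:R <= 5 * x by rewrite (natrD _ _ 2) (natrD _ _ 3) natrM; lra.
  have ab : h.+1%:R * (2 * h + 3 + 2)%:R <= (3 * x) * (5 * x) by apply: ler_pM.
  have xx : 10 * 10 <= x * x by apply: ler_pM; lra.
  by rewrite /glen natrD natrM expr2; lra.
have x2 : 10 * x <= x ^+ 2 by rewrite expr2; apply: ler_wpM2r; lra.
have x3 : 100 * x <= x ^+ 3.
  by rewrite exprS; have := ler_wpM2l (_ : 0 <= x) x2; rewrite mulrCA -expr2; lra.
have s37 : (2 * glen h + (2 * h + 3))%:R <= 37 * x ^+ 2 by rewrite natrD natrM; lra.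
rewrite natrD natrM.
have := ler_pM L0 (ler0n _ _) Lx s37.
have -> : 5 * x * (37 * x ^+ 2) = 185 * x ^+ 3 by ring.
lra.
Qed.
End Numerics.

Theorem theorem6p1 (R : realType) :
  exists (K C : R) (n0 : nat),
    [/\ 0 < K, 0 < C
      & forall n k : nat, (n0 <= n)%N ->
          k%:Z = Num.floor (K * ln (n%:R : R) ^+ 3) -> (k %| n)%N ->
        forall (d : nat) (lambda : R), (0 < d)%N -> 0 < lambda ->
          lambda <= d%:R / (C * ln (n%:R : R) ^+ 3) ->
        forall G : sgraph, ndl_graph n d lambda G ->
          has_factor (cycle_graph k) G].
Proof.
(* [K] makes the routes, of at most [190 * ln n ^+ 3] vertices, a small fraction
   of [k]; the factor 32 gives [32 * k * lam <= d]; and [n] exceeds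
   [480 * K * ln n ^+ 4] once [ln n] is at least [x0]. *)
pose x0 : R := 1000 * (100 * 100).
pose K : R := 100 * 1000.
exists K, (32 * K), (Num.Def.archi_bound (expR x0)); split; rewrite ?mulr_gt0 //.
move=> n k n0n kE kn d lam d0 lam0 lam_le G ndl.
have [cG reg _] := ndl.
have n0 : (0 < n)%N.
  apply: leq_trans n0n; rewrite -(ltr_nat R); apply: le_lt_trans (archi_boundP (expR_ge0 x0)).
  exact: expR_ge0.
have nR : 0 < n%:R :> R by rewrite ltr0n.
set x := ln (n%:R : R) in kE lam_le.
have ex : expR x = n%:R by rewrite lnK.
have big : x0 <= x.
  rewrite -ler_expR ex; apply: le_trans (ltW (archi_boundP (expR_ge0 x0))) _.
  by rewrite ler_nat.
have x10 : 10 <= x by move: big; rewrite /x0; lra.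
have x1 : 0 < x by lra.
have x3 : 0 < x ^+ 3 by rewrite exprn_gt0.
have [k_le k_gt] : k%:R <= K * x ^+ 3 /\ K * x ^+ 3 < k%:R + 1.
  have := floor_itv (K * x ^+ 3); rewrite -kE intrD => /andP[kk kk'].
  by split.
have X3 : 1000 <= x ^+ 3.
  have : 10 ^+ 3 <= x ^+ 3 by rewrite lerXn2r ?nnegrE //; lra.
  by apply: le_trans; lra.
have X31 : x <= x ^+ 3.
  by rewrite -[leLHS]expr1 ler_eXn2l //; move: x10; clear; lra.
have k_big : 99 * 1000 * x ^+ 3 <= k%:R by move: k_gt X3; rewrite /K; lra.
have k1000 : (1000 <= k)%N by rewrite -(ler_nat R); move: k_big X3; lra.
case: k => [//|k] in kE kn k_le k_gt k_big k1000 *.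
pose t := (n %/ k.+1)%N.
have nE : n = (k.+1 * t)%N by rewrite mulnC divnK.
have t0 : (0 < t)%N by move: n0; rewrite nE muln_gt0.
have dR : 0 < d%:R :> R by rewrite ltr0n.
have lamC : lam * (32 * K * x ^+ 3) <= d%:R.
  by rewrite -ler_pdivlMr // !mulr_gt0.
have lamk : 32 * k.+1%:R * lam <= d%:R.
  apply: le_trans lamC; have := ler_wpM2l (ltW lam0) k_le; clear; lra.
have lam1000 : 1000 * lam <= d%:R.
  apply: le_trans lamC; by have := ler_wpM2l (ltW lam0) X3; rewrite /K; move: lam0; clear; lra.
have lam8000 : 8000 * lam <= d%:R.
  apply: le_trans lamC; by have := ler_wpM2l (ltW lam0) X3; rewrite /K; move: lam0; clear; lra.
have gap : lam < d%:R by move: lam1000 lam0; clear; lra.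
have mix := expander_mixing n0 ndl (ltW lam0) gap.
have d_large := degree_large n0 d0 reg cG (ltW lam0) mix big lamC.
(* The search trees have linearly many leaves, enough to be joined by an edge,
   but few compared with the reservoir of about [n / 100] vertices. *)
pose h := trunc_log 2 (n %/ 4000).
have n_big : (4000 <= n)%N.
  rewrite -(ler_nat R); apply: le_trans (ln_pow_le n0 big); rewrite -/x.
  have x4 : 1 <= x ^+ 4 by rewrite exprn_ege1 //; move: x10; clear; lra.
  by move: (x ^+ 4) x4; clear=> y; lra.
have n4000 : (0 < n %/ 4000)%N by rewrite divn_gt0.
have hP : (4000 * 2 ^ h <= n)%N.
  by rewrite mulnC -leq_divRL // trunc_logP.
have hP2 : (n < 2 * (4000 * 2 ^ h))%N.
  have := trunc_log_ltn (n %/ 4000) (isT : 1 < 2)%N.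
  by rewrite -/h ltn_divLR // expnS -mulnA [(2 ^ h * _)%N]mulnC.
have lam_h : lam * n%:R < d%:R * (2 ^ h)%:R.
  have a1 : n%:R < 8000 * (2 ^ h)%:R :> R.
    have a0 : n%:R < 2 * (4000 * (2 ^ h)%:R) :> R by rewrite -!natrM ltr_nat.
    by apply: lt_le_trans a0 _; rewrite mulrA -natrM.
  have a2 := ler_wpM2r (ler0n R (2 ^ h)) lam8000.
  have a3 : lam * n%:R < lam * (8000 * (2 ^ h)%:R) by rewrite ltr_pM2l.
  by apply: lt_le_trans a3 _; apply: le_trans a2; rewrite mulrCA mulrA.
have h_le : h%:R <= 2 * x.
  apply: exponent_le_ln; apply: leq_trans hP; exact: leq_pmull.
have L_le : (2 * up_log 2 t)%:R <= 5 * x.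
  have tn : (t <= n)%N by rewrite nE leq_pmull.
  apply: le_trans (up_log_le_ln R n0 tn) _; rewrite -/x.
  by move: x10; clear; lra.
pose q := (k.+1 %/ 100)%N.
have q100 : (100 * q <= k.+1)%N by rewrite mulnC leq_trunc_div.
have q_gt : (k.+1 < 100 * q + 100)%N by rewrite /q; move: k1000; clear; lia.
have enough : (k.+1 <= 200 * q)%N by move: q_gt k1000; clear; lia.
have few : (100 * (2 * up_log 2 t + 2 + q) <= 2 * k.+1)%N.
  have : (100 * (2 * up_log 2 t + 2) <= k.+1)%N.
    have aux (z y Y w : R) :
        z <= 5 * y -> 99 * 1000 * Y <= w -> y <= Y -> 1000 <= Y -> 100 * (z + 2) <= w.
      by clear; lra.
    by rewrite -(ler_nat R) natrM natrD; apply: aux L_le k_big X31 X3.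
  move: q100; move: (2 * up_log 2 t)%N => z; clear; lia.
have room : (t * (2 * h + 3 + 2 * up_log 2 t * (2 * glen h + (2 * h + 3))) + 13 * 2 ^ h
    <= q * t)%N.
  have len := route_length_le x10 h_le L_le.
  have tR : 0 < t%:R :> R by rewrite ltr0n.
  have h4 : 4000 * (2 ^ h)%:R <= k.+1%:R * t%:R :> R by rewrite -!natrM ler_nat -nE.
  have q4 : k.+1%:R < 100 * q%:R + 100 :> R by rewrite -natrM -natrD ltr_nat.
  rewrite -(ler_nat R) natrD !natrM (mulrC q%:R).
  have len2 := ler_wpM2l (ltW tR) len.
  apply: le_trans (lerD len2 (lexx _)) _.
  have aux1 (y w z : R) : 99 * 1000 * y <= w -> w < 100 * z + 100 -> 1000 <= y ->
      190 * y + 13 / 4000 * w <= z by clear; lra.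
  have main : 190 * x ^+ 3 + 13 / 4000 * k.+1%:R <= q%:R by apply: aux1 k_big q4 X3.
  have aux2 (y z w u v : R) : 4000 * z <= w * u -> u * (190 * y + 13 / 4000 * w) <= u * v ->
      u * (190 * y) + 13 * z <= u * v by clear; lra.
  exact: aux2 h4 (ler_wpM2l (ltW tR) main).
have exp_large : (n * n)%:R < expR (d%:R / (120 * k.+1%:R)) :> R.
  rewrite natrM -ex -expRD ltr_expR ltr_pdivlMr ?mulr_gt0 ?ltr0n //.
  apply: le_lt_trans d_large; rewrite -/x.
  have -> : (x + x) * (120 * k.+1%:R) = 240 * (x * k.+1%:R) by ring.
  have -> : 240 * (100 * 1000) * x ^+ 4 = 240 * (x * (K * x ^+ 3)) by rewrite /K; ring.
  by rewrite ler_pM2l // ler_pM2l.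
exact: (cycle_factor nE cG t0 d0 reg (ltW lam0) mix lamk lam1000 lam_h hP room few enough exp_large).
Qed.
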